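(* Let $\Sigma=\{0,1\}$ and let $(p_{ij})_{i,j\in\Sigma}$ be a transition matrix with $p_{ij}\in(0,1)$ for all $i,j\in\Sigma$ and $p_{ij}\neq \tfrac12$ for some $(i,j)\in\Sigma^2$. Let $\mu=\mu_0\delta_0+\mu_1\delta_1$ be any probability distribution on $\Sigma$, and let $B_n^\mu$ be the number of bucket operations of radix sort (equivalently, the external path length of the trie) built from $n$ independent strings generated by the Markov source with initial distribution $\mu$ and transition matrix $(p_{ij})$. Then, as $n\to\infty$, $$\mathbb{E}[B_n^\mu]=\frac1H n\log n+O(n),\qquad \operatorname{Var}(B_n^\mu)=\sigma^2 n\log n+O\big(n\sqrt{\log n}\big),$$ where $$\sigma^2=\frac{\pi_0 p_{00}p_{01}}{H^3}\Big(\log(p_{00}/p_{01})+\frac{H_1-H_0}{p_{01}+p_{10}}\Big)^2+\frac{\pi_1 p_{10}p_{11}}{H^3}\Big(\log(p_{10}/p_{11})+\frac{H_1-H_0}{p_{01}+p_{10}}\Big)^2.$$ Moreover, $$\frac{B_n^\mu-\mathbb{E}[B_n^\mu]}{\sqrt{\operatorname{Var}(B_n^\mu)}}\xrightarrow{d}\mathcal N(0,1).$$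
   Context: Markov source: each string $\xi_1\xi_2\xi_3\ldots\in\Sigma^{\mathbb N}$ is the sequence of states of a homogeneous Markov chain with $\mathbb P(\xi_1=j)=\mu_j$ and $\mathbb P(\xi_{k+1}=j\mid \xi_k=i)=p_{ij}$; the $n$ strings are i.i.d. The number of bucket operations is $B_n^\mu=\sum_{j=1}^n D_j$, where $D_j$ is the smallest $k\ge0$ such that no other of the $n$ strings has the same first $k$ symbols as string $j$ (so $B_0^\mu=B_1^\mu=0$; equivalently, for $n\ge2$ one inspects the first symbol of each string, splits into two buckets, and recurses on the remaining suffixes, counting $n$ operations per split). Stationary distribution: $\pi_0=p_{10}/(p_{01}+p_{10})$, $\pi_1=p_{01}/(p_{01}+p_{10})$. Entropies: $H_i=-\sum_{j\in\Sigma}p_{ij}\log p_{ij}$ and entropy rate $H=\pi_0H_0+\pi_1H_1$. $\log$ is the natural logarithm. *)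

(* Defs.v *)
From HB Require Import structures.
From mathcomp Require Import all_boot all_order all_algebra.
From mathcomp Require Import all_classical all_reals all_analysis.
Set Implicit Arguments. Unset Strict Implicit. Unset Printing Implicit Defensive.
Import Order.TTheory GRing.Theory Num.Theory.
Local Open Scope ring_scope.

(* Alphabet Sigma = {0,1} is encoded as bool (false = 0, true = 1).
   A family of strings is  s : nat -> nat -> bool,  s j k = (k+1)-th symbol
   of the j-th string (both indices start at 0). *)

Definition agree (s : nat -> nat -> bool) (i j k : nat) : bool :=
  [forall l : 'I_k, s i l == s j l].

Definition sep (n : nat) (s : nat -> nat -> bool) (j k : nat) : bool :=
  [forall i : 'I_n, (val i != j) ==> ~~ agree s i j k].

(* D_j : the smallest such k (0 on the null event where no k exists,
   i.e. when two strings coincide entirely) *)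
Definition depth (n : nat) (s : nat -> nat -> bool) (j : nat) : nat :=
  match pselect (exists k, sep n s j k) with
  | left h => ex_minn h
  | right _ => 0%N
  end.

Definition buckets (n : nat) (s : nat -> nat -> bool) : nat :=
  (\sum_(j < n) depth n s j)%N.

Definition Hent {R : realType} (p : bool -> bool -> R) (i : bool) : R :=
  - (p i false * ln (p i false) + p i true * ln (p i true)).

Definition pi0 {R : realType} (p : bool -> bool -> R) : R :=
  p true false / (p false true + p true false).
Definition pi1 {R : realType} (p : bool -> bool -> R) : R :=
  p false true / (p false true + p true false).

Definition Hrate {R : realType} (p : bool -> bool -> R) : R :=
  pi0 p * Hent p false + pi1 p * Hent p true.

Definition sigma2 {R : realType} (p : bool -> bool -> R) : R :=
  let c := (Hent p true - Hent p false) / (p false true + p true false) in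
  pi0 p * p false false * p false true / Hrate p ^+ 3
    * (ln (p false false / p false true) + c) ^+ 2
  + pi1 p * p true false * p true true / Hrate p ^+ 3
    * (ln (p true false / p true true) + c) ^+ 2.

Definition Phi {R : realType} (x : R) : R :=
  fine (normal_prob 0 1 `]-oo, x]%classic).

(* Main.v *)
(* Splitting [n] strings by their first symbol is binomial, so the mean and the
   variance of the trie of [n] strings following the symbol [i] satisfy
   recurrences [a_i(n) = toll + E (a_0(K) + a_1(n - K))].  Writing
   [a_i(n) = n x_i(n - 1)] (size bias) gives [x_i(m) = s_i + E x_J(K)], where
   [J] is the next symbol of a tagged string and [K] of the [m] other strings
   follow it.  This recurrence obeys a comparison principle, and its solution is
   the harmonic number times the stationary mean of [s] over [H], plus a solution
   of the Poisson equation of the symbol chain, up to a bounded error [w].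
   For the variance, [e_0(k) + e_1(n - k)] is [slope_i * k] plus a remainder; the
   slopes produce [sigma2], and by Efron-Stein the remainder costs at most the
   drift of the bounded function [w^2], which telescopes along the recurrence.
   For the limit law, [E cos (t (B - e) + a)] is compared with its Gaussian value
   at every node of the trie by a Taylor expansion (Lindeberg); the errors add up
   through the same recurrences, and [t] of order [(n log n)^(-1/2)] makes them
   small.  Trigonometric polynomials squeezed around a step function then give
   convergence of the distribution functions. *)
Require Import Defs.
From HB Require Import structures.
From mathcomp Require Import all_boot all_order all_algebra.
From mathcomp Require Import all_classical all_reals all_analysis.
From mathcomp Require Import measurable_realfun.
From mathcomp Require Import ring lra zify.
Import Order.TTheory GRing.Theory Num.Theory numFieldNormedType.Exports.
Local Open Scope ring_scope.
Local Open Scope classical_set_scope.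
Set Implicit Arguments. Unset Strict Implicit. Unset Printing Implicit Defensive.

(** * Binomial splitting *)

(** The recurrences are implicit: all strings of a bucket may share their next symbol, so the value
    at [n] reappears on the right-hand side. What makes comparison possible is a collision
    probability [coll_rate] below [1]; it turns [1 / m.+1] into a barrier that absorbs every error
    of that order. Of [w] only boundedness is known, so its increments are not small one by one;
    this is why an averaged, telescoping bound is used. Two free parameters balance the errors.
    Young's inequality separates the linear part of a split from its remainder with weights [lam]
    and [1 / lam], and [lam = (ln n)^(-1/2)] gives the error [n sqrt (ln n)]. In the Lindeberg step
    [k] plays this role: it is fixed small before [n] tends to infinity. The phase [a] replaces
    complex exponentials: conditioning on one subtrie merely shifts the phase for the other, so the
    induction closes over real cosines. Every law is that of the first [L] levels, hence a finite
    sum. Letting [L] grow uses monotone convergence for moments and an error [coll_rate ^ L] for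
    cosines. *)

(* [Ebin q n F] is the expectation of [F k (n - k)] for [k] binomial with
   parameters [n] and [q false]; the recursion places one string at a time. *)
Fixpoint Ebin {R : realType} (q : bool -> R) (n : nat) (F : nat -> nat -> R) : R :=
  if n is m.+1 then q false * Ebin q m (fun k l => F k.+1 l)
                    + q true * Ebin q m (fun k l => F k l.+1)
  else F 0%N 0%N.

Section Ebin_theory.
Variables (R : realType) (q : bool -> R).
Implicit Types (F G : nat -> nat -> R) (n k l : nat).

Lemma eq_Ebin n F G : (forall k l, (k + l = n)%N -> F k l = G k l) ->
  Ebin q n F = Ebin q n G.
Proof.
elim: n F G => [|n IH] F G h /=; first exact: h.
by congr (_ * _ + _ * _); apply: IH => k l e; apply: h; rewrite ?addnS ?addSn e.
Qed.

Lemma EbinD n F G : Ebin q n (fun k l => F k l + G k l) = Ebin q n F + Ebin q n G.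
Proof. by elim: n F G => [|n IH] F G //=; rewrite !IH; ring. Qed.

Lemma EbinZ n c F : Ebin q n (fun k l => c * F k l) = c * Ebin q n F.
Proof. by elim: n F => [|n IH] F //=; rewrite !IH; ring. Qed.

Lemma EbinN n F : Ebin q n (fun k l => - F k l) = - Ebin q n F.
Proof. by elim: n F => [|n IH] F //=; rewrite !IH; ring. Qed.

Lemma EbinB n F G : Ebin q n (fun k l => F k l - G k l) = Ebin q n F - Ebin q n G.
Proof. by rewrite (EbinD n F (fun k l => - G k l)) EbinN. Qed.

Hypothesis q_sum : q false + q true = 1.

Let qtE : q true = 1 - q false. Proof. by rewrite -q_sum addrC addKr. Qed.

Lemma Ebin_cst n c : Ebin q n (fun _ _ => c) = c.
Proof. by elim: n => [|n IH] //=; rewrite !IH -mulrDl q_sum mul1r. Qed.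

(* Size bias: picking one of the [n.+1] strings at random. *)
Lemma Ebin_sizel n F :
  Ebin q n.+1 (fun k l => k%:R * F k l)
  = n.+1%:R * q false * Ebin q n (fun k l => F k.+1 l).
Proof.
elim: n F => [|n IH] F; first by rewrite /= !mul1r mul0r mulr0 addr0.
have e1 : Ebin q n.+1 (fun k l => k.+1%:R * F k.+1 l)
   = Ebin q n.+1 (fun k l => k%:R * F k.+1 l) + Ebin q n.+1 (fun k l => F k.+1 l).
  by rewrite -EbinD; apply: eq_Ebin => k l _; rewrite -(natr1 k); ring.
rewrite [LHS]/= -/(Ebin q n.+1 _) -/(Ebin q n.+1 (fun k l => k%:R * F k l.+1)).
rewrite [X in q false * X]e1 (IH (fun k l => F k.+1 l)) (IH (fun k l => F k l.+1)).
rewrite -(natr1 n.+1) -(natr1 n) /=; ring.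
Qed.

Lemma Ebin_sizer n F :
  Ebin q n.+1 (fun k l => l%:R * F k l)
  = n.+1%:R * q true * Ebin q n (fun k l => F k l.+1).
Proof.
elim: n F => [|n IH] F; first by rewrite /= !mul1r mul0r mulr0 add0r.
have e1 : Ebin q n.+1 (fun k l => l.+1%:R * F k l.+1)
   = Ebin q n.+1 (fun k l => l%:R * F k l.+1) + Ebin q n.+1 (fun k l => F k l.+1).
  by rewrite -EbinD; apply: eq_Ebin => k l _; rewrite -(natr1 l); ring.
rewrite [LHS]/= -/(Ebin q n.+1 _) -/(Ebin q n.+1 (fun k l => l%:R * F k.+1 l)).
rewrite [X in q true * X]e1 (IH (fun k l => F k l.+1)) (IH (fun k l => F k.+1 l)).
rewrite -(natr1 n.+1) -(natr1 n) /=; ring.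
Qed.

Lemma Ebin_succB n F : Ebin q n.+1 F - Ebin q n F
  = Ebin q n (fun k l => q false * (F k.+1 l - F k l) + q true * (F k l.+1 - F k l)).
Proof.
rewrite /= EbinD !EbinZ !EbinB.
rewrite qtE; ring.
Qed.

Hypothesis q_ge0 : forall i, 0 <= q i.

Lemma le_Ebin n F G : (forall k l, (k + l = n)%N -> F k l <= G k l) ->
  Ebin q n F <= Ebin q n G.
Proof.
elim: n F G => [|n IH] F G h /=; first exact: h.
by apply: lerD; apply: ler_wpM2l => //; apply: IH => k l e; apply: h;
  rewrite ?addnS ?addSn e.
Qed.

Lemma Ebin_ge0 n F : (forall k l, (k + l = n)%N -> 0 <= F k l) -> 0 <= Ebin q n F.
Proof. by move=> h; rewrite -(Ebin_cst n 0); exact: le_Ebin. Qed.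

Lemma Ebin_le n F c : (forall k l, (k + l = n)%N -> F k l <= c) -> Ebin q n F <= c.
Proof. by move=> h; rewrite -[leRHS](Ebin_cst n c); exact: le_Ebin. Qed.

Lemma ler_norm_Ebin n F : `|Ebin q n F| <= Ebin q n (fun k l => `|F k l|).
Proof.
rewrite ler_norml -EbinN; apply/andP; split; apply: le_Ebin => k l _.
  by rewrite lerNl -normrN ler_norm.
exact: ler_norm.
Qed.

Lemma Ebin_sqr_le n F : Ebin q n F ^+ 2 <= Ebin q n (fun k l => F k l ^+ 2).
Proof.
have : 0 <= Ebin q n (fun k l => (F k l - Ebin q n F) ^+ 2).
  by apply: Ebin_ge0 => k l _; exact: sqr_ge0.
rewrite (_ : (fun k l => _) = fun k l =>
  F k l ^+ 2 - ((2 * Ebin q n F) * F k l - Ebin q n F ^+ 2)); last first.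
  by apply/funext => k; apply/funext => l; ring.
rewrite !EbinB EbinZ Ebin_cst.
set a := Ebin q n F; set b := Ebin q n _; nra.
Qed.

Definition Vbin n F := Ebin q n (fun k l => F k l ^+ 2) - Ebin q n F ^+ 2.

Lemma Vbin_ge0 n F : 0 <= Vbin n F.
Proof. by rewrite subr_ge0 Ebin_sqr_le. Qed.

Lemma VbinE n F : Vbin n F = Ebin q n (fun k l => (F k l - Ebin q n F) ^+ 2).
Proof.
rewrite (_ : (fun k l => (_ - _) ^+ 2) = fun k l =>
  F k l ^+ 2 - ((2 * Ebin q n F) * F k l - Ebin q n F ^+ 2)); last first.
  by apply/funext => k; apply/funext => l; ring.
by rewrite !EbinB EbinZ Ebin_cst /Vbin; ring.
Qed.

(** Induction on the strings: the variance is the mean conditional variance given the place of one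
    string, plus the variance between the two conditional means. Jensen bounds the latter by a mean
    squared difference. *)
Lemma Efron_Stein n F : Vbin n.+1 F <=
  n.+1%:R * (q false * q true) * Ebin q n (fun k l => (F k.+1 l - F k l.+1) ^+ 2).
Proof.
elim: n F => [|n IH] F.
  rewrite /Vbin /= mul1r.
  rewrite qtE.
  by rewrite le_eqVlt; apply/orP; left; apply/eqP; ring.
have -> : Vbin n.+2 F = q false * Vbin n.+1 (fun k l => F k.+1 l)
    + q true * Vbin n.+1 (fun k l => F k l.+1)
    + q false * q true * (Ebin q n.+1 (fun k l => F k.+1 l - F k l.+1)) ^+ 2.
  rewrite EbinB /Vbin -[n.+2]/(n.+1.+1).
  set m := n.+1; rewrite /=.
  rewrite qtE.
  by ring.
have h0 := IH (fun k l => F k.+1 l); have h1 := IH (fun k l => F k l.+1).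
have h2 := Ebin_sqr_le n.+1 (fun k l => F k.+1 l - F k l.+1).
set D := fun k l => (F k.+1 l - F k l.+1) ^+ 2.
have eD : Ebin q n.+1 D = q false * Ebin q n (fun k l => D k.+1 l)
   + q true * Ebin q n (fun k l => D k l.+1) by [].
rewrite -(natr1 n.+1) mulrDl mul1r mulrDl eD.
have g0 := ler_wpM2l (q_ge0 false) h0.
have g1 := ler_wpM2l (q_ge0 true) h1.
have g2 := ler_wpM2l (mulr_ge0 (q_ge0 false) (q_ge0 true)) h2.
rewrite -/D eD in g2.
apply: le_trans (lerD (lerD g0 g1) g2) _.
by rewrite /D le_eqVlt; apply/orP; left; apply/eqP; ring.
Qed.

Lemma Ebin_left n : Ebin q n (fun k _ => k%:R) = n%:R * q false.
Proof.
case: n => [|n]; first by rewrite mul0r.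
have := Ebin_sizel n (fun _ _ => 1); rewrite Ebin_cst mulr1 => <-.
by apply: eq_Ebin => k l _; rewrite mulr1.
Qed.

Lemma Ebin_right n : Ebin q n (fun _ l => l%:R) = n%:R * q true.
Proof.
case: n => [|n]; first by rewrite mul0r.
have := Ebin_sizer n (fun _ _ => 1); rewrite Ebin_cst mulr1 => <-.
by apply: eq_Ebin => k l _; rewrite mulr1.
Qed.

End Ebin_theory.

Section Ebin_more.
Variables (R : realType) (q : bool -> R).
Implicit Types (F G : nat -> nat -> R) (n k l : nat).

Lemma Ebin_swap n F : Ebin q n F = Ebin (fun i => q (~~ i)) n (fun k l => F l k).
Proof. by elim: n F => [|n IH] F //=; rewrite !IH addrC. Qed.

Hypothesis q_sum : q false + q true = 1.
Let qtE : q true = 1 - q false. Proof. by rewrite -q_sum addrC addKr. Qed.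

(** [Y] is the centred number of strings following [false]. One more string shifts it by [q true] or
    [- q false], so with a free offset [x] the moment identities below go through by induction. *)
Lemma Ebin_shift n (h : R -> R) (x : R) :
  let Y (k l : nat) := k%:R * q true - l%:R * q false in
  Ebin q n.+1 (fun k l => h (Y k l + x))
  = q false * Ebin q n (fun k l => h (Y k l + (x + q true)))
  + q true * Ebin q n (fun k l => h (Y k l + (x - q false))).
Proof.
move=> Y; rewrite /=; congr (_ * _ + _ * _); apply: eq_Ebin => k l _;
  congr h; rewrite /Y -natr1; ring.
Qed.

Lemma Ebin_sqr_shift n (x : R) :
  Ebin q n (fun k l => (k%:R * q true - l%:R * q false + x) ^+ 2)
  = x ^+ 2 + n%:R * (q false * q true).
Proof.
elim: n x => [|n IH] x; first by rewrite /=; ring.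
rewrite (Ebin_shift n (fun y => y ^+ 2)) !IH -natr1 qtE; ring.
Qed.

Lemma Ebin_quad_shift n (x : R) : let c := q false * q true in
  Ebin q n (fun k l => (k%:R * q true - l%:R * q false + x) ^+ 4)
  = x ^+ 4 + n%:R * c * (6 * x ^+ 2 + 4 * x * (q true - q false) + 1 - 6 * c)
    + 3 * n%:R ^+ 2 * c ^+ 2.
Proof.
elim: n x => [|n IH] x c; first by rewrite /=; ring.
rewrite (Ebin_shift n (fun y => y ^+ 4)) !IH -natr1 /c qtE; ring.
Qed.

Hypothesis q_ge0 : forall i, 0 <= q i.

Lemma Ebin_quad_le n :
  Ebin q n (fun k l => (k%:R * q true - l%:R * q false) ^+ 4) <= n%:R ^+ 2.
Proof.
rewrite (_ : (fun k l => _) = fun k l => (k%:R * q true - l%:R * q false + 0) ^+ 4).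
  rewrite Ebin_quad_shift expr0n /= add0r expr0n /= !mulr0 mul0r !add0r.
  set c := q false * q true.
  have c0 : 0 <= c by rewrite mulr_ge0.
  have c1 : 4 * c <= 1 by rewrite /c qtE; have := sqr_ge0 (2 * q false - 1); nra.
  have n0 : 0 <= n%:R :> R by [].
  have nn : n%:R <= n%:R ^+ 2 :> R by rewrite -natrX ler_nat; case: n {n0} => [|n] //; rewrite leq_pmulr.
  have h1 : n%:R * c * c >= 0 by rewrite !mulr_ge0.
  have h2 : n%:R * c * 4 <= n%:R by nra.
  have h3 : (n%:R * c * 4) ^+ 2 <= n%:R ^+ 2 by rewrite lerXn2r// nnegrE ?mulr_ge0.
  set t := (X in X <= _); have -> : t = n%:R * c - 6 * (n%:R * c * c) + 3 * (n%:R * c) ^+ 2.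
    by rewrite /t; ring.
  by rewrite expr2 in nn; lra.
by apply/funext => k; apply/funext => l; rewrite addr0.
Qed.
End Ebin_more.

(** * Logarithm series and harmonic numbers *)

Lemma geometric_bound (R : realType) (x : R) n : 0 <= x <= 1 ->
  n.+1%:R * x ^+ n * (1 - x) <= 1.
Proof.
move=> /andP[x0 x1].
(* Each of the [n.+1] terms of [1 + x + ... + x ^ n] is at least [x ^ n]. *)
suff : n.+1%:R * x ^+ n * (1 - x) <= 1 - x ^+ n.+1.
  by move=> /le_trans; apply; rewrite gerBl exprn_ge0.
elim: n => [|n IH]; first by rewrite expr0 expr1 !mul1r.
rewrite -[n.+2%:R]natr1 (exprS _ n.+1) (exprS _ n) -(exprS x n).
have h1 : n.+1%:R * x ^+ n.+1 * (1 - x) <= n.+1%:R * x ^+ n * (1 - x).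
  rewrite ler_wpM2r ?subr_ge0// ler_wpM2l// exprS ler_piMl//.
  exact: exprn_ge0.
have := le_trans h1 IH.
by set a := n.+1%:R; set b := x ^+ n.+1; lra.
Qed.

(** As a function of [x], the remainder has derivative [x ^ n / (1 - x)], so the mean value theorem
    bounds it without any infinite series. *)
Lemma ln_taylor (R : realType) (x : R) n : 0 <= x < 1 ->
  `|- ln (1 - x) - \sum_(j < n) x ^+ j.+1 / j.+1%:R| <= x ^+ n.+1 / (1 - x).
Proof.
move=> /andP[x0 x1].
pose f (y : R) := - ln (1 - y) - \sum_(j < n) j.+1%:R^-1 * y ^+ j.+1.
have f0 : f 0 = 0.
  by rewrite /f subr0 ln1 oppr0 sub0r big1 ?oppr0// => j _; rewrite expr0n mulr0.
have -> : - ln (1 - x) - \sum_(j < n) x ^+ j.+1 / j.+1%:R = f x - f 0.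
  by rewrite f0 subr0 /f; congr (_ - _); apply: eq_bigr => j _; rewrite mulrC.
pose df (y : R) := y ^+ n / (1 - y).
have fd (y : R) : y < 1 -> is_derive y 1 f (df y).
  move=> y1; have y1' : 0 < 1 - y by rewrite subr_gt0.
  have h1 : is_derive y 1 (fun y => ln (1 - y)) (- (1 - y)^-1).
    have d1 := is_derive1_ln y1'.
    have d2 : is_derive y 1 (fun y : R => 1 - y) (-1) by rewrite -[-1]sub0r; apply: is_deriveB.
    have -> : - (1 - y)^-1 = (1 - y)^-1 * (-1) by rewrite mulrN1.
    exact: is_derive1_comp.
  have h2 (j : 'I_n) : is_derive y 1 (fun y : R => j.+1%:R^-1 * y ^+ j.+1) (y ^+ j).
    have := @is_deriveZ _ _ _ (fun y : R => y ^+ j.+1) (j.+1%:R^-1) y 1 (j.+1%:R * y ^+ j).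
    rewrite /GRing.scale /= mulKf ?pnatr_eq0//; apply.
    by have := @is_deriveX _ _ id j.+1 y 1 1 _; rewrite [_ *: _]mulr1 exprfctE; apply; exact: is_derive_id.
  have h3 := is_derive_sum h2.
  have -> : df y = - (- (1 - y)^-1) - \sum_(j < n) y ^+ j.
    rewrite opprK /df; apply: (mulIf (lt0r_neq0 y1')).
    rewrite divfK ?lt0r_neq0// mulrBl mulVf ?lt0r_neq0//.
    by have := subrX1 y n; lra.
  rewrite (_ : f = (fun y => - ln (1 - y)) \- (\sum_(j < n) (fun y : R => j.+1%:R^-1 * y ^+ j.+1))).
    by apply: is_deriveB.
  by apply/funext => z; rewrite /f /= fct_sumE.
have [c cx ->] : exists2 c, c \in `[0, x]%R & f x - f 0 = df c * (x - 0).
  apply: (@MVT_segment R f df 0 x x0).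
    by move=> y; rewrite in_itv/= => /andP[_ yx]; apply: fd; exact: lt_trans x1.
  apply: derivable_within_continuous => y; rewrite in_itv/= => /andP[_ yx].
  by have := fd y (le_lt_trans yx x1).
move: cx; rewrite in_itv/= => /andP[c0 cx]; rewrite subr0 /df.
have c1 : 0 < 1 - c by rewrite subr_gt0 (le_lt_trans cx).
rewrite ger0_norm; last by rewrite mulr_ge0// divr_ge0 ?exprn_ge0// ltW.
rewrite exprSr mulrAC; apply: ler_pM => //.
- by rewrite mulr_ge0 // exprn_ge0.
- by rewrite invr_ge0 ltW.
- by apply: ler_wpM2r => //; apply: lerXn2r.
- by rewrite lef_pV2 ?posrE ?subr_gt0 //; lra.
Qed.

Definition harm {R : realType} (n : nat) : R := \sum_(j < n) j.+1%:R^-1.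

Section harm_theory.
Variable R : realType.
Local Notation harm := (@harm R).

Lemma harm0 : harm 0 = 0. Proof. by rewrite /harm big_ord0. Qed.

Lemma harmS n : harm n.+1 = harm n + n.+1%:R^-1.
Proof. by rewrite /harm big_ord_recr. Qed.

Lemma harm_ge0 n : 0 <= harm n.
Proof. by apply: sumr_ge0 => j _; rewrite invr_ge0. Qed.

Lemma ler_harm m n : (m <= n)%N -> harm m <= harm n.
Proof.
move=> /subnK <-; elim: (n - m)%N => [|k IH] //.
by rewrite addSn harmS (le_trans IH)// lerDl invr_ge0.
Qed.

Lemma harm_sub_le m k : (harm (m + k) - harm m) * m.+1%:R <= k%:R.
Proof.
elim: k => [|k IH]; first by rewrite addn0 subrr mul0r.
rewrite addnS harmS addrAC mulrDl -[k.+1%:R]natr1 lerD// mulrC ler_pdivrMr ?ltr0n// mul1r.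
by rewrite ler_nat ltnS leq_addr.
Qed.

(** Passing from [k] to [k + l] raises [harm] by at most [l / k.+1]. This lets [n * harm n] at a
    node be exchanged for the sum over its two children at cost [n]. *)
Lemma nharm_split k l :
  0 <= (k + l)%:R * harm (k + l) - k%:R * harm k - l%:R * harm l <= (k + l)%:R.
Proof.
have h1 : harm k <= harm (k + l) by apply: ler_harm; rewrite leq_addr.
have h2 : harm l <= harm (k + l) by apply: ler_harm; rewrite leq_addl.
have g1 := harm_sub_le k l; have g2 := harm_sub_le l k.
have k0 : 0 <= k%:R :> R by []. have l0 : 0 <= l%:R :> R by [].
move: h1 h2 g1 g2; rewrite (addnC l k) -2!natr1 natrD.
by set a := harm (k + l); nra.
Qed.

Lemma ln_succ_le_harm n : ln n.+1%:R <= harm n.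
Proof.
elim: n => [|n IH]; first by rewrite harm0 ln1.
rewrite harmS (_ : n.+2%:R = n.+1%:R * (1 + n.+1%:R^-1)); last first.
  by rewrite mulrDr mulr1 divff ?pnatr_eq0// natr1.
have h0 : 0 < n.+1%:R^-1 :> R by rewrite invr_gt0 ltr0n.
rewrite lnM ?posrE ?ltr0n ?addr_gt0// lerD// le_ln1Dx//.
by rewrite (lt_trans _ h0)// ltrN10.
Qed.

Lemma harm_le_ln n : harm n.+1 <= 1 + ln n.+1%:R.
Proof.
elim: n => [|n IH]; first by rewrite harmS harm0 ln1 add0r addr0 invr1.
have h0 : 0 < n.+2%:R^-1 :> R by rewrite invr_gt0 ltr0n.
have h1 : n.+2%:R^-1 < 1 :> R by rewrite invf_lt1 ?ltr0n// ltr1n.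
have e : n.+1%:R = n.+2%:R * (1 - n.+2%:R^-1) :> R.
  by rewrite mulrBr mulr1 divff ?pnatr_eq0// -[n.+2%:R]natr1 addrK.
have := IH; rewrite e lnM ?posrE ?ltr0n ?subr_gt0// => {}IH.
have : ln (1 - n.+2%:R^-1) <= - n.+2%:R^-1 :> R by apply: le_ln1Dx; rewrite ltrN2.
by rewrite (harmS n.+1); move: IH; set a := n.+2%:R^-1; set b := ln (1 - a); lra.
Qed.

Lemma ln_le_harm n : ln n%:R <= harm n.
Proof.
case: n => [|n]; first by rewrite harm0 ln0.
by apply: le_trans (ln_succ_le_harm n) _; apply: ler_harm.
Qed.

End harm_theory.

(** * Harmonic numbers of binomial variables *)

Section harm_binomial.
Variables (R : realType) (q : bool -> R).
Hypothesis q_sum : q false + q true = 1.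
Hypothesis q_ge0 : forall i, 0 <= q i.
Hypothesis q_gt0 : 0 < q false.
Local Notation harm := (@harm R).
Let qtE : q true = 1 - q false. Proof. by rewrite -q_sum addrC addKr. Qed.
Let qt01 : 0 <= q true < 1.
Proof. by rewrite q_ge0 /= qtE ltrBlDr ltrDl. Qed.

Lemma Ebin_posl n : Ebin q n (fun k _ => (0 < k)%N%:R) = 1 - q true ^+ n.
Proof.
elim: n => [|n IH]; first by rewrite /= subrr.
by rewrite /= Ebin_cst// IH exprS qtE; ring.
Qed.

(** Size bias applied to [1 / k], since [k * k^-1] is the indicator of [0 < k]. *)
Lemma Ebin_invSl n :
  Ebin q n (fun k _ => k.+1%:R^-1) = (1 - q true ^+ n.+1) / (n.+1%:R * q false).
Proof.
have h : n.+1%:R * q false != 0 by rewrite mulf_neq0 ?pnatr_eq0// gt_eqF.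
apply: (mulIf h); rewrite divfK// -Ebin_posl mulrC.
rewrite -(Ebin_sizel q n (fun k _ => k%:R^-1)).
by apply: eq_Ebin => -[|k] l _; rewrite ?mul0r// mulfV ?pnatr_eq0.
Qed.

(** [(k + 1)^-2] is at most [2 / ((k + 1) (k + 2))], and two size-bias steps turn the mean of this
    quotient into that of a variable bounded by [1]. *)
Lemma Ebin_invSl_sqr_le n :
  Ebin q n (fun k _ => (k.+1%:R^-1) ^+ 2) <= 2 / (n.+1%:R ^+ 2 * q false ^+ 2).
Proof.
have h1 : 0 < n.+1%:R * q false by rewrite mulr_gt0// ltr0n.
have h2 : 0 < n.+2%:R * q false by rewrite mulr_gt0// ltr0n.
apply: (@le_trans _ _ (2 * Ebin q n (fun k _ => (k.+2%:R * k.+1%:R)^-1))).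
  rewrite -EbinZ; apply: le_Ebin => // k l _.
  rewrite invfM expr2 mulrA ler_pM2r ?invr_gt0 ?ltr0n//.
  rewrite ler_pdivlMr ?ltr0n// mulrC ler_pdivrMr ?ltr0n//.
  by rewrite -natrM ler_nat mulnC; lia.
rewrite ler_pM2l// -exprMn -[leRHS]mul1r ler_pdivlMr ?exprn_gt0//.
apply: (@le_trans _ _ (n.+2%:R * q false * (n.+1%:R * q false *
   Ebin q n (fun k _ => (k.+2%:R * k.+1%:R)^-1)))).
  rewrite mulrC mulrA ler_wpM2r//.
    by apply: Ebin_ge0 => // k l _; rewrite invr_ge0 mulr_ge0.
  rewrite expr2 ler_pM2r// ler_pM2r// ler_nat.
  by [].
rewrite -(Ebin_sizel q n (fun k _ => (k.+1%:R * k%:R)^-1)).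
rewrite -(Ebin_sizel q n.+1 (fun k _ => (k.-1)%:R * (k%:R * (k.-1)%:R)^-1)).
apply: Ebin_le => // -[|[|k]] l _; rewrite ?mul0r ?mulr0// mulrA mulfV//.
by rewrite mulf_neq0 ?pnatr_eq0.
Qed.

(** One more string raises the mean of [harm] by [(1 - q true ^ n.+1) / n.+1], so the deficit
    against [harm n] is a partial sum of the series of [- ln (1 - q true)]. Its limit
    [- ln (q false)] is where the entropies come from. *)
Lemma Ebin_harm n :
  Ebin q n (fun k _ => harm k) = harm n - \sum_(j < n) q true ^+ j.+1 / j.+1%:R.
Proof.
elim: n => [|n IH]; first by rewrite /= big_ord0 subr0.
have := Ebin_succB q_sum n (fun k _ => harm k).
rewrite [RHS](@eq_Ebin _ q n _ (fun k _ => q false * k.+1%:R^-1)); last first.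
  by move=> k l _; rewrite harmS subrr mulr0 addr0 addrAC subrr add0r.
rewrite EbinZ Ebin_invSl => /eqP; rewrite subr_eq => /eqP ->.
rewrite IH harmS big_ord_recr /=.
have h : n.+1%:R != 0 :> R by rewrite pnatr_eq0.
have h' : q false != 0 by rewrite gt_eqF.
by field; rewrite ?h ?h' ?nat1r ?pnatr_eq0 //=; apply/negP; lra.
Qed.

Lemma Ebin_harm_approx n :
  `|Ebin q n (fun k _ => harm k) - harm n - ln (q false)| <= (q false ^+ 2 * n.+1%:R)^-1.
Proof.
rewrite Ebin_harm (addrAC (harm n)) subrr sub0r.
have -> : q false = 1 - q true by rewrite qtE opprB addrC subrK.
rewrite [X in `|X|]addrC.
apply: le_trans (ln_taylor n qt01) _.
have qf : 0 < 1 - q true by rewrite subr_gt0; case/andP: qt01.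
have n0 : 0 < n.+1%:R :> R by rewrite ltr0n.
rewrite ler_pdivrMr// -ler_pdivrMl ?invr_gt0 ?mulr_gt0 ?exprn_gt0// invrK.
have g := geometric_bound n (_ : 0 <= q true <= 1).
have {}g : n.+1%:R * q true ^+ n * (1 - q true) <= 1.
  by apply: g; case/andP: qt01 => -> /ltW ->.
set t := (X in X <= _); have -> : t =
    (n.+1%:R * q true ^+ n * (1 - q true)) * q true * (1 - q true).
  by rewrite /t (exprS (q true)); ring.
rewrite ler_piMl ?(ltW qf)// mulr_ile1 ?q_ge0//; last by case/andP: qt01 => _ /ltW.
by rewrite !mulr_ge0 ?exprn_ge0 ?q_ge0// ltW.
Qed.

(** Variance plus squared bias: Efron-Stein with increments [1 / k.+1] for the former,
    [Ebin_harm_approx] for the latter. *)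
Lemma Ebin_harm_sqr : exists2 C : R, 0 <= C & forall n,
  Ebin q n (fun k _ => (harm k - harm n - ln (q false)) ^+ 2) <= C / n.+1%:R.
Proof.
exists (4 / q false + (q false ^+ 4)^-1) => [|n].
  by rewrite addr_ge0// ?invr_ge0 ?divr_ge0 ?exprn_ge0// ltW.
have bias := Ebin_harm_approx n.
have n0 : 0 < n.+1%:R :> R by rewrite ltr0n.
have c0 : 0 < q false ^+ 2 * n.+1%:R by rewrite mulr_gt0 ?exprn_gt0.
set B := Ebin q n (fun k _ => harm k) in bias *.
have bias2 : (B - harm n - ln (q false)) ^+ 2 <= (q false ^+ 4)^-1 / n.+1%:R.
  rewrite -[leLHS]ger0_norm ?sqr_ge0// normrX.
  apply: (@le_trans _ _ ((q false ^+ 2 * n.+1%:R)^-1 ^+ 2)).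
    by rewrite lerXn2r// nnegrE // invr_ge0 ltW.
  rewrite exprVn -invfM lef_pV2 ?posrE ?exprn_gt0 ?mulr_gt0 ?exprn_gt0//.
  rewrite exprMn -exprM ler_wpM2l ?exprn_ge0 ?(ltW q_gt0)// expr2.
  by rewrite ler_peMr// ler1n.
have var : Vbin q n (fun k _ => harm k) <= 4 / q false / n.+1%:R.
  case: n {bias bias2 B} n0 c0 => [|n] n0 c0.
    by rewrite /Vbin /= subrr !divr_ge0// ltW.
  apply: le_trans (Efron_Stein _ _ _ _) _ => //.
  rewrite (@eq_Ebin _ q n _ (fun k _ => (k.+1%:R^-1) ^+ 2)); last first.
    by move=> k l _; rewrite harmS addrAC subrr add0r.
  apply: (@le_trans _ _ (n.+1%:R * q false * (2 / (n.+1%:R ^+ 2 * q false ^+ 2)))).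
    apply: ler_pM => //.
    - by rewrite !mulr_ge0.
    - by apply: Ebin_ge0 => // k l _; rewrite sqr_ge0.
    - by rewrite mulrA ler_piMr ?mulr_ge0// ltW//; case/andP: qt01.
    - exact: Ebin_invSl_sqr_le.
  have nn : n.+1%:R <= n.+2%:R :> R by rewrite ler_nat.
  have h1 : 0 < n.+1%:R :> R by rewrite ltr0n.
  rewrite ler_pdivlMr ?ltr0n// ler_pdivlMr//.
  set t := (X in X <= _); have -> : t = 2 * (n.+2%:R / n.+1%:R).
    by rewrite /t; field; rewrite (gt_eqF q_gt0) /= -?natrD ?nat1r ?natr1 ?pnatr_eq0.
  rewrite (_ : 4 = 2 * 2)%R ?ler_pM2l ?ler_pdivrMr -?natrM ?ler_nat//; first by lia.
have -> : Ebin q n (fun k _ => (harm k - harm n - ln (q false)) ^+ 2)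
   = Vbin q n (fun k _ => harm k) + (B - harm n - ln (q false)) ^+ 2.
  set c := harm n + ln (q false).
  rewrite (_ : (fun k _ => _) = fun k _ =>
    harm k ^+ 2 - ((2 * c) * harm k - c ^+ 2)); last first.
    by apply/funext => k; apply/funext => l; rewrite /c; ring.
  by rewrite !EbinB EbinZ Ebin_cst// /Vbin /c -/B; ring.
by rewrite mulrDl lerD.
Qed.
End harm_binomial.

(** * Recurrences over the trie *)

Lemma cvg_Ebin (R : realType) (q : bool -> R) n
    (F : nat -> nat -> nat -> R) (G : nat -> nat -> R) :
  (forall k l, F L k l @[L --> \oo] --> G k l) ->
  Ebin q n (F L) @[L --> \oo] --> Ebin q n G.
Proof.
elim: n F G => [|n IH] F G FG /=; first exact: FG.
by apply: cvgD; apply: cvgM; [exact: cvg_cst|apply: IH|exact: cvg_cst|apply: IH]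
  => k l; exact: FG.
Qed.

Section trie_operators.
Variables (R : realType) (p : bool -> bool -> R).
Implicit Types (x y : bool -> nat -> R).

Definition split_sum x i n : R := Ebin (p i) n (fun k l => x false k + x true l).

(* The transition operator of the chain (previous symbol, number of other
   strings in the same bucket) followed by one tagged string. *)
Definition tag_op x i m : R :=
  Ebin (p i) m (fun k l => p i false * x false k + p i true * x true l).

Lemma tag_opD x y i m :
  tag_op (fun i m => x i m + y i m) i m = tag_op x i m + tag_op y i m.
Proof. by rewrite /tag_op -EbinD; apply: eq_Ebin => k l _; ring. Qed.

Lemma tag_opZ c x i m : tag_op (fun i m => c * x i m) i m = c * tag_op x i m.
Proof. by rewrite /tag_op -EbinZ; apply: eq_Ebin => k l _; ring. Qed.

Lemma tag_opB x y i m :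
  tag_op (fun i m => x i m - y i m) i m = tag_op x i m - tag_op y i m.
Proof. by rewrite /tag_op -EbinB; apply: eq_Ebin => k l _; ring. Qed.

Lemma split_sumZ c x i m :
  split_sum (fun i m => c * x i m) i m = c * split_sum x i m.
Proof. by rewrite /split_sum -EbinZ; apply: eq_Ebin => k l _; ring. Qed.

Hypothesis p01 : forall i j, 0 < p i j < 1.
Hypothesis p_sum : forall i, p i false + p i true = 1.
Let p_gt0 i j : 0 < p i j. Proof. by case/andP: (p01 i j). Qed.
Let p_ge0 i j : 0 <= p i j. Proof. exact: ltW. Qed.
Let p_lt1 i j : p i j < 1. Proof. by case/andP: (p01 i j). Qed.
Let ptE i : p i true = 1 - p i false. Proof. by rewrite -(p_sum i) addrC addKr. Qed.

Lemma split_sum_tag x i n :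
  split_sum (fun j n => n%:R * x j n.-1) i n.+1 = n.+1%:R * tag_op x i n.
Proof.
rewrite /split_sum EbinD (Ebin_sizel (p i) n (fun k _ => x false k.-1)).
rewrite (Ebin_sizer (p i) n (fun _ l => x true l.-1)) /tag_op EbinD !EbinZ /=.
ring.
Qed.

Lemma tag_op_cst c i m : tag_op (fun _ _ => c) i m = c.
Proof. by rewrite /tag_op Ebin_cst// -mulrDl p_sum mul1r. Qed.

(** The largest probability, over the current symbol, that two independent strings sharing it also
    share the next one. *)
Definition coll_rate : R :=
  Num.max (p false false ^+ 2 + p false true ^+ 2)
          (p true false ^+ 2 + p true true ^+ 2).

Lemma coll_rateP i : p i false ^+ 2 + p i true ^+ 2 <= coll_rate.
Proof. by case: i; rewrite le_max lexx ?orbT. Qed.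

Lemma coll_rate_lt1 : coll_rate < 1.
Proof.
rewrite gt_max; have h i : p i false ^+ 2 + p i true ^+ 2 < 1.
  rewrite ptE; have := p_gt0 i false; have := p_lt1 i false; nra.
by rewrite !h.
Qed.

Lemma coll_rate_ge0 : 0 <= coll_rate.
Proof. by apply: le_trans (coll_rateP false); rewrite addr_ge0 ?sqr_ge0. Qed.

Let gap_gt0 : 0 < 1 - coll_rate. Proof. by rewrite subr_gt0 coll_rate_lt1. Qed.

(** A minimum principle, needed because the value at [m] occurs on both sides. At the state where
    the value [d] is least, suppose [d < 0]. By induction the chord [d * a / m] lies below [x] for
    all [a <= m], and its image under the operator is at least [d * coll_rate], which exceeds
    [d]. *)
Lemma tag_compare x : (forall i, 0 <= x i 0%N) ->
  (forall i m, (0 < m)%N -> tag_op x i m <= x i m) -> forall i m, 0 <= x i m.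
Proof.
move=> x0 xT i m; move: m i; elim/ltn_ind => m IH i.
case: m IH => [|m] IH; first exact: x0.
pose j := if x false m.+1 <= x true m.+1 then false else true.
have jmin k : x j m.+1 <= x k m.+1.
  by rewrite /j; case: (leP (x false _) (x true _)); case: k => // /ltW.
apply: le_trans (jmin i); rewrite leNgt; apply/negP => d0.
set d := x j m.+1 in d0 jmin.
have n0 : 0 < m.+1%:R :> R by rewrite ltr0n.
have low k (a : nat) : (a <= m.+1)%N -> d * (a%:R / m.+1%:R) <= x k a.
  rewrite leq_eqVlt => /orP[/eqP ->|am].
    by rewrite divff ?gt_eqF// mulr1.
  apply: le_trans (IH a am k); by rewrite nmulr_rle0// divr_ge0.
have : d * coll_rate <= tag_op x j m.+1.
  apply: (@le_trans _ _ (d * (p j false ^+ 2 + p j true ^+ 2))).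
    by rewrite ler_nM2l// coll_rateP.
  have -> : d * (p j false ^+ 2 + p j true ^+ 2) =
    tag_op (fun _ a => d * (a%:R / m.+1%:R)) j m.+1.
    rewrite /tag_op EbinD !EbinZ.
    rewrite (@eq_Ebin _ _ _ _ (fun k _ => m.+1%:R^-1 * k%:R)); last by move=> *; rewrite mulrC.
    rewrite [X in _ = _ + _ * (_ * X)](@eq_Ebin _ _ _ _ (fun _ k => m.+1%:R^-1 * k%:R)); last by move=> *; rewrite mulrC.
    by rewrite !EbinZ Ebin_left// Ebin_right//; field; rewrite gt_eqF//= nat1r.
  apply: le_Ebin => // k l kl; apply: lerD; rewrite ler_wpM2l// low//; lia.
move/le_trans/(_ (xT j m.+1 isT)); rewrite -/d.
have := coll_rate_lt1; nra.
Qed.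

(** The barrier: the operator multiplies [1 / m.+1] by at least [2 - coll_rate], a gain of
    [(1 - coll_rate) / m.+1]. *)
Lemma tag_op_invS i m : (0 < m)%N ->
  (2 - coll_rate) / m.+1%:R <= tag_op (fun _ a => a.+1%:R^-1) i m.
Proof.
move=> m0.
rewrite /tag_op EbinD !EbinZ Ebin_invSl// Ebin_swap Ebin_invSl//; last first.
  by rewrite addrC.
have n0 : 0 < m.+1%:R :> R by rewrite ltr0n.
set t := (X in _ <= X).
have -> : t = (2 - (p i false ^+ m.+1 + p i true ^+ m.+1)) / m.+1%:R.
  by rewrite /t /=; field; rewrite !gt_eqF//= nat1r.
rewrite ler_pM2r ?invr_gt0// lerD2l lerN2 (le_trans _ (coll_rateP i))//.
by apply: lerD; rewrite ler_wiXn2l// ltW.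
Qed.

Lemma tag_upper x (C : R) : 0 <= C ->
  (forall i m, (0 < m)%N -> x i m <= tag_op x i m + C / m.+1%:R) ->
  forall i m, x i m <= C / (1 - coll_rate) + `|x false 0%N| + `|x true 0%N|.
Proof.
move=> C0 xT i m; set D := C / _.
have D0 : 0 <= D by rewrite divr_ge0// ltW.
have De : D * (1 - coll_rate) = C by rewrite /D divfK// gt_eqF.
move: D D0 De => D D0 De.
(* The supersolution is [K - D / m.+1]: the gain of the barrier times [D] is exactly the error
   [C / m.+1], and the two norms in [K] make it dominate at [m = 0]. *)
set K := D + _ + _.
suff : 0 <= K - D * m.+1%:R^-1 - x i m.
  have : 0 <= D * m.+1%:R^-1 by rewrite mulr_ge0// invr_ge0.
  by set a := D * _; lra.
pose y j a := K - D * a.+1%:R^-1 - x j a.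
apply: (@tag_compare y) => {i m} [i|i m m0].
  rewrite /y /K invr1 mulr1; have := ler_norm (x false 0%N).
  by have := ler_norm (x true 0%N); have := normr_ge0 (x false 0%N);
   have := normr_ge0 (x true 0%N); case: i; lra.
rewrite /y tag_opB (tag_opB (fun _ _ => K)) tag_op_cst tag_opZ.
have := tag_op_invS i m0; have := xT i m m0.
rewrite -De.
set t := tag_op (fun _ a => a.+1%:R^-1) i m; set s := tag_op x i m.
set u := m.+1%:R^-1 => h1 h2.
have h3 : D * ((2 - coll_rate) * u) <= D * t by rewrite ler_wpM2l.
by move: h1 h3; rewrite -/s; lra.
Qed.

Lemma tag_bounded x (C : R) : 0 <= C ->
  (forall i m, (0 < m)%N -> `|x i m - tag_op x i m| <= C / m.+1%:R) ->
  exists2 K : R, 0 <= K & forall i m, `|x i m| <= K.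
Proof.
move=> C0 xT.
have h1 i m : (0 < m)%N -> x i m <= tag_op x i m + C / m.+1%:R.
  by move=> m0; have := xT i m m0; rewrite ler_norml => /andP[_]; rewrite lerBlDl.
have h2 i m : (0 < m)%N ->
    (-1) * x i m <= tag_op (fun i m => (-1) * x i m) i m + C / m.+1%:R.
  move=> m0; rewrite (tag_opZ (-1) x).
  by have := xT i m m0; rewrite ler_norml => /andP[h _]; rewrite !mulN1r;
    move: h; set s := tag_op _ _ _; set u := C / _; lra.
have D0 : 0 <= C / (1 - coll_rate) by rewrite divr_ge0// ltW.
exists (C / (1 - coll_rate) + `|x false 0%N| + `|x true 0%N|) => [|i m].
  by rewrite !addr_ge0.
have := tag_upper C0 h1 i m; have := tag_upper C0 h2 i m.
by rewrite !mulN1r !normrN ler_norml lerNl => -> ->.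
Qed.

End trie_operators.

(** * The law of the truncated trie *)

Definition toll (n : nat) : nat := if (n < 2)%N then 0%N else n.

(* [trie_law p L i n f] is the expectation of [f B], where [B] is the number of
   bucket operations on the first [L] levels of the trie of [n] strings whose
   first symbols are drawn from [p i]. *)
Fixpoint trie_law {R : realType} (p : bool -> bool -> R) (L : nat) (i : bool)
    (n : nat) (f : nat -> R) : R :=
  if L is L'.+1 then
    Ebin (p i) n (fun k l => trie_law p L' false k (fun x =>
      trie_law p L' true l (fun y => f (toll n + x + y)%N)))
  else f 0%N.

Section trie_law_theory.
Variables (R : realType) (p : bool -> bool -> R).
Implicit Types (f g : nat -> R) (L n : nat) (i : bool).
Local Notation law := (trie_law p).

Lemma eq_trie_law L i n f g : f =1 g -> law L i n f = law L i n g.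
Proof.
elim: L i n f g => [|L IH] i n f g fg /=; first exact: fg.
by apply: eq_Ebin => k l _; apply: (IH) => x; apply: (IH) => y.
Qed.

Lemma trie_lawD L i n f g :
  law L i n (fun x => f x + g x) = law L i n f + law L i n g.
Proof.
elim: L i n f g => [|L IH] i n f g; first by [].
rewrite /= -EbinD; apply: eq_Ebin => k l _.
by rewrite -IH; apply: eq_trie_law => x; rewrite -IH.
Qed.

Lemma trie_lawZ L i n c f : law L i n (fun x => c * f x) = c * law L i n f.
Proof.
elim: L i n f => [|L IH] i n f; first by [].
rewrite /= -EbinZ; apply: eq_Ebin => k l _.
by rewrite -IH; apply: eq_trie_law => x; rewrite -IH.
Qed.

Lemma trie_lawB L i n f g :
  law L i n (fun x => f x - g x) = law L i n f - law L i n g.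
Proof.
rewrite -[- law L i n g]mulN1r -trie_lawZ -trie_lawD.
by apply: eq_trie_law => x; rewrite mulN1r.
Qed.

Hypothesis p01 : forall i j, 0 < p i j < 1.
Hypothesis p_sum : forall i, p i false + p i true = 1.
Let p_ge0 i j : 0 <= p i j. Proof. by case/andP: (p01 i j) => /ltW. Qed.

Lemma trie_law_cst L i n c : law L i n (fun _ => c) = c.
Proof.
elim: L i n => [|L IH] i n //=.
rewrite (@eq_Ebin _ _ _ _ (fun _ _ => c)) ?Ebin_cst// => k l _.
by rewrite -[RHS](IH false k); apply: eq_trie_law => x; rewrite IH.
Qed.

Lemma le_trie_law L i n f g : (forall x, f x <= g x) -> law L i n f <= law L i n g.
Proof.
elim: L i n f g => [|L IH] i n f g fg /=; first exact: fg.
by apply: le_Ebin => // k l _; apply: (IH) => x; apply: (IH) => y.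
Qed.

Lemma ler_norm_trie_law L i n f : `|law L i n f| <= law L i n (fun x => `|f x|).
Proof.
have N : law L i n (fun x => - f x) = - law L i n f.
  by rewrite -mulN1r -trie_lawZ; apply: eq_trie_law => x; rewrite mulN1r.
rewrite ler_norml lerNl -N; apply/andP; split; apply: le_trie_law => x.
  by rewrite -normrN ler_norm.
exact: ler_norm.
Qed.

Definition mean_lev L i n := law L i n (fun x => x%:R).
Definition sqr_lev L i n := law L i n (fun x => x%:R ^+ 2).

Lemma mean_levS L i n :
  mean_lev L.+1 i n = (toll n)%:R + split_sum p (mean_lev L) i n.
Proof.
rewrite /mean_lev /split_sum /= -[(toll n)%:R](Ebin_cst (p_sum i) n) -EbinD.
apply: eq_Ebin => k l _.
rewrite (@eq_trie_law _ _ _ _ (fun x => ((toll n)%:R + x%:R) + mean_lev L true l)).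
  by rewrite !trie_lawD !trie_law_cst addrA.
move=> x; rewrite -[X in X + _](trie_law_cst L true l) /mean_lev -trie_lawD.
by apply: eq_trie_law => y; rewrite !natrD.
Qed.

Lemma sqr_levS L i n : sqr_lev L.+1 i n = split_sum p (sqr_lev L) i n
  + Ebin (p i) n (fun k l => (toll n)%:R ^+ 2
     + 2 * (toll n)%:R * (mean_lev L false k + mean_lev L true l)
     + 2 * (mean_lev L false k * mean_lev L true l)).
Proof.
rewrite /split_sum -EbinD {1}/sqr_lev /=; apply: eq_Ebin => k l _.
set a := (toll n)%:R : R; set m1 := mean_lev L true l.
rewrite (@eq_trie_law _ _ _ _ (fun x => (x%:R ^+ 2 + (2 * (a + m1)) * x%:R)
   + (a ^+ 2 + 2 * a * m1 + sqr_lev L true l))).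
  rewrite !trie_lawD trie_lawZ !trie_law_cst -/(mean_lev L false k).
  rewrite -/(sqr_lev L false k); ring.
move=> x.
rewrite (@eq_trie_law _ _ _ _ (fun y => (y%:R ^+ 2 + (2 * (a + x%:R)) * y%:R)
   + (a ^+ 2 + 2 * a * x%:R + x%:R ^+ 2))); last first.
  by move=> y; rewrite !natrD -/a; ring.
rewrite !trie_lawD trie_lawZ !trie_law_cst -/(mean_lev L true l).
by rewrite -/(sqr_lev L true l) -/m1; ring.
Qed.

Lemma mean_lev_ge0 L i n : 0 <= mean_lev L i n.
Proof. by rewrite -(trie_law_cst L i n 0); apply: le_trie_law. Qed.

Lemma sqr_lev_ge0 L i n : 0 <= sqr_lev L i n.
Proof. by rewrite -(trie_law_cst L i n 0); apply: le_trie_law => x; exact: sqr_ge0. Qed.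

Lemma mean_lev_homo i n : {homo (fun L => mean_lev L i n) : L L' / (L <= L')%N >-> L <= L'}.
Proof.
apply/nondecreasing_seqP => L; elim: L i n => [|L IH] i n.
  by rewrite {1}/mean_lev /= mean_lev_ge0.
rewrite !mean_levS lerD2l; apply: le_Ebin => // k l _; exact: lerD.
Qed.

Lemma sqr_lev_homo i n : {homo (fun L => sqr_lev L i n) : L L' / (L <= L')%N >-> L <= L'}.
Proof.
apply/nondecreasing_seqP => L; elim: L i n => [|L IH] i n.
  by rewrite {1}/sqr_lev /= expr0n sqr_lev_ge0.
have H j m : mean_lev L j m <= mean_lev L.+1 j m by apply: mean_lev_homo.
rewrite (sqr_levS L.+1) (sqr_levS L); apply: lerD.
  by apply: le_Ebin => // k l _; exact: lerD.
apply: le_Ebin => // k l _; rewrite lerD ?lerD2l ?ler_wpM2l ?mulr_ge0 ?lerD//.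
by rewrite ler_pM ?mean_lev_ge0.
Qed.

Definition pairs n : R := (n * n.-1)%:R.

Lemma pairsD k l : pairs k + pairs l <= pairs (k + l).
Proof. rewrite /pairs -natrD ler_nat; case: k l => [|k] [|l]; nia. Qed.

Lemma toll_pairs n : (toll n)%:R <= pairs n.
Proof. by rewrite /pairs ler_nat /toll; case: n => [|[|n]] //=; nia. Qed.

(** Two strings of one bucket stay together with probability at most [coll_rate]. This contraction
    bounds the moments here and the cost of truncating the trie later. *)
Lemma split_sum_pairs i n :
  split_sum p (fun _ => pairs) i n <= coll_rate p * pairs n.
Proof.
case: n => [|n]; first by rewrite /split_sum /= /pairs !mul0n addr0 mulr0.
rewrite (_ : (fun _ => pairs) = fun j n => n%:R * n.-1%:R); last first.
  by apply/funext => j; apply/funext => a; rewrite /pairs natrM.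
rewrite (split_sum_tag p (fun _ => fun n => n%:R)) /tag_op EbinD !EbinZ.
rewrite Ebin_left// Ebin_right//.
have := coll_rateP p i; have : 0 <= pairs n.+1 by rewrite /pairs.
set t := (X in _ -> _ -> X <= _).
have -> : t = (p i false ^+ 2 + p i true ^+ 2) * pairs n.+1.
  by rewrite /t /pairs /= natrM; ring.
by move=> h1 h2; rewrite ler_wpM2r.
Qed.

Let gap_gt0 : 0 < 1 - coll_rate p. Proof. by rewrite subr_gt0 coll_rate_lt1. Qed.

Lemma mean_lev_le L i n : mean_lev L i n <= (1 - coll_rate p)^-1 * pairs n.
Proof.
set K := _^-1; have K0 : 0 <= K by rewrite invr_ge0 ltW.
elim: L i n => [|L IH] i n; first by rewrite {1}/mean_lev /= mulr_ge0.
rewrite mean_levS.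
have h : split_sum p (mean_lev L) i n <= K * (coll_rate p * pairs n).
  apply: (@le_trans _ _ (K * split_sum p (fun _ => pairs) i n)).
    rewrite -split_sumZ; apply: le_Ebin => // k l _; exact: lerD.
  by rewrite ler_wpM2l// split_sum_pairs.
have e : K * pairs n - K * (coll_rate p * pairs n) = pairs n.
  by rewrite -mulrBr -{1}[pairs n]mul1r -mulrBl /K mulrA mulVf ?mul1r// gt_eqF.
by have := toll_pairs n; lra.
Qed.

Lemma sqr_lev_le : exists2 M : R, 0 <= M & forall L i n, sqr_lev L i n <= M * pairs n ^+ 2.
Proof.
pose K := (1 - coll_rate p)^-1; have K0 : 0 <= K by rewrite invr_ge0 ltW.
(* This constant solves [M = coll_rate * M + (1 + K) ^ 2]: the second moments of the subtries
   contract, and the remaining terms are at most [((1 + K) * pairs n) ^ 2]. *)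
exists ((1 + K) ^+ 2 * K) => [|L i n]; first by rewrite mulr_ge0 ?sqr_ge0.
elim: L i n => [|L IH] i n.
  rewrite {1}/sqr_lev /= expr0n /=; apply: mulr_ge0; last exact: sqr_ge0.
  by apply: mulr_ge0 => //; exact: sqr_ge0.
have P0 m : 0 <= pairs m by rewrite /pairs.
rewrite sqr_levS.
set M := _ * K in IH *; have M0 : 0 <= M by rewrite mulr_ge0 ?sqr_ge0.
have h1 : split_sum p (sqr_lev L) i n <= M * (coll_rate p * pairs n ^+ 2).
  apply: (@le_trans _ _ (M * (pairs n * split_sum p (fun _ => pairs) i n))).
    rewrite -split_sumZ -split_sumZ; apply: le_Ebin => // k l kl.
    apply: le_trans (lerD (IH _ _) (IH _ _)) _; rewrite -!mulrDr ler_wpM2l//.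
    have := pairsD k l; rewrite kl; have := P0 k; have := P0 l.
    set a := pairs k; set b := pairs l; set c := pairs n; nra.
  by rewrite ler_wpM2l// expr2 mulrCA ler_wpM2l// split_sum_pairs.
have h2 : Ebin (p i) n (fun k l => (toll n)%:R ^+ 2
     + 2 * (toll n)%:R * (mean_lev L false k + mean_lev L true l)
     + 2 * (mean_lev L false k * mean_lev L true l)) <= ((1 + K) * pairs n) ^+ 2.
  apply: Ebin_le => // k l kl.
  apply: (@le_trans _ _ (((toll n)%:R + (mean_lev L false k + mean_lev L true l)) ^+ 2)).
    rewrite -subr_ge0.
    have := sqr_ge0 (mean_lev L false k); have := sqr_ge0 (mean_lev L true l); lra.
  rewrite lerXn2r ?nnegrE ?addr_ge0 ?mulr_ge0 ?mean_lev_ge0// ?addr_ge0//.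
  rewrite mulrDl mul1r lerD ?toll_pairs//.
  apply: le_trans (lerD (mean_lev_le _ _ _) (mean_lev_le _ _ _)) _.
  by rewrite -mulrDr ler_wpM2l// -kl pairsD.
apply: le_trans (lerD h1 h2) _.
have e : (1 + K) ^+ 2 = M * (1 - coll_rate p) by rewrite /M /K mulrVK// unitfE gt_eqF.
by rewrite exprMn e; lra.
Qed.

End trie_law_theory.

(** * Mean and variance of the infinite trie *)

Definition mean_trie {R : realType} (p : bool -> bool -> R) i n : R :=
  lim (mean_lev p L i n @[L --> \oo]).
Definition sqr_trie {R : realType} (p : bool -> bool -> R) i n : R :=
  lim (sqr_lev p L i n @[L --> \oo]).
Definition var_trie {R : realType} (p : bool -> bool -> R) i n : R :=
  sqr_trie p i n - mean_trie p i n ^+ 2.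
Definition mean_incr {R : realType} (p : bool -> bool -> R) i n : R :=
  mean_trie p i n.+1 - mean_trie p i n.

Section trie_moments.
Variables (R : realType) (p : bool -> bool -> R).
Hypothesis p01 : forall i j, 0 < p i j < 1.
Hypothesis p_sum : forall i, p i false + p i true = 1.
Let p_ge0 i j : 0 <= p i j. Proof. by case/andP: (p01 i j) => /ltW. Qed.
Local Notation e := (mean_trie p).
Local Notation v := (var_trie p).
Local Notation g := (mean_incr p).

Lemma cvg_mean_lev i n : mean_lev p L i n @[L --> \oo] --> e i n.
Proof.
apply: nondecreasing_is_cvgn; first exact: mean_lev_homo.
by exists ((1 - coll_rate p)^-1 * pairs R n) => _ [L _ <-]; exact: mean_lev_le.
Qed.

Lemma cvg_sqr_lev i n : sqr_lev p L i n @[L --> \oo] --> sqr_trie p i n.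
Proof.
have [M _ h] := sqr_lev_le p01 p_sum.
apply: nondecreasing_is_cvgn; first exact: sqr_lev_homo.
by exists (M * pairs R n ^+ 2) => _ [L _ <-]; exact: h.
Qed.

Lemma mean_trieE i n : e i n = (toll n)%:R + split_sum p e i n.
Proof.
have h : mean_lev p L.+1 i n @[L --> \oo] --> e i n.
  by rewrite (cvg_shiftS (fun L => mean_lev p L i n)); exact: cvg_mean_lev.
rewrite -(cvg_lim _ h)//; apply: cvg_lim => //.
under eq_cvg do rewrite mean_levS//.
apply: cvgD; first exact: cvg_cst.
by apply: cvg_Ebin => k l; apply: cvgD; exact: cvg_mean_lev.
Qed.

Lemma sqr_trieE i n : sqr_trie p i n = split_sum p (sqr_trie p) i n
  + Ebin (p i) n (fun k l => (toll n)%:R ^+ 2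
     + 2 * (toll n)%:R * (e false k + e true l) + 2 * (e false k * e true l)).
Proof.
have h : sqr_lev p L.+1 i n @[L --> \oo] --> sqr_trie p i n.
  by rewrite (cvg_shiftS (fun L => sqr_lev p L i n)); exact: cvg_sqr_lev.
rewrite -(cvg_lim _ h)//; apply: cvg_lim => //.
under eq_cvg do rewrite sqr_levS//.
apply: cvgD.
  by apply: cvg_Ebin => k l; apply: cvgD; exact: cvg_sqr_lev.
apply: cvg_Ebin => k l; have h0 := @cvg_mean_lev false k; have h1 := @cvg_mean_lev true l.
apply: cvgD; last by apply: cvgM; [exact: cvg_cst|exact: cvgM].
apply: cvgD; first exact: cvg_cst.
by apply: cvgM; [exact: cvg_cst|exact: cvgD].
Qed.

(** Law of total variance at the split; the toll is deterministic and drops out. *)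
Lemma var_trieE i n : v i n = split_sum p v i n
  + Vbin (p i) n (fun k l => e false k + e true l).
Proof.
rewrite {1}/var_trie sqr_trieE mean_trieE /split_sum /Vbin.
set b := Ebin (p i) n (fun k l => e false k + e true l); set a := (toll n)%:R : R.
have -> : (a + b) ^+ 2 = Ebin (p i) n (fun k l => a ^+ 2 + 2 * a * (e false k + e true l))
    + b ^+ 2.
  by rewrite EbinD Ebin_cst// EbinZ -/b; ring.
rewrite opprD addrA addrA; congr (_ - _).
by rewrite -!EbinD -EbinB; apply: eq_Ebin => k l _; rewrite /var_trie; ring.
Qed.

(** At one string the recurrence is satisfied by any constant. The bound by [pairs], which vanishes
    there, settles the value. *)
Lemma mean_trie_small i n : (n < 2)%N -> e i n = 0.
Proof.
move=> n2; apply: cvg_lim => //.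
rewrite (_ : (fun L => _) = cst 0); first exact: cvg_cst.
apply/funext => L; apply/eqP; rewrite eq_le mean_lev_ge0//.
rewrite (le_trans (mean_lev_le p01 p_sum L i n))// /pairs.
by case: n n2 => [|[|]]; rewrite ?mul0n ?muln0 ?mulr0.
Qed.

Lemma var_trie_small i n : (n < 2)%N -> v i n = 0.
Proof.
move=> n2; rewrite /var_trie mean_trie_small// expr0n subr0.
apply: cvg_lim => //; have [M _ h] := sqr_lev_le p01 p_sum.
rewrite (_ : (fun L => _) = cst 0); first exact: cvg_cst.
apply/funext => L; apply/eqP; rewrite eq_le sqr_lev_ge0//.
rewrite (le_trans (h L i n))// /pairs.
by case: n n2 => [|[|]]; rewrite ?mul0n ?muln0 ?expr0n ?mulr0.
Qed.

Lemma mean_incrE i n :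
  g i n = (toll n.+1)%:R - (toll n)%:R + tag_op p g i n.
Proof.
rewrite {1}/mean_incr [e i n.+1]mean_trieE [e i n]mean_trieE opprD addrACA.
congr (_ + _); rewrite Ebin_succB//; apply: eq_Ebin => k l _.
by rewrite /mean_incr; ring.
Qed.

Lemma sum_mean_incr i n : e i n = \sum_(m < n) g i m.
Proof.
elim: n => [|n IH]; first by rewrite big_ord0 mean_trie_small.
by rewrite big_ord_recr /= -IH /mean_incr addrC subrK.
Qed.

End trie_moments.

(** * Entropies, slopes and the Poisson equation *)

Section entropy_constants.
Variables (R : realType) (p : bool -> bool -> R).
Hypothesis p01 : forall i j, 0 < p i j < 1.
Hypothesis p_sum : forall i, p i false + p i true = 1.
Let p_gt0 i j : 0 < p i j. Proof. by case/andP: (p01 i j). Qed.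
Let p_ge0 i j : 0 <= p i j. Proof. exact: ltW. Qed.

Lemma Hent_gt0 i : 0 < Hent p i.
Proof.
rewrite oppr_gt0 -oppr_gt0 opprD addr_gt0// oppr_gt0 pmulr_rlt0// ln_lt0//.
Qed.

Lemma Hrate_gt0 : 0 < Hrate p.
Proof.
rewrite /Hrate /pi0 /pi1 addr_gt0// mulr_gt0 ?Hent_gt0// divr_gt0 ?addr_gt0//.
Qed.

Definition ent_gap : R := (Hent p true - Hent p false) / (p false true + p true false).

(** To leading order at [k = n * p i false], the derivative in [k] of [e false k + e true (n - k)],
    where [e] is [mean_trie p]: the logarithms come from the harmonic numbers, [ent_gap] from the
    two Poisson corrections. *)
Definition slope i : R := (ln (p i false / p i true) + ent_gap) / Hrate p.

Definition step_var i : R := p i false * p i true * slope i ^+ 2.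

Lemma sigma2E : sigma2 p = (pi0 p * step_var false + pi1 p * step_var true) / Hrate p.
Proof.
rewrite /sigma2 /step_var /slope -/ent_gap.
have := Hrate_gt0; move: (Hrate p) => H H0.
by field; rewrite gt_eqF.
Qed.

Lemma step_var_ge0 i : 0 <= step_var i.
Proof. by apply: mulr_ge0; [exact: mulr_ge0|exact: sqr_ge0]. Qed.

Lemma sigma2_ge0 : 0 <= sigma2 p.
Proof.
rewrite sigma2E; apply: divr_ge0; last exact: ltW Hrate_gt0.
by apply: addr_ge0; apply: mulr_ge0; rewrite ?step_var_ge0// ltW// divr_gt0 ?addr_gt0.
Qed.

(** If both slopes vanish, the two rows have the same ratio of entries and hence coincide. Then the
    entropies agree, the gap is [0], the logarithm of the ratio must vanish too, and all entries are
    [1/2]. *)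
Lemma sigma2_gt0 : (exists i j, p i j != 2^-1) -> 0 < sigma2 p.
Proof.
move=> [i [j hij]]; rewrite sigma2E divr_gt0 ?Hrate_gt0//.
have p0 : 0 < pi0 p by rewrite divr_gt0 ?addr_gt0.
have p1 : 0 < pi1 p by rewrite divr_gt0 ?addr_gt0.
have t0 : 0 <= pi0 p * step_var false by apply: mulr_ge0 (ltW _) (step_var_ge0 _).
have t1 : 0 <= pi1 p * step_var true by apply: mulr_ge0 (ltW _) (step_var_ge0 _).
rewrite lt_neqAle addr_ge0// andbT eq_sym paddr_eq0//.
have pmul_eq0 (a b : R) : 0 < a -> (a * b == 0) = (b == 0).
  by move=> a0; rewrite mulf_eq0 gt_eqF.
have slope_eq0 k : (step_var k == 0) = (ln (p k false / p k true) + ent_gap == 0).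
  rewrite /step_var pmul_eq0 ?mulr_gt0// expf_eq0 /= /slope mulrC pmul_eq0//.
  by rewrite invr_gt0 Hrate_gt0.
apply/negP; rewrite (pmul_eq0 _ _ p0) (pmul_eq0 _ _ p1) !slope_eq0 => /andP[/eqP e0 /eqP e1].
have el : ln (p false false / p false true) = ln (p true false / p true true) by lra.
have er : p false false / p false true = p true false / p true true.
  by apply: ln_inj el; rewrite posrE divr_gt0.
have e2 : p false false = p true false.
  have : p false false * p true true = p true false * p false true.
    move/(congr1 (fun x => x * (p false true * p true true))): er.
    by rewrite mulrA divfK ?gt_eqF// [X in _ = X -> _]mulrCA divfK ?gt_eqF// mulrC [_ * p true false]mulrC.
  have := p_sum false; have := p_sum true; nra.
have e3 : p false true = p true true by have := p_sum false; have := p_sum true; lra.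
have gap0 : ent_gap = 0 by rewrite /ent_gap /Hent e2 e3 subrr mul0r.
move: e0; rewrite gap0 addr0 => /eqP; rewrite ln_eq0 ?divr_gt0// => /eqP r1.
have e4 : p false false = p false true.
  by rewrite -[LHS](divfK (lt0r_neq0 (p_gt0 false true))) r1 mul1r.
move/negP: hij; apply; apply/eqP.
have := p_sum false; have := p_sum true.
by case: i; case: j; lra.
Qed.

(* A solution of the Poisson equation [d - p d = s - K H] of the symbol chain,
   where the constant [K] makes the right-hand side centered for [(pi0, pi1)]. *)
Definition poisson (K : R) (s : bool -> R) i : R :=
  let d := (s false - K * Hent p false) / p false true in
  if i then `|d| else `|d| + d.

(** Poisson solutions are unique up to a constant. The summand [|d|] is that constant, chosen so
    that a profile with [K >= 0] is nonnegative and can serve as a variance. *)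
Lemma poisson_ge0 K s i : 0 <= poisson K s i.
Proof.
rewrite /poisson; set d := _ / _; case: i => //.
by have := lerNnormlW (lexx `|d|); lra.
Qed.

Lemma poissonE K s : K * Hrate p = pi0 p * s false + pi1 p * s true -> forall i,
  poisson K s i = s i - K * Hent p i
    + (p i false * poisson K s false + p i true * poisson K s true).
Proof.
rewrite /Hrate /pi0 /pi1 => h.
have pp : p false true + p true false != 0 by rewrite gt_eqF ?addr_gt0.
have {}h : p true false * (s false - K * Hent p false)
         + p false true * (s true - K * Hent p true) = 0.
  move/(congr1 (fun x => x * (p false true + p true false))): h.
  rewrite (_ : K * _ * _ = K * (p true false * Hent p false + p false true * Hent p true)).
    rewrite (_ : (_ + _) * _ = p true false * s false + p false true * s true); first by lra.
    by field.
  by field.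
have b : p false true != 0 by rewrite gt_eqF.
rewrite /poisson; set d := _ / _.
have e : s false - K * Hent p false = p false true * d by rewrite [RHS]mulrC divfK.
have e' : s true - K * Hent p true = - (p true false * d).
  by apply: (mulfI b); move: h; rewrite e; lra.
case.
  by rewrite e' (_ : p true true = 1 - p true false); [ring|rewrite -(p_sum true) addrC addKr].
by rewrite e (_ : p false true = 1 - p false false); [ring|rewrite -(p_sum false) addrC addKr].
Qed.
End entropy_constants.

Lemma Ebin_harm_approxr (R : realType) (q : bool -> R) n :
  q false + q true = 1 -> (forall i, 0 <= q i) -> 0 < q true ->
  `|Ebin q n (fun _ l => harm l) - harm n - ln (q true)| <= (q true ^+ 2 * n.+1%:R)^-1.
Proof.
move=> qs q0 qt; rewrite Ebin_swap.
by apply: (@Ebin_harm_approx _ (fun i => q (~~ i))) => //; rewrite addrC.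
Qed.

Lemma Ebin_harm_sqrr (R : realType) (q : bool -> R) :
  q false + q true = 1 -> (forall i, 0 <= q i) -> 0 < q true ->
  exists2 C : R, 0 <= C & forall n,
  Ebin q n (fun _ l => (harm l - harm n - ln (q true)) ^+ 2) <= C / n.+1%:R.
Proof.
move=> qs q0 qt.
have [|//||C C0 h] := @Ebin_harm_sqr _ (fun i => q (~~ i)); rewrite 1?addrC//.
by exists C => // n; rewrite Ebin_swap; exact: h.
Qed.

(** * Asymptotics of the mean *)

Section harmonic_profile.
Variables (R : realType) (p : bool -> bool -> R).
Hypothesis p01 : forall i j, 0 < p i j < 1.
Hypothesis p_sum : forall i, p i false + p i true = 1.
Let p_gt0 i j : 0 < p i j. Proof. by case/andP: (p01 i j). Qed.
Let p_ge0 i j : 0 <= p i j. Proof. exact: ltW. Qed.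
Local Notation e := (mean_trie p).
Local Notation v := (var_trie p).
Local Notation g := (mean_incr p).

(* Up to [O(1 / m.+1)], the solution of [x = s + tag_op p x]. *)
Definition profile (K : R) (s : bool -> R) i m : R := K * harm m + poisson p K s i.

(** By [Ebin_harm_approx] the operator adds to [harm m] the average of [ln (p i j)] with weights
    [p i j], that is [- Hent p i], up to [O(1 / m.+1)]. The Poisson equation turns this loss into
    the toll [s i]. *)
Lemma profile_tag K s : K * Hrate p = pi0 p * s false + pi1 p * s true ->
  exists2 C : R, 0 <= C & forall i m,
  `|profile K s i m - (s i + tag_op p (profile K s) i m)| <= C / m.+1%:R.
Proof.
move=> hK.
pose D i : R := (p i false ^+ 2)^-1 + (p i true ^+ 2)^-1.
have D0 i : 0 <= D i by rewrite addr_ge0// invr_ge0 sqr_ge0.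
exists (`|K| * (D false + D true)) => [|i m]; first by apply: mulr_ge0 => //; exact: addr_ge0.
have n0 : 0 < m.+1%:R :> R by rewrite ltr0n.
have hf := Ebin_harm_approx (p_sum i) (p_ge0 i) (p_gt0 i false) m.
have ht := Ebin_harm_approxr m (p_sum i) (p_ge0 i) (p_gt0 i true).
have -> : tag_op p (profile K s) i m
  = K * (p i false * Ebin (p i) m (fun k _ => harm k)
         + p i true * Ebin (p i) m (fun _ l => harm l))
    + (p i false * poisson p K s false + p i true * poisson p K s true).
  rewrite /tag_op -[X in _ = _ + X](Ebin_cst (p_sum i) m) mulrDr !mulrA -!EbinZ -!EbinD.
  by apply: eq_Ebin => k l _; rewrite /profile; ring.
rewrite /profile (poissonE p01 p_sum hK i).
set d := _ + p i true * poisson _ _ _ _.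
move: hf ht; set Ef := Ebin _ _ _; set Et := Ebin _ _ _ => hf ht.
have -> : K * harm m + (s i - K * Hent p i + d) -
   (s i + (K * (p i false * Ef + p i true * Et) + d))
  = - K * (p i false * (Ef - harm m - ln (p i false))
           + p i true * (Et - harm m - ln (p i true))).
  have -> : p i true = 1 - p i false by rewrite -(p_sum i) addrC addKr.
  rewrite /Hent; have -> : p i true = 1 - p i false by rewrite -(p_sum i) addrC addKr.
  ring.
rewrite normrM normrN -mulrA ler_wpM2l//.
have h1 : D i <= D false + D true by case: i {hf ht Ef Et d}; have := D0 false; have := D0 true; lra.
apply: (@le_trans _ _ (D i / m.+1%:R)); last by rewrite ler_pM2r ?invr_gt0.
apply: le_trans (ler_normD _ _) _; rewrite !normrM !(ger0_norm (p_ge0 i _)).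
rewrite /D mulrDl -!invfM; apply: lerD.
  by apply: le_trans hf; rewrite ler_piMl// ltW//; case/andP: (p01 i false).
by apply: le_trans ht; rewrite ler_piMl// ltW//; case/andP: (p01 i true).
Qed.

Definition mean_profile : bool -> nat -> R := profile (Hrate p)^-1 (fun _ => 1).
Definition incr_rest i m : R := g i m - mean_profile i m.

Lemma mean_profile_eq : (Hrate p)^-1 * Hrate p = pi0 p * 1 + pi1 p * 1.
Proof.
rewrite mulVf ?gt_eqF ?Hrate_gt0// /pi0 /pi1; field.
by rewrite gt_eqF ?addr_gt0.
Qed.

Lemma incr_rest_tag : exists2 C : R, 0 <= C & forall i m, (0 < m)%N ->
  `|incr_rest i m - tag_op p incr_rest i m| <= C / m.+1%:R.
Proof.
have [C C0 h] := @profile_tag (Hrate p)^-1 (fun _ => 1) mean_profile_eq.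
exists (C + 2) => [|i m m0]; first by rewrite addr_ge0.
have n0 : 0 < m.+1%:R :> R by rewrite ltr0n.
have := h i m; rewrite -/mean_profile.
rewrite (tag_opB p g) /incr_rest (mean_incrE p01 p_sum i m).
set t := tag_op p g i m; set x := mean_profile i m; set y := tag_op _ mean_profile i m.
set a := (toll m.+1)%:R - (toll m)%:R => hxy.
have -> : a + t - x - (t - y) = (a - 1) - (x - (1 + y)) by ring.
apply: le_trans (ler_normB _ _) _; rewrite addrC mulrDl; apply: lerD => //.
(* The toll grows by [2] from one string to two, and by [1] from then on; the constant [2] in the
   bound covers the exceptional case [m = 1]. *)
rewrite /a; case: m m0 {h n0 t x y a hxy} => [//|[|m]] _.
  by rewrite /toll /= subr0 -natr1 addrK normr1 divff.
by rewrite /toll /= -[m.+3%:R]natr1 (addrAC m.+2%:R) subrr add0r subrr normr0 divr_ge0.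
Qed.

Lemma incr_rest_bounded : exists2 K : R, 0 <= K & forall i m, `|incr_rest i m| <= K.
Proof. by have [C C0 h] := incr_rest_tag; exact: (tag_bounded p01 p_sum C0 h). Qed.

Lemma sum_harm n : \sum_(m < n) harm m = n%:R * harm n - n%:R :> R.
Proof.
elim: n => [|n IH]; first by rewrite big_ord0 mul0r subr0.
rewrite big_ord_recr /= IH harmS -natr1; field.
by rewrite natr1 pnatr_eq0.
Qed.

Lemma mean_trie_approx : exists2 C : R, 0 <= C & forall i n,
  `|e i n - n%:R * harm n / Hrate p| <= C * n%:R.
Proof.
have [K K0 hK] := incr_rest_bounded.
pose D := poisson p (Hrate p)^-1 (fun _ => 1) false + poisson p (Hrate p)^-1 (fun _ => 1) true.
have Hi : 0 <= (Hrate p)^-1 by rewrite invr_ge0 ltW// Hrate_gt0.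
have P0 i := poisson_ge0 p (Hrate p)^-1 (fun _ => 1) i.
exists (K + D + (Hrate p)^-1) => [|i n].
  by apply: addr_ge0 => //; apply: addr_ge0 => //; apply: addr_ge0; exact: P0.
rewrite sum_mean_incr//.
have -> : \sum_(m < n) g i m - n%:R * harm n / Hrate p
   = \sum_(m < n) (incr_rest i m + poisson p (Hrate p)^-1 (fun _ => 1) i)
     - n%:R / Hrate p.
  rewrite (eq_bigr (fun m : 'I_n => (Hrate p)^-1 * harm m +
    (incr_rest i m + poisson p (Hrate p)^-1 (fun _ => 1) i))); last first.
    by move=> m _; rewrite /incr_rest /mean_profile /profile; ring.
  rewrite big_split /= -mulr_sumr sum_harm; ring.
apply: le_trans (ler_normB _ _) _.
rewrite [leRHS]mulrDl; apply: lerD; last first.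
  by rewrite ger0_norm ?mulr_ge0// mulrC.
apply: le_trans (ler_norm_sum _ _ _) _.
rewrite mulr_natr -[X in _ *+ X]card_ord -sumr_const; apply: ler_sum => m _.
apply: le_trans (ler_normD _ _) _; apply: lerD; first exact: hK.
rewrite ger0_norm ?P0// /D; case: i; by rewrite ?lerDl ?lerDr P0.
Qed.

End harmonic_profile.

(** * Asymptotics of the variance *)

Section variance_split.
Variables (R : realType) (q : bool -> R).
Hypothesis q_sum : q false + q true = 1.
Hypothesis q_ge0 : forall i, 0 <= q i.

(** Young's inequality with a free weight: a small [lam] keeps the leading constant of [F], at the
    price of a factor of order [1 / lam] on [G]. *)
Lemma Vbin_add_le n F G (lam : R) : 0 < lam ->
  Vbin q n (fun k l => F k l + G k l)
  <= (1 + lam) * Vbin q n F + (1 + lam^-1) * Vbin q n G.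
Proof.
move=> l0; rewrite !VbinE// -!EbinZ -EbinD (EbinD q n F G); apply: le_Ebin => // k l _.
set x := F k l - Ebin q n F; set y := G k l - Ebin q n G.
have -> : F k l + G k l - (Ebin q n F + Ebin q n G) = x + y by rewrite /x /y; ring.
rewrite -subr_ge0.
have -> : (1 + lam) * x ^+ 2 + (1 + lam^-1) * y ^+ 2 - (x + y) ^+ 2
   = lam^-1 * (lam * x - y) ^+ 2 by field; rewrite gt_eqF.
by rewrite mulr_ge0 ?sqr_ge0// invr_ge0 ltW.
Qed.

Lemma Vbin_add_ge n F G (lam : R) : 0 < lam ->
  (1 - lam) * Vbin q n F - lam^-1 * Vbin q n G
  <= Vbin q n (fun k l => F k l + G k l).
Proof.
move=> l0; rewrite !VbinE// -!EbinZ -EbinB (EbinD q n F G); apply: le_Ebin => // k l _.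
set x := F k l - Ebin q n F; set y := G k l - Ebin q n G.
have -> : F k l + G k l - (Ebin q n F + Ebin q n G) = x + y by rewrite /x /y; ring.
rewrite -subr_ge0.
have -> : (x + y) ^+ 2 - ((1 - lam) * x ^+ 2 - lam^-1 * y ^+ 2)
   = lam^-1 * (lam * x + y) ^+ 2 + y ^+ 2 by field; rewrite gt_eqF.
apply: addr_ge0; last exact: sqr_ge0.
by apply: mulr_ge0; [rewrite invr_ge0 ltW|exact: sqr_ge0].
Qed.

Lemma Vbin_linear n (c : R) :
  Vbin q n (fun k _ => c * k%:R) = n%:R * (q false * q true * c ^+ 2).
Proof.
rewrite VbinE// EbinZ Ebin_left//.
rewrite (@eq_Ebin _ _ _ _ (fun k l => c ^+ 2 * (k%:R * q true - l%:R * q false + 0) ^+ 2)).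
  by rewrite EbinZ Ebin_sqr_shift// expr0n /= add0r; ring.
move=> k l <-; rewrite natrD.
by have -> : q true = 1 - q false; [rewrite -q_sum addrC addKr|ring].
Qed.
End variance_split.

Section variance_asymptotics.
Variables (R : realType) (p : bool -> bool -> R).
Hypothesis p01 : forall i j, 0 < p i j < 1.
Hypothesis p_sum : forall i, p i false + p i true = 1.
Let p_gt0 i j : 0 < p i j. Proof. by case/andP: (p01 i j). Qed.
Let p_ge0 i j : 0 <= p i j. Proof. exact: ltW. Qed.
Local Notation e := (mean_trie p).
Local Notation v := (var_trie p).
Local Notation g := (mean_incr p).
Local Notation w := (incr_rest p).

Definition branch_rest i k l : R := e false k + e true l - slope p i * k%:R.

Lemma poisson_gap :
  poisson p (Hrate p)^-1 (fun _ => 1) false - poisson p (Hrate p)^-1 (fun _ => 1) true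
  = ent_gap p / Hrate p.
Proof.
rewrite /poisson /= addrAC subrr add0r.
have H0 := Hrate_gt0 p01; have h : Hrate p != 0 by rewrite gt_eqF.
have b : p false true != 0 by rewrite gt_eqF.
have c : p false true + p true false != 0 by rewrite gt_eqF ?addr_gt0.
rewrite /ent_gap; apply: (mulIf h); rewrite divfK//.
rewrite mulrAC mulrBl mul1r mulrAC mulVf// mul1r.
by rewrite /Hrate /pi0 /pi1; field; rewrite b c.
Qed.

(** The slope is exactly what centres both harmonic numbers at their approximate means
    [harm m + ln (p i j)]; [m] itself cancels, and Efron-Stein will take it to be the number of
    other strings. *)
Lemma branch_rest_step i k l m : branch_rest i k.+1 l - branch_rest i k l.+1
  = ((harm k - harm m - ln (p i false)) - (harm l - harm m - ln (p i true))) / Hrate p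
    + (w false k - w true l).
Proof.
rewrite /branch_rest /incr_rest /mean_profile /profile.
have := poisson_gap; set c0 := poisson _ _ _ false; set c1 := poisson _ _ _ true => gap.
have -> : slope p i = (ln (p i false) - ln (p i true)) / Hrate p + (c0 - c1).
  by rewrite gap /slope ln_div ?posrE// mulrDl.
by rewrite /mean_incr -[k.+1%:R]natr1; ring.
Qed.

(* Efron-Stein bounds this variance by the increments of [w]; their mean square
   is the drift of the potential [3 * w ^+ 2] along the tagged string. *)
Lemma branch_rest_var : exists2 C : R, 0 <= C & exists2 pot : bool -> nat -> R,
  (exists K, forall i m, 0 <= pot i m <= K) &
  forall i m, (0 < m)%N -> Vbin (p i) m.+1 (branch_rest i)
    <= m.+1%:R * (C / m.+1%:R + tag_op p pot i m - pot i m).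
Proof.
have [K K0 wK] := incr_rest_bounded p01 p_sum.
have [C C0 wC] := incr_rest_tag p01 p_sum.
have [D D0 hD] : exists2 D : R, 0 <= D & forall i m,
    Ebin (p i) m (fun k _ => (harm k - harm m - ln (p i false)) ^+ 2)
    + Ebin (p i) m (fun _ l => (harm l - harm m - ln (p i true)) ^+ 2) <= D / m.+1%:R.
  have [a a0 ha] := Ebin_harm_sqr (p_sum false) (p_ge0 false) (p_gt0 false false).
  have [b b0 hb] := Ebin_harm_sqr (p_sum true) (p_ge0 true) (p_gt0 true false).
  have [c c0 hc] := Ebin_harm_sqrr (p_sum false) (p_ge0 false) (p_gt0 false true).
  have [d d0 hd] := Ebin_harm_sqrr (p_sum true) (p_ge0 true) (p_gt0 true true).
  exists ((a + c) + (b + d)) => [|i m]; first by rewrite !addr_ge0.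
  have n0 : 0 <= m.+1%:R^-1 :> R by rewrite invr_ge0.
  have ac : 0 <= (a + c) / m.+1%:R by rewrite mulr_ge0// addr_ge0.
  have bd : 0 <= (b + d) / m.+1%:R by rewrite mulr_ge0// addr_ge0.
  case: i; rewrite mulrDl.
    by apply: le_trans (lerD (hb m) (hd m)) _; rewrite -(mulrDl b d) lerDr.
  by apply: le_trans (lerD (ha m) (hc m)) _; rewrite -(mulrDl a c) lerDl.
have H0 := Hrate_gt0 p01.
(* The factors [3] come from [(x - y + z)^2 <= 3 (x^2 + y^2 + z^2)]. The term [2 * K * C] bounds
   [m.+1] times [w^2 - (tag_op w)^2], as [w] is bounded by [K] and within [C / m.+1] of its
   image. *)
exists (3 * D / Hrate p ^+ 2 + 3 * (2 * K * C)).
  by rewrite addr_ge0// ?mulr_ge0 ?invr_ge0 ?sqr_ge0.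
exists (fun i m => 3 * w i m ^+ 2).
  exists (3 * K ^+ 2) => i m; rewrite mulr_ge0 ?sqr_ge0//= ler_pM2l//.
  by rewrite -[leLHS]ger0_norm ?sqr_ge0// normrX lerXn2r// nnegrE.
move=> i m m0.
have n0 : 0 < m.+1%:R :> R by rewrite ltr0n.
apply: le_trans (Efron_Stein (p_sum i) (p_ge0 i) _ _) _.
rewrite -mulrA ler_pM2l//.
have c1 : p i false * p i true <= 1.
  by rewrite mulr_ile1// ltW//; [case/andP: (p01 i false)|case/andP: (p01 i true)].
have c0 : 0 <= p i false * p i true by rewrite mulr_ge0.
pose A k := harm k - harm m - ln (p i false) : R.
pose B l := harm l - harm m - ln (p i true) : R.
have h1 : Ebin (p i) m (fun k l => (branch_rest i k.+1 l - branch_rest i k l.+1) ^+ 2)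
   <= 3 / Hrate p ^+ 2 * (Ebin (p i) m (fun k _ => A k ^+ 2) + Ebin (p i) m (fun _ l => B l ^+ 2))
     + 3 * Ebin (p i) m (fun k l => (w false k - w true l) ^+ 2).
  rewrite -EbinD -!EbinZ -EbinD; apply: le_Ebin => // k l _.
  rewrite (branch_rest_step i k l m) -/(A k) -/(B l).
  set x := A k / Hrate p; set y := B l / Hrate p; set z := w false k - w true l.
  have -> : (A k - B l) / Hrate p + z = x - y + z by rewrite /x /y; ring.
  have -> : 3 / Hrate p ^+ 2 * (A k ^+ 2 + B l ^+ 2) = 3 * (x ^+ 2 + y ^+ 2).
    by rewrite /x /y; field; rewrite gt_eqF.
  have := sqr_ge0 (x + y); have := sqr_ge0 (x - z); have := sqr_ge0 (y + z); lra.
(* For a given split, [p i false * p i true * (w false k - w true l)^2] is the variance of [w] over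
   the next symbol of the tagged string; Jensen over the split then brings in the square of
   [tag_op]. *)
have h2 : p i false * p i true * Ebin (p i) m (fun k l => (w false k - w true l) ^+ 2)
   <= tag_op p (fun i m => w i m ^+ 2) i m - tag_op p w i m ^+ 2.
  have := Ebin_sqr_le (p_sum i) (p_ge0 i) m
    (fun k l => p i false * w false k + p i true * w true l).
  rewrite -/(tag_op p w i m).
  have -> : Ebin (p i) m (fun k l => (p i false * w false k + p i true * w true l) ^+ 2)
    = tag_op p (fun i m => w i m ^+ 2) i m
      - p i false * p i true * Ebin (p i) m (fun k l => (w false k - w true l) ^+ 2).
    rewrite -EbinZ -EbinB; apply: eq_Ebin => k l _.
    have -> : p i true = 1 - p i false by rewrite -(p_sum i) addrC addKr.
    ring.
  lra.
have h3 : w i m ^+ 2 - 2 * K * C / m.+1%:R <= tag_op p w i m ^+ 2.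
  have := wC i m m0; have := wK i m; have := sqr_ge0 (tag_op p w i m - w i m).
  set t := tag_op p w i m; set x := w i m; set c := C / m.+1%:R => h4 h5 h6.
  have -> : 2 * K * C / m.+1%:R = 2 * (K * c) by rewrite /c; ring.
  have h7 : `|x * (x - t)| <= K * c by rewrite normrM ler_pM.
  have := ler_norm (x * (x - t)); lra.
rewrite (tag_opZ p 3 (fun i m => w i m ^+ 2)).
have h4 : p i false * p i true *
   (3 / Hrate p ^+ 2 * (Ebin (p i) m (fun k _ => A k ^+ 2) + Ebin (p i) m (fun _ l => B l ^+ 2)))
   <= 3 * D / Hrate p ^+ 2 / m.+1%:R.
  have e0 : 0 <= Ebin (p i) m (fun k _ => A k ^+ 2) + Ebin (p i) m (fun _ l => B l ^+ 2).
    by rewrite addr_ge0//; apply: Ebin_ge0 => // *; exact: sqr_ge0.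
  have e1 : 0 <= 3 / Hrate p ^+ 2 by rewrite divr_ge0// sqr_ge0.
  apply: le_trans (ler_piMl (mulr_ge0 e1 e0) c1) _.
  apply: le_trans (ler_wpM2l e1 (hD i m)) _.
  by rewrite le_eqVlt; apply/orP; left; apply/eqP; ring.
have h5 := ler_wpM2l c0 h1.
rewrite mulrDr in h5; rewrite mulrDl.
move: h2 h3 h4 h5.
set q := p i false * p i true; set T2 := tag_op _ (fun i m => w i m ^+ 2) i m.
set T1 := tag_op _ _ _ _ ^+ 2; set W := Ebin _ _ _; set E := Ebin _ _ _.
set X := q * (3 / _ * _); set Y := 3 * D / _ / _.
set E0 := Ebin _ _ _; set iv := m.+1%:R^-1; move=> a1 a2 a3 a4; lra.
Qed.

Let vtag i m : R := v i m.+1 / m.+1%:R.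
Let varprof : bool -> nat -> R := profile p (sigma2 p) (step_var p).

Lemma sigma2_eq :
  sigma2 p * Hrate p = pi0 p * step_var p false + pi1 p * step_var p true.
Proof. by rewrite sigma2E// divfK// gt_eqF// Hrate_gt0. Qed.

Lemma var_trie_tag i m :
  vtag i m = tag_op p vtag i m
    + Vbin (p i) m.+1 (fun k l => e false k + e true l) / m.+1%:R.
Proof.
have n0 : m.+1%:R != 0 :> R by rewrite pnatr_eq0.
rewrite {1}/vtag var_trieE// mulrDl; congr (_ + _).
rewrite (_ : v = fun j n => n%:R * vtag j n.-1); last first.
  apply/funext => j; apply/funext => -[|n] /=; first by rewrite var_trie_small// mul0r.
  by rewrite /vtag mulrC divfK// pnatr_eq0.
by rewrite split_sum_tag mulrC mulKf.
Qed.

(* Supersolution [A * varprof - B * pot + cst] of the variance recurrence. *)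
Lemma var_tag_upper : exists2 M : R, 0 <= M & exists2 C : R, 0 <= C &
  exists2 pot : bool -> nat -> R,
  (forall i m, (0 < m)%N -> Vbin (p i) m.+1 (branch_rest i)
    <= m.+1%:R * (C / m.+1%:R + tag_op p pot i m - pot i m)) &
  forall a A B u : R, `|A| <= u -> 0 <= B <= u ->
  (forall i m, (0 < m)%N ->
    a * Vbin (p i) m.+1 (fun k l => e false k + e true l) <=
    m.+1%:R * (A * step_var p i + B * (C / m.+1%:R + tag_op p pot i m - pot i m))) ->
  forall i m, a * vtag i m <= A * varprof i m + u * M.
Proof.
have [C C0 [pot [K potK] hpot]] := branch_rest_var.
have [D D0 hD] := profile_tag p01 p_sum sigma2_eq.
have gap0 : 0 < 1 - coll_rate p by rewrite subr_gt0 coll_rate_lt1.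
have K0 : 0 <= K by case/andP: (potK true 0%N); exact: le_trans.
pose P i := poisson p (sigma2 p) (step_var p) i.
have P0 i : 0 <= P i by exact: poisson_ge0.
pose M := (C + D) / (1 - coll_rate p) + (P false + K) + (P true + K).
have M0 : 0 <= M.
  have PK j : 0 <= P j + K by rewrite addr_ge0.
  apply: addr_ge0 => //; apply: addr_ge0 => //; apply: divr_ge0; last exact: ltW.
  exact: addr_ge0.
exists M => //.
exists C => //; exists pot => // a A B u Au /andP[B0 Bu] hyp i m.
have u0 : 0 <= u by rewrite (le_trans _ Au).
pose z i m := a * vtag i m - A * varprof i m + B * pot i m.
have zT j n : (0 < n)%N -> z j n <= tag_op p z j n + u * (C + D) / n.+1%:R.
  move=> n0; have N0 : 0 < n.+1%:R :> R by rewrite ltr0n.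
  rewrite /z tag_opD tag_opB !tag_opZ var_trie_tag.
  have := hyp j n n0; rewrite -ler_pdivrMl//.
  set V := Vbin _ _ _; set tv := tag_op p vtag j n; set tp := tag_op p pot j n.
  have := hD j n; rewrite -/varprof; set x := varprof j n; set tx := tag_op p varprof j n.
  set iv := n.+1%:R^-1 => h1 h2.
  have iv0 : 0 <= iv by rewrite invr_ge0.
  have h3 : - (u * (D * iv)) <= A * (x - (step_var p j + tx)).
    rewrite lerNl -mulrN; apply: le_trans (ler_norm _) _.
    by rewrite normrM normrN ler_pM.
  have h4 : B * (C * iv) <= u * (C * iv) by rewrite ler_wpM2r// mulr_ge0.
  by move: h2 h3 h4; lra.
have cd : 0 <= u * (C + D) by rewrite mulr_ge0// addr_ge0.
have := tag_upper p01 p_sum cd zT i m.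
have z0 j : `|z j 0%N| <= u * (P j + K).
  have -> : z j 0%N = - (A * P j) + B * pot j 0%N.
    by rewrite /z /vtag var_trie_small// /varprof /profile harm0 mul0r mulr0 mulr0 !add0r.
  apply: le_trans (ler_normD _ _) _; rewrite normrN !normrM mulrDr lerD//.
    by rewrite (ger0_norm (P0 j)) ler_wpM2r.
  case/andP: (potK j 0%N) => q0 qK.
  by rewrite (ger0_norm B0) (ger0_norm q0) ler_pM.
have := z0 false; have := z0 true.
have : 0 <= B * pot i m by rewrite mulr_ge0//; case/andP: (potK i m).
rewrite /M /z -mulrA; set s := (C + D) / _; lra.
Qed.

Lemma var_trie_approx : exists2 C : R, 0 <= C & forall i n (lam : R), 0 < lam <= 1 ->
  `|v i n - sigma2 p * (n%:R * harm n)| <= C * (lam * (n%:R * harm n) + n%:R / lam).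
Proof.
have [M M0 [C C0 [pot hpot hM]]] := var_tag_upper.
pose P := poisson p (sigma2 p) (step_var p) false + poisson p (sigma2 p) (step_var p) true.
have P0 i : 0 <= poisson p (sigma2 p) (step_var p) i by exact: poisson_ge0.
have Pi i : poisson p (sigma2 p) (step_var p) i <= P.
  by rewrite /P; case: i; rewrite ?lerDl ?lerDr.
have PP : 0 <= P by rewrite addr_ge0.
have s0 := sigma2_ge0 p01.
exists (sigma2 p + 2 * P + 2 * M) => [|i n lam /andP[l0 l1]].
  by apply: addr_ge0; [apply: addr_ge0 => //|]; exact: mulr_ge0.
case: n => [|n].
  by rewrite var_trie_small// harm0 !mulr0 subr0 normr0 mul0r addr0 mulr0.
have N0 : 0 < n.+1%:R :> R by rewrite ltr0n.
have -> : v i n.+1 = n.+1%:R * vtag i n by rewrite /vtag mulrC divfK// gt_eqF.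
have il : 1 <= lam^-1 by rewrite invf_ge1.
have linE j : (fun k l => e false k + e true l)
    = (fun k l => slope p j * k%:R + branch_rest j k l) :> (nat -> nat -> R).
  by apply/funext => k; apply/funext => l; rewrite /branch_rest; ring.
(* The upper bound weighs the linear part by [1 + lam] and the remainder by [1 + 1 / lam]. The lower
   bound is the same statement for [- vtag], with weights [- (1 - lam)] and [1 / lam]. As
   [lam <= 1], all four are at most [2 / lam] in absolute value. *)
have up : 1 * vtag i n <= (1 + lam) * varprof i n + 2 * lam^-1 * M.
  apply: (hM _ _ (1 + lam^-1)) => [||j m m0].
  - by rewrite ger0_norm; lra.
  - by apply/andP; split; lra.
  rewrite mul1r (linE j).
  apply: le_trans (Vbin_add_le (p_sum j) (p_ge0 j) _ _ _ l0) _.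
  rewrite Vbin_linear// -/(step_var p j) [in X in _ <= X]mulrDr; apply: lerD.
    by rewrite mulrCA.
  rewrite [leRHS]mulrCA ler_pM2l ?hpot//; lra.
have lo : -1 * vtag i n <= - (1 - lam) * varprof i n + 2 * lam^-1 * M.
  apply: (hM _ _ lam^-1) => [||j m m0].
  - by rewrite normrN ger0_norm; lra.
  - by apply/andP; split; lra.
  rewrite mulN1r (linE j) lerNl.
  apply: le_trans (Vbin_add_ge (p_sum j) (p_ge0 j) _ _ _ l0).
  rewrite Vbin_linear// -/(step_var p j) [in X in X <= _]mulrDr [in X in X <= _]opprD; apply: lerD.
    by rewrite mulrCA mulNr opprK.
  by rewrite lerN2 [leRHS]mulrCA ler_pM2l ?invr_gt0// hpot.
move: up lo; rewrite /varprof /profile mul1r mulN1r.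
set y := vtag i n; set d := poisson _ _ _ _; have d0 : 0 <= d by exact: P0.
have dP : d <= P by exact: Pi.
rewrite harmS; set h := harm n; have h0 : 0 <= h by exact: harm_ge0.
have Nn : n.+1%:R != 0 :> R by rewrite gt_eqF.
move: N0 Nn; set N := n.+1%:R; set il' := lam^-1 => N0 Nn up lo.
have -> : N * y - sigma2 p * (N * (h + N^-1)) = N * (y - sigma2 p * h) - sigma2 p.
  by field.
have -> : lam * (N * (h + N^-1)) + N / lam = N * (lam * h + il') + lam.
  by rewrite /il'; field; rewrite (gt_eqF l0) nat1r pnatr_eq0.
have N1 : 1 <= N by rewrite /N ler1n.
have k1 : y - sigma2 p * h <= (sigma2 p + 2 * P + 2 * M) * (lam * h + il').
  have a1 : 0 <= P * (lam * h) by rewrite !mulr_ge0// ltW.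
  have a2 : 0 <= M * (lam * h) by rewrite !mulr_ge0// ltW.
  have a3 : 0 <= sigma2 p * il' by rewrite !mulr_ge0// invr_ge0 ltW.
  have a4 : (1 + lam) * d <= 2 * (P * il').
    apply: (@le_trans _ _ (2 * P)); first by rewrite ler_pM//; lra.
    by rewrite ler_pM2l// ler_peMr.
  by lra.
have k2 : - (y - sigma2 p * h) + sigma2 p <= (sigma2 p + 2 * P + 2 * M) * (lam * h + il').
  have a1 : 0 <= P * (lam * h) by rewrite !mulr_ge0// ltW.
  have a2 : 0 <= M * (lam * h) by rewrite !mulr_ge0// ltW.
  have a3 : sigma2 p <= sigma2 p * il' by rewrite ler_peMr.
  have a4 : 0 <= P * il' by rewrite !mulr_ge0// invr_ge0 ltW.
  have a5 : 0 <= (1 - lam) * d by rewrite mulr_ge0// subr_ge0.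
  by lra.
have n0 : 0 <= N by rewrite /N.
have b1 := ler_wpM2l n0 k1; have b2 := ler_wpM2l n0 k2.
have b3 : 0 <= (sigma2 p + 2 * P + 2 * M) * lam.
  by apply: mulr_ge0; [apply: addr_ge0; [apply: addr_ge0 => //|]; exact: mulr_ge0|exact: ltW].
have b4 : sigma2 p <= N * sigma2 p by rewrite ler_peMl.
have -> : (sigma2 p + 2 * P + 2 * M) * (N * (lam * h + il') + lam)
  = N * ((sigma2 p + 2 * P + 2 * M) * (lam * h + il'))
    + (sigma2 p + 2 * P + 2 * M) * lam by ring.
move: b1 b2 b3 b4; set Q := (_ + _ + _) * (lam * h + il'); set CL := _ * lam.
by rewrite ler_norml => b1 b2 b3 b4; apply/andP; split; lra.
Qed.
End variance_asymptotics.

(** * Gaussian approximation *)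

Section taylor.
Variable R : realType.
Implicit Types (x y z a h k : R) (f df : R -> R).

Lemma mvt_norm f df x B : (forall y, is_derive y 1 f (df y)) ->
  (forall y, `|y| <= `|x| -> `|df y| <= B) -> `|f x - f 0| <= B * `|x|.
Proof.
move=> fd dfB.
have fc (i : interval R) : {within [set` i], continuous f}.
  by apply: derivable_within_continuous => y _; have := fd y.
have [x0|x0] := leP 0 x.
  have [c] := @MVT_segment R f df 0 x x0 (fun y _ => fd y) (fc _).
  rewrite in_itv/= => /andP[c0 cx] ->; rewrite subr0 normrM.
  by rewrite ler_wpM2r// dfB// !ger0_norm.
have [c] := @MVT_segment R f df x 0 (ltW x0) (fun y _ => fd y) (fc _).
rewrite in_itv/= => /andP[c0 cx]; rewrite distrC => ->; rewrite sub0r normrM normrN.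
by rewrite ler_wpM2r// dfB// !ler0_norm ?(ltW x0)// lerN2.
Qed.

Lemma sin_norm_le x : `|sin x| <= `|x|.
Proof.
have := @mvt_norm (@sin R) (@cos R) x 1 (fun y => is_derive_sin y).
by rewrite sin0 subr0 mul1r; apply => y _; exact: cos_max.
Qed.

Lemma cos_taylor1 x : `|1 - cos x| <= x ^+ 2 / 2.
Proof.
have -> : cos x = cos ((x / 2) *+ 2) by rewrite -mulr_natr divfK.
rewrite cos_mulr2n cos2sin2.
have -> : 1 - ((1 - sin (x / 2) ^+ 2) *+ 2 - 1) = 2 * sin (x / 2) ^+ 2 by ring.
rewrite normrM normrX ger0_norm//.
have := sin_norm_le (x / 2); rewrite normrM [`|2^-1|]ger0_norm// => h.
have := real_normK (num_real x); set s := `|sin _| in h *; set t := `|x| in h * => <-.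
have : 0 <= s by exact: normr_ge0.
have : 0 <= t by exact: normr_ge0. nra.
Qed.

Lemma sin_taylor1 x : `|sin x - x| <= `|x| ^+ 3 / 2.
Proof.
have := @mvt_norm (fun y => sin y - y) (fun y => cos y - 1) x (`|x| ^+ 2 / 2).
have -> : `|x| ^+ 3 / 2 = `|x| ^+ 2 / 2 * `|x| by field.
rewrite sin0 !subr0; apply => y yx.
rewrite distrC (le_trans (cos_taylor1 y))// ler_pM2r ?invr_gt0//.
by rewrite -[leLHS]ger0_norm ?sqr_ge0// normrX lerXn2r// nnegrE.
Qed.

Lemma cos_taylor2 x : `|cos x - 1 + x ^+ 2 / 2| <= x ^+ 4 / 8.
Proof.
have -> : cos x = cos ((x / 2) *+ 2) by rewrite -mulr_natr divfK.
rewrite cos_mulr2n cos2sin2; set y := x / 2.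
have -> : x = 2 * y by rewrite /y mulrC divfK.
have -> : (1 - sin y ^+ 2) *+ 2 - 1 - 1 + (2 * y) ^+ 2 / 2
  = - 2 * (sin y - y) * (sin y + y) by field.
have h1 := sin_taylor1 y; have h2 := sin_norm_le y.
have h3 : `|sin y + y| <= 2 * `|y|.
  by apply: le_trans (ler_normD _ _) _; move: h2; lra.
rewrite !normrM normrN [`|2|]ger0_norm//.
apply: (@le_trans _ _ (2 * (`|y| ^+ 3 / 2) * (2 * `|y|))).
  by rewrite ler_pM ?mulr_ge0// ler_pM2l.
have -> : (2 * y) ^+ 4 / 8 = 2 * `|y| ^+ 4.
  rewrite (_ : `|y| ^+ 4 = y ^+ 4); first by field.
  by rewrite -normrX ger0_norm// exprn_even_ge0.
by rewrite le_eqVlt; apply/orP; left; apply/eqP; field.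
Qed.

Lemma expRN_norm_le1 A : 0 <= A -> `|expR (- A)| <= 1 :> R.
Proof. by move=> A0; rewrite ger0_norm ?expR_ge0// -expR0 ler_expR oppr_le0. Qed.

Lemma expRN_taylor (A B : R) : 0 <= A -> 0 <= B ->
  `|expR (- A) - expR (- B)| <= `|A - B| /\
  `|expR (- A) - expR (- B) * (1 - (A - B))| <= (A - B) ^+ 2.
Proof.
move=> A0 B0.
have hA : expR (- A) <= 1 by rewrite -expR0 ler_expR oppr_le0.
have hB : expR (- B) <= 1 by rewrite -expR0 ler_expR oppr_le0.
have gA := expR_ge0 (- A); have gB := expR_ge0 (- B).
have h1 : expR (- B) * (1 - (A - B)) <= expR (- A).
  have := ler_wpM2l gB (expR_ge1Dx (B - A)); rewrite -expRD.
  by have -> : - B + (B - A) = - A by [ring]; have -> : 1 + (B - A) = 1 - (A - B) by ring.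
have h2 : expR (- A) * (1 + (A - B)) <= expR (- B).
  have := ler_wpM2l gA (expR_ge1Dx (A - B)); rewrite -expRD.
  by have -> : - A + (A - B) = - B by ring.
set x := expR (- A) in hA gA h1 h2 *; set y := expR (- B) in hB gB h1 h2 *.
set d := A - B in h1 h2 *.
have n1 : `|x - y| <= `|d|.
  have [d0|d0] := leP 0 d.
    by rewrite (ger0_norm d0) ler_norml; apply/andP; split; nra.
  by rewrite (ltr0_norm d0) ler_norml; apply/andP; split; nra.
split=> //.
rewrite ger0_norm ?subr_ge0//.
have : (y - x) * d <= d ^+ 2.
  apply: le_trans (ler_norm _) _.
  by rewrite normrM -[d ^+ 2]real_normK ?num_real// expr2 ler_wpM2r// distrC.
nra.
Qed.

(** The cubic bound is the better one for [|x| <= 2], the trivial bound [2 * |x|] beyond. *)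
Lemma sin_taylor0 x : `|sin x - x| <= x ^+ 2.
Proof.
have h1 := sin_taylor1 x; have h2 := sin_norm_le x.
have h3 : `|sin x - x| <= 2 * `|x|.
  by apply: le_trans (ler_normB _ _) _; move: h2; lra.
rewrite -[x ^+ 2]real_normK ?num_real//; have := normr_ge0 x.
move: h1 h3; set t := `|x|; set s := `|_ - _|.
by have [t2|t2] := leP t 2; nra.
Qed.

Lemma sinD_norm_le x a : `|sin (x + a) - sin a| <= `|x|.
Proof.
have h y : is_derive y 1 (fun y => sin (y + a)) (cos (y + a)).
  have d1 : is_derive y 1 (fun y : R => y + a) 1 by rewrite -[X in is_derive _ _ _ X]addr0; apply: is_deriveD.
  have -> : cos (y + a) = cos (y + a) * 1 by rewrite mulr1.
  exact: (@is_derive1_comp _ (@sin R) (fun y => y + a)).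
have := @mvt_norm (fun y => sin (y + a)) (fun y => cos (y + a)) x 1 h.
by rewrite add0r mul1r; apply => y _; exact: cos_max.
Qed.

(** [x] stands for the linear part of a split and is kept to second order; [z] stands for the
    remainder and is kept to first order, its square being an error already. *)
Lemma cos_shift_taylor x z a :
  `|cos (x + z + a) - (cos a - (x + z) * sin a - x ^+ 2 / 2 * cos a)|
  <= 3 / 2 * z ^+ 2 + `|z| * `|x| + `|x| ^+ 3 / 2 + x ^+ 4 / 8.
Proof.
have -> : cos (x + z + a) - (cos a - (x + z) * sin a - x ^+ 2 / 2 * cos a)
  = - ((1 - cos z) * cos (x + a)) - (sin z - z) * sin (x + a)
    - z * (sin (x + a) - sin a)
    + (- ((sin x - x) * sin a) + (cos x - 1 + x ^+ 2 / 2) * cos a).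
  have -> : x + z + a = (x + a) + z by ring.
  by rewrite (cosD (x + a)) (cosD x a); ring.
have b (u w M : R) : `|u| <= M -> `|w| <= 1 -> `|u * w| <= M.
  by move=> uM w1; rewrite normrM (le_trans _ uM)// ler_piMr.
have h1 := b _ _ _ (cos_taylor1 z) (cos_max (x + a)).
have h2 := b _ _ _ (sin_taylor0 z) (sin_max (x + a)).
have h3 := ler_wpM2l (normr_ge0 z) (sinD_norm_le x a).
have h4 := b _ _ _ (sin_taylor1 x) (sin_max a).
have h5 := b _ _ _ (cos_taylor2 x) (cos_max a).
rewrite -normrM in h3.
have tri (u1 u2 u3 u4 u5 : R) : `|- u1 - u2 - u3 + (- u4 + u5)|
    <= `|u1| + `|u2| + `|u3| + (`|u4| + `|u5|).
  rewrite -[`|u1|]normrN -[`|u4|]normrN.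
  apply: le_trans (ler_normD _ _) _; apply: lerD; last exact: ler_normD.
  apply: le_trans (ler_normB _ _) _; rewrite lerD2r; exact: ler_normB.
apply: le_trans (tri _ _ _ _ _) _; lra.
Qed.

(** [x ^ 2] has the order of the variance itself, so its coefficient has to be a small [k]. The
    products of [x] with [z], [x ^ 2] and [A - B] are split by [u * w <= k / 4 * u ^ 2 + w ^ 2 / k],
    which charges [1 / k] to the smaller quantities only. *)
Lemma gauss_step_taylor x z a A B k : 0 <= A -> 0 <= B -> 0 < k <= 1 ->
  `|expR (- A) * cos (x + z + a)
    - expR (- B) * (cos a * (1 - x ^+ 2 / 2 - (A - B)) - sin a * (x + z))|
  <= k * x ^+ 2 + 3 / k * (z ^+ 2 + x ^+ 4 + (A - B) ^+ 2).
Proof.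
move=> A0 B0 /andP[k0 k1].
have [e1 e2] := expRN_taylor A0 B0; have h1 := cos_shift_taylor x z a.
set Q := cos a - (x + z) * sin a - x ^+ 2 / 2 * cos a in h1.
set h := A - B in e1 e2 *.
have EA : `|expR (- A)| <= 1 by exact: expRN_norm_le1.
have -> : expR (- A) * cos (x + z + a)
    - expR (- B) * (cos a * (1 - x ^+ 2 / 2 - h) - sin a * (x + z))
  = expR (- A) * (cos (x + z + a) - Q)
    + (expR (- A) - expR (- B) * (1 - h)) * cos a
    - (expR (- A) - expR (- B)) * ((x + z) * sin a + x ^+ 2 / 2 * cos a).
  by rewrite /Q; ring.
have g1 : `|expR (- A) * (cos (x + z + a) - Q)| <=
    3 / 2 * z ^+ 2 + `|z| * `|x| + `|x| ^+ 3 / 2 + x ^+ 4 / 8.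
  by rewrite normrM (le_trans _ h1)// ler_piMl.
have g2 : `|(expR (- A) - expR (- B) * (1 - h)) * cos a| <= h ^+ 2.
  by rewrite normrM (le_trans _ e2)// ler_piMr// cos_max.
have g3 : `|(expR (- A) - expR (- B)) * ((x + z) * sin a + x ^+ 2 / 2 * cos a)|
    <= `|h| * (`|x| + `|z| + x ^+ 2 / 2).
  rewrite normrM ler_pM//; apply: le_trans (ler_normD _ _) _; apply: lerD.
    by rewrite normrM (le_trans _ (ler_normD _ _))// ler_piMr// sin_max.
  by rewrite normrM ger0_norm ?divr_ge0 ?sqr_ge0// ler_piMr ?divr_ge0 ?sqr_ge0// cos_max.
apply: le_trans (ler_normB _ _) _.
apply: le_trans (lerD (ler_normD _ _) (lexx _)) _.
apply: le_trans (lerD (lerD g1 g2) g3) _.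
rewrite -[z ^+ 2]real_normK ?num_real// -[h ^+ 2]real_normK ?num_real//.
have x4 : x ^+ 4 = `|x| ^+ 4 by rewrite -normrX ger0_norm// exprn_even_ge0.
rewrite x4 -[x ^+ 2]real_normK ?num_real//.
have := normr_ge0 x; have := normr_ge0 z; have := normr_ge0 h.
set X := `|x|; set Z := `|z|; set H := `|h| => H0 Z0 X0.
have kI : 1 <= k^-1 by rewrite invf_ge1.
have amgm (u w : R) : u * w <= k / 4 * u ^+ 2 + k^-1 * w ^+ 2.
  rewrite -subr_ge0.
  have -> : k / 4 * u ^+ 2 + k^-1 * w ^+ 2 - u * w = k * (u / 2 - w / k) ^+ 2.
    by field; rewrite gt_eqF.
  by rewrite mulr_ge0 ?sqr_ge0// ltW.
have a1 := amgm X Z; have a2 := amgm X (X ^+ 2 / 2); have a3 := amgm X H.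
have a4 : H * Z <= H ^+ 2 / 2 + Z ^+ 2 / 2 by have := sqr_ge0 (H - Z); nra.
have a5 : H * X ^+ 2 <= H ^+ 2 / 2 + X ^+ 4 / 2.
  have -> : X ^+ 4 = (X ^+ 2) ^+ 2 by rewrite -exprM.
  by have := sqr_ge0 (H - X ^+ 2); lra.
have b1 : H ^+ 2 <= k^-1 * H ^+ 2 by rewrite ler_peMl// sqr_ge0.
have b2 : Z ^+ 2 <= k^-1 * Z ^+ 2 by rewrite ler_peMl// sqr_ge0.
have b3 : X ^+ 4 <= k^-1 * X ^+ 4 by rewrite ler_peMl// exprn_ge0.
have b4 : 0 <= k * X ^+ 2 by rewrite mulr_ge0 ?sqr_ge0// ltW.
have c2 : X * (X ^+ 2 / 2) = X ^+ 3 / 2 by rewrite mulrA -exprS.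
have d2 : k^-1 * (X ^+ 2 / 2) ^+ 2 = k^-1 * X ^+ 4 / 4 by field; rewrite gt_eqF.
rewrite c2 d2 in a2.
rewrite [3 / k * _]mulrDr [3 / k * _]mulrDr.
have -> : H * (X + Z + X ^+ 2 / 2) = X * H + H * Z + H * X ^+ 2 / 2 by ring.
rewrite [Z * X]mulrC -!mulrA.
have z0 : 0 <= k^-1 * H ^+ 2 by apply: le_trans b1; exact: sqr_ge0.
have z1 : 0 <= k^-1 * Z ^+ 2 by apply: le_trans b2; exact: sqr_ge0.
have z2 : 0 <= k^-1 * X ^+ 4 by apply: le_trans b3; exact: exprn_ge0.
move: z0 z1 z2 a1 a2 a3 a4 a5 b1 b2 b3 b4.
set i1 := k^-1 * _; set i2 := k^-1 * _; set i3 := k^-1 * _.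
lra.
Qed.
End taylor.

(** * One Lindeberg step *)

Section gauss_step.
Variables (R : realType) (p : bool -> bool -> R).
Hypothesis p01 : forall i j, 0 < p i j < 1.
Hypothesis p_sum : forall i, p i false + p i true = 1.
Local Notation e := (mean_trie p).

(* The law of the trie of [n] strings whose first symbols are drawn from [q],
   which may be the initial distribution of the source. *)
Definition root_law (q : bool -> R) L n (f : nat -> R) : R :=
  Ebin q n (fun k l => trie_law p L false k (fun x =>
    trie_law p L true l (fun y => f (toll n + x + y)%N))).

(** The two subtries are replaced by their Gaussian values one after the other, with total error
    [delta]; then exponential and cosine are expanded around [B] and [a]. The linear terms vanish
    because [Y] and [F] are centred, and the second-order terms cancel up to the mismatch of
    variances in the last summand. *)
Lemma gauss_step (q : bool -> R) L n (delta A : bool -> nat -> R)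
    (Y F : nat -> nat -> R) (c B t k a : R) :
  q false + q true = 1 -> (forall i, 0 <= q i) ->
  (forall j m, 0 <= A j m) -> 0 <= B -> 0 < k <= 1 ->
  (forall j m a, `|trie_law p L j m (fun x => cos (t * (x%:R - e j m) + a))
      - expR (- (t ^+ 2 / 2 * A j m)) * cos a| <= delta j m) ->
  (forall x y, (x + y = n)%N -> (toll n)%:R + e false x + e true y - c = Y x y + F x y) ->
  Ebin q n Y = 0 -> Ebin q n F = 0 ->
  `|root_law q L n (fun x => cos (t * (x%:R - c) + a)) - expR (- (t ^+ 2 / 2 * B)) * cos a|
  <= Ebin q n (fun x y => delta false x + delta true y)
   + (k * (t ^+ 2 * Ebin q n (fun x y => Y x y ^+ 2))
     + 3 / k * (t ^+ 2 * Ebin q n (fun x y => F x y ^+ 2)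
     + t ^+ 4 * (Ebin q n (fun x y => Y x y ^+ 4)
        + Ebin q n (fun x y => (A false x + A true y - B) ^+ 2))))
   + t ^+ 2 / 2 * `|Ebin q n (fun x y => A false x + A true y)
                    + Ebin q n (fun x y => Y x y ^+ 2) - B|.
Proof.
move=> q1 q0 A0 B0 k01 hd hYF EY EF.
have t20 : 0 <= t ^+ 2 / 2 by rewrite divr_ge0 ?sqr_ge0.
pose V x y := A false x + A true y.
have V0 x y : 0 <= V x y by rewrite addr_ge0.
pose E1 x y := expR (- (t ^+ 2 / 2 * V x y)).
have step1 : `|root_law q L n (fun x => cos (t * (x%:R - c) + a))
    - Ebin q n (fun x y => E1 x y * cos (t * Y x y + t * F x y + a))|
    <= Ebin q n (fun x y => delta false x + delta true y).
  rewrite /root_law -EbinB; apply: le_trans (ler_norm_Ebin q0 _ _) _.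
  apply: le_Ebin => // x y xy.
  set e1 := expR (- (t ^+ 2 / 2 * A true y)); set e0 := expR (- (t ^+ 2 / 2 * A false x)).
  have e1le : `|e1| <= 1.
    exact/expRN_norm_le1/mulr_ge0.
  (* The toll and the means of both subtries enter through this phase alone. *)
  pose b := a + t * ((toll n)%:R + e false x + e true y - c).
  have -> : E1 x y * cos (t * Y x y + t * F x y + a) = e1 * (e0 * cos b).
    rewrite /E1 /V mulrDr opprD expRD -/e1 -/e0 mulrCA mulrA; congr (_ * cos _).
    by rewrite /b hYF// mulrDr addrC.
  rewrite (_ : _ - _ = trie_law p L false x (fun z =>
       trie_law p L true y (fun z' => cos (t * ((toll n + z + z')%:R - c) + a))
       - e1 * cos (t * (z%:R - e false x) + b))
     + e1 * (trie_law p L false x (fun z => cos (t * (z%:R - e false x) + b)) - e0 * cos b)).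
    2: by rewrite trie_lawB trie_lawZ; ring.
  rewrite addrC; apply: le_trans (ler_normD _ _) _; apply: lerD.
    rewrite normrM; apply: le_trans (hd _ _ b); exact: ler_piMl.
  apply: le_trans (ler_norm_trie_law p01 _ _ _ _) _.
  rewrite -[leRHS](trie_law_cst p_sum L false x); apply: le_trie_law => // z.
  have := hd true y (t * (z%:R - e false x) + b).
  rewrite -/e1 (@eq_trie_law _ _ _ _ _ _ (fun z' => cos (t * ((toll n + z + z')%:R - c) + a)))//.
  move=> z'; congr cos; rewrite /b !natrD; ring.
have step2 : `|Ebin q n (fun x y => E1 x y * cos (t * Y x y + t * F x y + a))
   - Ebin q n (fun x y => expR (- (t ^+ 2 / 2 * B)) *
     (cos a * (1 - (t * Y x y) ^+ 2 / 2 - (t ^+ 2 / 2 * V x y - t ^+ 2 / 2 * B))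
      - sin a * (t * Y x y + t * F x y)))|
   <= k * (t ^+ 2 * Ebin q n (fun x y => Y x y ^+ 2))
     + 3 / k * (t ^+ 2 * Ebin q n (fun x y => F x y ^+ 2)
     + t ^+ 4 * (Ebin q n (fun x y => Y x y ^+ 4)
        + Ebin q n (fun x y => (A false x + A true y - B) ^+ 2))).
  rewrite -EbinB; apply: le_trans (ler_norm_Ebin q0 _ _) _.
  rewrite -(EbinD q n (fun x y => Y x y ^+ 4)) -!EbinZ -EbinD -EbinZ -EbinD.
  apply: le_Ebin => // x y _.
  apply: le_trans (gauss_step_taylor _ _ _ (mulr_ge0 t20 (V0 x y)) (mulr_ge0 t20 B0) k01) _.
  have k0 : 0 < k by case/andP: k01.
  rewrite !exprMn lerD2l ler_pM2l ?divr_gt0// -/(V x y).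
  rewrite -mulrBr exprMn.
  have -> : t ^+ 2 * F x y ^+ 2 + t ^+ 4 * (Y x y ^+ 4 + (V x y - B) ^+ 2)
     = t ^+ 2 * F x y ^+ 2 + t ^+ 4 * Y x y ^+ 4 + t ^+ 4 * (V x y - B) ^+ 2 by ring.
  rewrite lerD2l ler_wpM2r ?sqr_ge0//.
  rewrite exprMn exprVn -exprM -[leRHS]mulr1 ler_wpM2l ?exprn_even_ge0//.
  by rewrite invf_le1 ?exprn_gt0// expr2; lra.
have -> : Ebin q n (fun x y => A false x + A true y) = Ebin q n V by [].
have e3 : Ebin q n (fun x y => expR (- (t ^+ 2 / 2 * B)) *
     (cos a * (1 - (t * Y x y) ^+ 2 / 2 - (t ^+ 2 / 2 * V x y - t ^+ 2 / 2 * B))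
      - sin a * (t * Y x y + t * F x y))) - expR (- (t ^+ 2 / 2 * B)) * cos a
   = - (expR (- (t ^+ 2 / 2 * B)) * cos a * (t ^+ 2 / 2 *
     (Ebin q n V + Ebin q n (fun x y => Y x y ^+ 2) - B))).
  set E0 := expR _.
  transitivity (Ebin q n (fun x y => E0 * cos a * (1 + t ^+ 2 / 2 * B)
      - (E0 * cos a * (t ^+ 2 / 2)) * (Y x y ^+ 2)
      - (E0 * cos a * (t ^+ 2 / 2)) * V x y
      - (E0 * sin a * t) * Y x y - (E0 * sin a * t) * F x y) - E0 * cos a).
    by congr (_ - _); apply: eq_Ebin => x y _; ring.
  by rewrite !EbinB !EbinZ Ebin_cst// EY EF; ring.
set X1 := root_law _ _ _ _ in step1 *; set X2 := Ebin q n _ in step1 step2.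
set X3 := Ebin q n _ in step2 e3.
have -> : X1 - expR (- (t ^+ 2 / 2 * B)) * cos a
  = (X1 - X2) + (X2 - X3) + (X3 - expR (- (t ^+ 2 / 2 * B)) * cos a) by ring.
apply: le_trans (ler_normD _ _) _; apply: lerD.
  by apply: le_trans (ler_normD _ _) _; exact: lerD.
rewrite e3 normrN [X in X <= _]normrM [X in _ * X <= _]normrM (ger0_norm t20).
apply: ler_piMl; [exact: mulr_ge0|rewrite normrM].
apply: mulr_ile1 => //; last exact: cos_max.
exact/expRN_norm_le1/mulr_ge0.
Qed.
End gauss_step.

(** An explicit stand-in for [var_trie]: it satisfies the variance recurrence with the linear part
    only, [n * step_var p i], up to a bounded error per node, which is what the Lindeberg step has
    to cancel. *)
Definition gauss_var {R : realType} (p : bool -> bool -> R) i n : R :=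
  n%:R * profile p (sigma2 p) (step_var p) i n.-1.

(** * Lindeberg induction over the trie *)

Section trie_gauss.
Variables (R : realType) (p : bool -> bool -> R).
Hypothesis p01 : forall i j, 0 < p i j < 1.
Hypothesis p_sum : forall i, p i false + p i true = 1.
Let p_gt0 i j : 0 < p i j. Proof. by case/andP: (p01 i j). Qed.
Let p_ge0 i j : 0 <= p i j. Proof. exact: ltW. Qed.
Local Notation e := (mean_trie p).
Local Notation A := (gauss_var p).
Let pois i := poisson p (sigma2 p) (step_var p) i.
Let pois_ge0 i : 0 <= pois i. Proof. exact: poisson_ge0. Qed.

Lemma gauss_var_ge0 i n : 0 <= A i n.
Proof.
apply: mulr_ge0 => //; apply: addr_ge0; last exact: pois_ge0.
by apply: mulr_ge0; [exact: sigma2_ge0|exact: harm_ge0].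
Qed.

Lemma gauss_varE i n :
  A i n = sigma2 p * (n%:R * harm n) + (n%:R * pois i - (0 < n)%N%:R * sigma2 p).
Proof.
rewrite /gauss_var /profile -/(pois i); case: n => [|n] /=; first by rewrite !mul0r; ring.
by rewrite harmS; field; rewrite nat1r pnatr_eq0.
Qed.

Lemma gauss_var_approx : exists2 C : R, 0 <= C & forall i n,
  `|A i n - sigma2 p * (n%:R * harm n)| <= C * n%:R.
Proof.
exists (pois false + pois true + sigma2 p) => [|i n].
  by rewrite addr_ge0 ?sigma2_ge0// addr_ge0.
rewrite gauss_varE addrAC subrr add0r.
apply: le_trans (ler_normB _ _) _; rewrite [leRHS]mulrDl; apply: lerD.
  rewrite mulrC ger0_norm ?mulr_ge0// ler_wpM2r//.
  by case: i; rewrite ?lerDl ?lerDr.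
rewrite mulrC ger0_norm ?mulr_ge0 ?sigma2_ge0// ler_wpM2l ?sigma2_ge0// ler_nat.
by case: n.
Qed.

Lemma gauss_var_split : exists2 C : R, 0 <= C & forall k l,
  `|A false k + A true l - sigma2 p * ((k + l)%:R * harm (k + l))| <= C * (k + l)%:R.
Proof.
have [C C0 hC] := gauss_var_approx.
exists (C + sigma2 p) => [|k l]; first by rewrite addr_ge0 ?sigma2_ge0.
have h1 := hC false k; have h2 := hC true l.
have /andP[h3 h4] := nharm_split R k l.
have s0 := sigma2_ge0 p01.
have NE := natrD R k l.
move: h1 h2 h3 h4 NE; set N := (k + l)%:R; set h := N * harm (k + l).
set hk := k%:R * harm k; set hl := l%:R * harm l => h1 h2 h3 h4 NE.
have g3 := ler_wpM2l s0 h3; have g4 := ler_wpM2l s0 h4; rewrite mulr0 in g3.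
have -> : (C + sigma2 p) * N = C * k%:R + C * l%:R + sigma2 p * N by rewrite NE; ring.
move: h1 h2; rewrite !ler_norml => /andP[a1 a2] /andP[b1 b2].
by apply/andP; split; lra.
Qed.

Lemma gauss_var_rec : exists2 C : R, 0 <= C & forall i n, (1 < n)%N ->
  `|split_sum p A i n + n%:R * step_var p i - A i n| <= C.
Proof.
have [C C0 hC] := profile_tag p01 p_sum (sigma2_eq p01).
exists C => // i [//|m] _.
rewrite (split_sum_tag p (profile p (sigma2 p) (step_var p))) /gauss_var /=.
have n0 : 0 < m.+1%:R :> R by rewrite ltr0n.
rewrite -mulrDr -mulrBr normrM ger0_norm// mulrC -ler_pdivlMr//.
by apply: le_trans (hC i m); rewrite distrC [step_var _ _ + _]addrC.
Qed.

Lemma trie_law_small L i n f : (n < 2)%N -> trie_law p L i n f = f 0%N.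
Proof.
elim: L i n f => [//|L IH] i n f n2 /=.
rewrite (@eq_Ebin _ _ _ _ (fun _ _ => f 0%N)) ?Ebin_cst// => k l kl.
by rewrite !IH /toll ?n2//; lia.
Qed.

Lemma sqr_le_pairs n : (1 < n)%N -> n%:R ^+ 2 <= 2 * pairs R n.
Proof. by move=> n2; rewrite /pairs -natrX -natrM ler_nat; nia. Qed.

(** Each summand of the bound is a supersolution paying for one kind of error: [A] for the linear
    parts with coefficient [k], a linear term ([W] in the proof) for the remainders, [pairs] for the
    fourth-order terms, and [pairs * coll_rate ^ L] for the truncation. All constants are
    independent of [k], [t] and [L]. *)
Lemma trie_law_gauss : exists2 C : R, 0 <= C & forall k t, 0 < k <= 1 ->
  forall L i n a,
  `|trie_law p L i n (fun x => cos (t * (x%:R - e i n) + a))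
    - expR (- (t ^+ 2 / 2 * A i n)) * cos a|
  <= k * t ^+ 2 * A i n + C * (t ^+ 2 / k) * n%:R + C * (t ^+ 4 / k) * pairs R n
     + 2 * pairs R n * coll_rate p ^+ L.
Proof.
have [C1 C10 [pot [Kp potK] hpot]] := branch_rest_var p01 p_sum.
have [C2 C20 hrec] := gauss_var_rec.
have [C3 C30 hsplit] := gauss_var_split.
have [C4 C40 happ] := gauss_var_approx.
set r := coll_rate p; have gap0 : 0 < 1 - r by rewrite subr_gt0 coll_rate_lt1.
have r0 : 0 <= r by exact: coll_rate_ge0.
pose S := slope p false ^+ 4 + slope p true ^+ 4.
have S4 i : 0 <= slope p i ^+ 4 <= S.
  have s4 j : 0 <= slope p j ^+ 4 by rewrite exprn_even_ge0.
  by rewrite s4 /S; case: i; rewrite ?lerDl ?lerDr s4.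
have S0 : 0 <= S by case/andP: (S4 true); exact: le_trans.
have Kp0 : 0 <= Kp by case/andP: (potK true 0%N); exact: le_trans.
(* Errors to be paid through the barrier [1 / m.+1]: [3 * C1] from the remainder of the split and
   twice [C2] from the defect in the recurrence of [A]. In [c] below, [6] is the [3] of the Taylor
   bound doubled by [n ^ 2 <= 2 * pairs n]. *)
pose M := (3 * C1 + 2 * C2) / (1 - r).
have M0 : 0 <= M by apply: divr_ge0; [apply: addr_ge0; exact: mulr_ge0|exact: ltW].
have Me : M * (1 - r) = 3 * C1 + 2 * C2 by rewrite /M divfK// gt_eqF.
pose K := 3 * Kp + M + (pois false + pois true).
have K0 : 0 <= K by apply: addr_ge0; [apply: addr_ge0 => //; exact: mulr_ge0|exact: addr_ge0].
pose c := 6 * (S + (C3 + C4) ^+ 2) / (1 - r).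
have c0 : 0 <= c.
  by apply: divr_ge0; [apply: mulr_ge0 => //; apply: addr_ge0 => //; exact: sqr_ge0|exact: ltW].
have ce : c * (1 - r) = 6 * (S + (C3 + C4) ^+ 2) by rewrite /c divfK// gt_eqF.
move: M c M0 c0 Me ce @K K0 => M c M0 c0 Me ce K K0.
(* [- 3 * pot] cancels the drift in the bound on the variance of [branch_rest], and [K] is large
   enough to keep [om] above [pois]. *)
pose om i m := K - 3 * pot i m - M * m.+1%:R^-1.
have om0 i m : pois i <= om i m.
  rewrite /om /K; set iv := M * _.
  have h1 : iv <= M by rewrite ler_piMr// invf_le1 ?ltr0n// ler1n.
  have h2 := pois_ge0 false; have h3 := pois_ge0 true.
  have /andP[_ h4] := potK i m.
  have h5 : pois i <= pois false + pois true by case: (i); lra.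
  lra.
have omK i m : om i m <= K.
  rewrite /om; set iv := M * _.
  have h1 : 0 <= iv by rewrite mulr_ge0// invr_ge0.
  have /andP[h2 _] := potK i m.
  lra.
pose W i n := n%:R * om i n.-1.
exists (K + c) => [|k t /andP[k0 k1] L i n a]; first exact: addr_ge0.
pose bound L i n := k * t ^+ 2 * A i n + t ^+ 2 / k * W i n + c * (t ^+ 4 / k) * pairs R n
     + 2 * pairs R n * r ^+ L.
have ki : 0 <= k^-1 by rewrite invr_ge0 ltW.
have t2k : 0 <= t ^+ 2 / k by rewrite mulr_ge0 ?sqr_ge0.
have t4k : 0 <= t ^+ 4 / k by rewrite mulr_ge0 ?exprn_even_ge0.
have P0 m : 0 <= pairs R m by rewrite /pairs.
apply: (@le_trans _ _ (bound L i n)); last first.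
  have h1 : t ^+ 2 / k * W i n <= t ^+ 2 / k * (n%:R * K).
    by rewrite ler_wpM2l// /W ler_wpM2l.
  have h2 : 0 <= c * (t ^+ 2 / k) * n%:R by apply: mulr_ge0 => //; exact: mulr_ge0.
  have h3 : 0 <= K * (t ^+ 4 / k) * pairs R n by apply: mulr_ge0 => //; exact: mulr_ge0.
  move: h1 h2 h3; rewrite /bound; set u := t ^+ 2 / k; set u4 := t ^+ 4 / k.
  by move=> h1 h2 h3; lra.
(* Below two strings the trie is deterministic, yet [A j 1 = pois j] may be nonzero; the term with
   [W] covers this discrepancy because [pois <= om]. *)
have base L' j m b : (m < 2)%N -> `|trie_law p L' j m (fun x => cos (t * (x%:R - e j m) + b))
    - expR (- (t ^+ 2 / 2 * A j m)) * cos b| <= bound L' j m.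
  move=> m2; rewrite trie_law_small// mean_trie_small// subrr mulr0 add0r.
  have -> : A j m = m%:R * pois j.
    by rewrite gauss_varE; case: m m2 => [|[|//]] _ /=; rewrite ?harmS harm0; field.
  set h := t ^+ 2 / 2 * _.
  have h0 : 0 <= h by apply: mulr_ge0; [apply: divr_ge0 => //; exact: sqr_ge0|exact: mulr_ge0].
  have -> : cos b - expR (- h) * cos b = (1 - expR (- h)) * cos b by ring.
  rewrite normrM (le_trans (ler_piMr _ (cos_max b)))//.
  have le1 := expRN_norm_le1 h0.
  have e1 : `|1 - expR (- h)| <= h.
    rewrite ger0_norm ?subr_ge0; last by rewrite -[expR _]ger0_norm ?expR_ge0.
    by have := expR_ge1Dx (- h); lra.
  apply: (le_trans e1); rewrite /bound.
  have x1 : 0 <= k * t ^+ 2 * A j m.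
    by rewrite mulr_ge0 ?gauss_var_ge0// mulr_ge0 ?sqr_ge0// ltW.
  have x2 : 0 <= c * (t ^+ 4 / k) * pairs R m by rewrite mulr_ge0// mulr_ge0.
  have x3 : 0 <= 2 * pairs R m * r ^+ L' by rewrite mulr_ge0 ?exprn_ge0// mulr_ge0.
  have x4 : h <= t ^+ 2 / k * W j m.
    rewrite /h; apply: ler_pM => //.
    - by rewrite divr_ge0 ?sqr_ge0.
    - by rewrite mulr_ge0.
    - rewrite ler_wpM2l ?sqr_ge0// lef_pV2 ?posrE//; lra.
    - by rewrite /W ler_wpM2l.
  lra.
elim: L i n a => [|L IH] i n a.
  have [n2|n2] := ltnP n 2; first exact: base.
  (* With no level counted, the difference is only known to be at most [2], which [2 * pairs R n]
     covers from two strings on. *)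
  have b1 : `|trie_law p 0 i n (fun x => cos (t * (x%:R - e i n) + a))| <= 1 by exact: cos_max.
  have t2 : 0 <= t ^+ 2 / 2 * A i n by rewrite mulr_ge0 ?gauss_var_ge0// divr_ge0 ?sqr_ge0.
  have b2 : `|expR (- (t ^+ 2 / 2 * A i n)) * cos a| <= 1.
    by rewrite normrM mulr_ile1// ?cos_max// expRN_norm_le1.
  apply: le_trans (ler_normB _ _) _.
  have x1 : 0 <= k * t ^+ 2 * A i n.
    by rewrite mulr_ge0 ?gauss_var_ge0// mulr_ge0 ?sqr_ge0// ltW.
  have x2 : 0 <= c * (t ^+ 4 / k) * pairs R n by rewrite mulr_ge0// mulr_ge0.
  have x4 : 0 <= t ^+ 2 / k * W i n.
    by rewrite mulr_ge0// /W mulr_ge0// (le_trans (pois_ge0 i)).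
  have x3 : 1 <= pairs R n by rewrite /pairs ler1n muln_gt0; case: n n2 {b1 b2 t2 x1 x2 x4} => [|[|]].
  rewrite /bound expr0 mulr1; lra.
have [n2|n2] := ltnP n 2; first exact: base.
have [m mE] : exists m, n = m.+2 by case: n n2 => [|[|m]] // _; exists m.
(* [Y] is the centred linear part of the split and [F] its centred remainder; they add up to the
   fluctuation of the conditional mean of the trie. *)
pose Y (x y : nat) := slope p i * (x%:R * p i true - y%:R * p i false).
pose F x y := branch_rest p i x y - Ebin (p i) n (branch_rest p i).
have EF : Ebin (p i) n F = 0 by rewrite /F EbinB Ebin_cst// subrr.
have EY1 : Ebin (p i) n (fun x y => x%:R * p i true - y%:R * p i false) = 0.
  rewrite EbinB (@eq_Ebin _ _ _ _ (fun x y => p i true * x%:R)); last by move=> *; rewrite mulrC.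
  rewrite [X in _ - X](@eq_Ebin _ _ _ _ (fun x y => p i false * y%:R)); last by move=> *; rewrite mulrC.
  by rewrite !EbinZ Ebin_left// Ebin_right//; ring.
have EY : Ebin (p i) n Y = 0 by rewrite /Y EbinZ EY1 mulr0.
have EY2 : Ebin (p i) n (fun x y => Y x y ^+ 2) = n%:R * step_var p i.
  rewrite (@eq_Ebin _ _ _ _ (fun x y => slope p i ^+ 2 * (x%:R * p i true - y%:R * p i false + 0) ^+ 2)).
    by rewrite EbinZ Ebin_sqr_shift// expr0n /= /step_var; ring.
  by move=> x y _; rewrite /Y addr0; ring.
have EY4 : Ebin (p i) n (fun x y => Y x y ^+ 4) <= S * n%:R ^+ 2.
  rewrite (@eq_Ebin _ _ _ _ (fun x y => slope p i ^+ 4 * (x%:R * p i true - y%:R * p i false) ^+ 4)).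
    rewrite EbinZ; apply: ler_pM; [by case/andP: (S4 i)| |by case/andP: (S4 i)|exact: Ebin_quad_le].
    by apply: Ebin_ge0 => // x y _; rewrite exprn_even_ge0.
  by move=> x y _; rewrite /Y; ring.
have EFE : Ebin (p i) n (fun x y => F x y ^+ 2) = Vbin (p i) n (branch_rest p i).
  by rewrite VbinE.
have hYF x y : (x + y = n)%N ->
    (toll n)%:R + e false x + e true y - e i n = Y x y + F x y.
  move=> xy; rewrite (mean_trieE p01 p_sum i n) /split_sum.
  have -> : Ebin (p i) n (fun k l => e false k + e true l)
     = slope p i * (n%:R * p i false) + Ebin (p i) n (branch_rest p i).
    rewrite -Ebin_left// -EbinZ -EbinD; apply: eq_Ebin => k' l' _; rewrite /branch_rest; ring.
  rewrite /F /Y /branch_rest -xy natrD.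
  have -> : p i true = 1 - p i false by rewrite -(p_sum i) addrC addKr.
  ring.
have EA2 : Ebin (p i) n (fun x y => (A false x + A true y - A i n) ^+ 2)
    <= (C3 + C4) ^+ 2 * n%:R ^+ 2.
  apply: Ebin_le => // x y xy; rewrite -exprMn -[leLHS]real_normK ?num_real//.
  rewrite lerXn2r ?nnegrE ?mulr_ge0 ?addr_ge0//.
  have := hsplit x y; have := happ i n; rewrite xy !ler_norml => /andP[? ?] /andP[? ?].
  by apply/andP; split; lra.
have kk : 0 < k <= 1 by apply/andP.
have := @gauss_step R p p01 p_sum (p i) L n (bound L) A Y F (e i n) (A i n) t k a
  (p_sum i) (p_ge0 i) gauss_var_ge0 (gauss_var_ge0 i n) kk IH hYF EY EF.
rewrite /root_law => /le_trans; apply.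
rewrite EY2 EFE.
have s1 : split_sum p (bound L) i n = k * t ^+ 2 * split_sum p A i n
  + t ^+ 2 / k * split_sum p W i n
  + c * (t ^+ 4 / k) * split_sum p (fun _ => pairs R) i n
  + 2 * r ^+ L * split_sum p (fun _ => pairs R) i n.
  rewrite /split_sum -!EbinZ -!EbinD; apply: eq_Ebin => x y _; rewrite /bound; ring.
rewrite -/(split_sum p (bound L) i n) s1 -/(split_sum p A i n).
have hp := split_sum_pairs p_sum i n.
have hA := hrec i n n2.
have n0 : 0 < n.-1.+1%:R :> R by rewrite ltr0n.
have np : n.-1.+1 = n by rewrite mE.
have hW : split_sum p W i n <= W i n - 3 * (n%:R * (tag_op p pot i n.-1 - pot i n.-1))
    - (3 * C1 + 2 * C2).
  have -> : split_sum p W i n = n%:R * tag_op p om i n.-1.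
    by rewrite -[X in split_sum _ _ _ X]np /W split_sum_tag np.
  have -> : tag_op p om i n.-1 = K - 3 * tag_op p pot i n.-1
      - M * tag_op p (fun _ a => a.+1%:R^-1) i n.-1.
    rewrite (tag_opB p (fun j a => K - 3 * pot j a) (fun _ a => M * a.+1%:R^-1)).
    by rewrite (tag_opB p (fun _ _ => K) (fun j a => 3 * pot j a)) tag_op_cst// !tag_opZ.
  have hT : (2 - r) / n%:R <= tag_op p (fun _ a => a.+1%:R^-1) i n.-1.
    by have := @tag_op_invS _ p p01 p_sum i n.-1; rewrite np; apply; rewrite mE.
  have N0 : 0 < n%:R :> R by rewrite -np.
  have hT' : M * (2 - r) <= n%:R * (M * tag_op p (fun _ a => a.+1%:R^-1) i n.-1).
    by rewrite mulrCA ler_wpM2l// mulrC -ler_pdivrMr.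
  rewrite -Me /W /om np.
  have -> : n%:R * (K - 3 * pot i n.-1 - M / n%:R) = n%:R * (K - 3 * pot i n.-1) - M.
    by field; rewrite gt_eqF.
  move: hT'; set T1 := tag_op _ _ _ _; set T2 := tag_op _ pot _ _; lra.
have hV : Vbin (p i) n (branch_rest p i) <= C1 + n%:R * (tag_op p pot i n.-1 - pot i n.-1).
  have := hpot i n.-1; rewrite np => /(_ _)/le_trans; apply; first by rewrite mE.
  have N0 : n%:R != 0 :> R by rewrite mE pnatr_eq0.
  by rewrite le_eqVlt; apply/orP; left; apply/eqP; field.
have n2p := sqr_le_pairs n2.
move: hA hW hV; set D := n%:R * (tag_op _ _ _ _ - _); set V := Vbin _ _ _.
set sA := split_sum p A i n; set sW := split_sum p W i n; set N := n%:R * step_var p i.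
move=> hA hW hV.
have kki : k <= k^-1 by rewrite (le_trans k1)// invf_ge1.
have t0 : 0 <= t ^+ 2 by exact: sqr_ge0.
have t4 : 0 <= t ^+ 4 by rewrite exprn_even_ge0.
have f1 : k * t ^+ 2 * sA + k * (t ^+ 2 * N) <= k * t ^+ 2 * A i n + t ^+ 2 / k * C2.
  have g : sA + N - A i n <= C2 by apply: le_trans hA; exact: ler_norm.
  have g1 : k * t ^+ 2 * (sA + N - A i n) <= k * t ^+ 2 * C2.
    by rewrite ler_wpM2l// mulr_ge0// ltW.
  have g2 : k * (t ^+ 2 * C2) <= k^-1 * (t ^+ 2 * C2) by rewrite ler_wpM2r// mulr_ge0.
  by move: g1 g2; set ki' := k^-1; lra.
have f2 : t ^+ 2 / 2 * `|sA + N - A i n| <= t ^+ 2 / k * C2.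
  apply: ler_pM => //; first by rewrite divr_ge0.
  by rewrite ler_wpM2l// lef_pV2 ?posrE//; lra.
have f3 : t ^+ 2 / k * sW + 3 / k * (t ^+ 2 * V) <= t ^+ 2 / k * (W i n - 2 * C2).
  have -> : 3 / k * (t ^+ 2 * V) = t ^+ 2 / k * (3 * V) by ring.
  by rewrite -mulrDr ler_wpM2l//; lra.
have f4 : c * (t ^+ 4 / k) * split_sum p (fun _ => pairs R) i n
   + 3 / k * (t ^+ 4 * (Ebin (p i) n (fun x y => Y x y ^+ 4) +
       Ebin (p i) n (fun x y => (A false x + A true y - A i n) ^+ 2)))
   <= c * (t ^+ 4 / k) * pairs R n.
  set Z := Ebin _ _ _ + _.
  have hZ : 3 * Z <= c * (1 - r) * pairs R n.
    rewrite ce; apply: (@le_trans _ _ (3 * ((S + (C3 + C4) ^+ 2) * n%:R ^+ 2))).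
      by rewrite ler_pM2l// mulrDl lerD.
    have G0 : 0 <= S + (C3 + C4) ^+ 2 by apply: addr_ge0 => //; exact: sqr_ge0.
    have := ler_wpM2l G0 n2p; set G := S + _; set N2 := n%:R ^+ 2; lra.
  have -> : 3 / k * (t ^+ 4 * Z) = t ^+ 4 / k * (3 * Z) by ring.
  have g1 := ler_wpM2l t4k hZ.
  have g2 : c * (t ^+ 4 / k) * split_sum p (fun _ => pairs R) i n
    <= c * (t ^+ 4 / k) * (r * pairs R n) by rewrite ler_wpM2l// mulr_ge0.
  by move: g1 g2; set u := t ^+ 4 / k; lra.
have f5 : 2 * r ^+ L * split_sum p (fun _ => pairs R) i n <= 2 * pairs R n * r ^+ L.+1.
  have -> : 2 * pairs R n * r ^+ L.+1 = 2 * r ^+ L * (r * pairs R n) by rewrite exprS; ring.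
  by rewrite ler_wpM2l// mulr_ge0// exprn_ge0.
move: f1 f2 f3 f4 f5; rewrite /bound.
set Q4 := Ebin _ _ _; set Q2 := Ebin _ _ _; set sP := split_sum _ _ _ _.
set z3 := _ * `|_|; set r1 := r ^+ L; set r2 := r ^+ L.+1; set a1 := A i n.
set w1 := W i n; set kk' := k^-1 => f1 f2 f3 f4 f5; lra.
Qed.
End trie_gauss.

(** * The root of the trie *)

Section root.
Variables (R : realType) (p : bool -> bool -> R) (mu : bool -> R).
Hypothesis p01 : forall i j, 0 < p i j < 1.
Hypothesis p_sum : forall i, p i false + p i true = 1.
Hypothesis mu_ge0 : forall i, 0 <= mu i.
Hypothesis mu_sum : mu false + mu true = 1.
Let p_gt0 i j : 0 < p i j. Proof. by case/andP: (p01 i j). Qed.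
Let p_ge0 i j : 0 <= p i j. Proof. exact: ltW. Qed.
Local Notation e := (mean_trie p).
Local Notation v := (var_trie p).
Local Notation g := (mean_incr p).
Local Notation A := (gauss_var p).

Definition root_mean n : R := (toll n)%:R + Ebin mu n (fun k l => e false k + e true l).
Definition root_var n : R := Ebin mu n (fun k l => v false k + v true l)
  + Vbin mu n (fun k l => e false k + e true l).

Lemma cvg_root_mean n : root_law p mu L n (fun x => x%:R) @[L --> \oo] --> root_mean n.
Proof.
have E L : root_law p mu L n (fun x => x%:R) =
    (toll n)%:R + Ebin mu n (fun k l => mean_lev p L false k + mean_lev p L true l).
  rewrite -[(toll n)%:R](Ebin_cst mu_sum n) -EbinD; apply: eq_Ebin => k l _.
  rewrite (@eq_trie_law _ _ _ _ _ _ (fun x => ((toll n)%:R + x%:R) + mean_lev p L true l)).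
    by rewrite !trie_lawD !trie_law_cst// addrA.
  move=> x; rewrite -[X in X + _](trie_law_cst p_sum L true l) /mean_lev -trie_lawD.
  by apply: eq_trie_law => y; rewrite !natrD.
under eq_cvg do rewrite E.
apply: cvgD; first exact: cvg_cst.
by apply: cvg_Ebin => k l; apply: cvgD; exact: cvg_mean_lev.
Qed.

Lemma cvg_root_sqr n : root_law p mu L n (fun x => x%:R ^+ 2) @[L --> \oo]
  --> root_var n + root_mean n ^+ 2.
Proof.
have E L : root_law p mu L n (fun x => x%:R ^+ 2) =
    Ebin mu n (fun k l => (sqr_lev p L false k + sqr_lev p L true l) +
    ((toll n)%:R ^+ 2 + 2 * (toll n)%:R * (mean_lev p L false k + mean_lev p L true l)
     + 2 * (mean_lev p L false k * mean_lev p L true l))).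
  apply: eq_Ebin => k l _.
  set a := (toll n)%:R : R; set m1 := mean_lev p L true l.
  rewrite (@eq_trie_law _ _ _ _ _ _ (fun x => (x%:R ^+ 2 + (2 * (a + m1)) * x%:R)
     + (a ^+ 2 + 2 * a * m1 + sqr_lev p L true l))).
    rewrite !trie_lawD trie_lawZ !trie_law_cst// -/(mean_lev p L false k).
    rewrite -/(sqr_lev p L false k); ring.
  move=> x.
  rewrite (@eq_trie_law _ _ _ _ _ _ (fun y => (y%:R ^+ 2 + (2 * (a + x%:R)) * y%:R)
     + (a ^+ 2 + 2 * a * x%:R + x%:R ^+ 2))); last first.
    by move=> y; rewrite !natrD -/a; ring.
  rewrite !trie_lawD trie_lawZ !trie_law_cst// -/(mean_lev p L true l).
  by rewrite -/(sqr_lev p L true l) -/m1; ring.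
under eq_cvg do rewrite E.
have -> : root_var n + root_mean n ^+ 2 =
    Ebin mu n (fun k l => (sqr_trie p false k + sqr_trie p true l) +
    ((toll n)%:R ^+ 2 + 2 * (toll n)%:R * (e false k + e true l)
     + 2 * (e false k * e true l))).
  rewrite /root_var /root_mean /Vbin /=; set a := (toll n)%:R.
  set b := Ebin mu n (fun k l => e false k + e true l).
  have -> : (a + b) ^+ 2 = Ebin mu n (fun k l => a ^+ 2 + 2 * a * (e false k + e true l))
      + b ^+ 2.
    by rewrite EbinD Ebin_cst// EbinZ -/b; ring.
  transitivity (Ebin mu n (fun k l => v false k + v true l)
    + (Ebin mu n (fun k l => (e false k + e true l) ^+ 2)
    + Ebin mu n (fun k l => a ^+ 2 + 2 * a * (e false k + e true l)))); first by ring.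
  by rewrite -!EbinD; apply: eq_Ebin => k l _; rewrite /var_trie; ring.
apply: cvg_Ebin => k l.
have h0 := @cvg_mean_lev _ p p01 p_sum false k.
have h1 := @cvg_mean_lev _ p p01 p_sum true l.
apply: cvgD; first by apply: cvgD; exact: cvg_sqr_lev.
apply: cvgD; last by apply: cvgM; [exact: cvg_cst|exact: cvgM].
apply: cvgD; first exact: cvg_cst.
by apply: cvgM; [exact: cvg_cst|exact: cvgD].
Qed.

Lemma toll_le n : (toll n)%:R <= n%:R :> R.
Proof. by rewrite ler_nat /toll; case: ltnP. Qed.

Lemma root_mean_approx : exists2 C : R, 0 <= C & forall n,
  `|root_mean n - n%:R * harm n / Hrate p| <= C * n%:R.
Proof.
have [C C0 hC] := mean_trie_approx p01 p_sum.
have H0 := Hrate_gt0 p01; have Hi : 0 <= (Hrate p)^-1 by rewrite invr_ge0 ltW.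
exists (1 + C + (Hrate p)^-1) => [|n]; first by rewrite !addr_ge0.
have -> : root_mean n - n%:R * harm n / Hrate p = Ebin mu n (fun k l =>
    (toll n)%:R + (e false k + e true l) - n%:R * harm n / Hrate p).
  by rewrite EbinB EbinD !Ebin_cst.
apply: le_trans (ler_norm_Ebin mu_ge0 _ _) _; apply: Ebin_le => // k l kl.
have h1 := hC false k; have h2 := hC true l; have h3 := toll_le n.
have h4 : 0 <= (toll n)%:R :> R by [].
have /andP[h5 h6] := nharm_split R k l.
have NE := natrD R k l; rewrite kl in h5 h6 NE.
have g5 := ler_wpM2r Hi h5; have g6 := ler_wpM2r Hi h6; rewrite mul0r in g5.
move: h1 h2 h3 h4 g5 g6; set iH := (Hrate p)^-1; set hk := k%:R * harm k.
set hl := l%:R * harm l; set hn := n%:R * harm n => h1 h2 h3 h4 g5 g6.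
have -> : (1 + C + iH) * n%:R = n%:R + C * k%:R + C * l%:R + n%:R * iH.
  by rewrite NE; ring.
move: h1 h2; rewrite !ler_norml => /andP[a1 a2] /andP[b1 b2].
by apply/andP; split; lra.
Qed.

(** The root is a single split and may cost [O(n)], so its linear part is not isolated: each squared
    increment has mean [O(1)], and Efron-Stein multiplies by [n]. *)
Lemma root_Vbin_le : exists2 C : R, 0 <= C & forall n,
  Vbin mu n (fun k l => e false k + e true l) <= C * n%:R.
Proof.
have [K K0 wK] := incr_rest_bounded p01 p_sum.
have H0 := Hrate_gt0 p01; have Hi : 0 <= (Hrate p)^-1 by rewrite invr_ge0 ltW.
have triv (i : bool) : mu i = 0 -> mu false * mu true = 0.
  by case: i => ->; rewrite ?mul0r ?mulr0.
(* The estimates by [ln (mu i)] need positive weights. A degenerate [mu] sends all strings the same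
   way, and the variance vanishes. *)
have V0 : mu false * mu true = 0 -> exists2 C : R, 0 <= C & forall n,
    Vbin mu n (fun k l => e false k + e true l) <= C * n%:R.
  move=> m0; exists 0 => // -[|n]; first by rewrite /Vbin /= subrr mulr0.
  apply: le_trans (Efron_Stein mu_sum mu_ge0 _ _) _.
  by rewrite m0 mulr0 !mul0r.
have [/eqP m0|m0] := boolP (mu false == 0); first exact/V0/(triv false).
have [/eqP m1|m1] := boolP (mu true == 0); first exact/V0/(triv true).
have {m0}m0 : 0 < mu false by rewrite lt_neqAle eq_sym m0 mu_ge0.
have {m1}m1 : 0 < mu true by rewrite lt_neqAle eq_sym m1 mu_ge0.
have [a a0 ha] := Ebin_harm_sqr mu_sum mu_ge0 m0.
have [b b0 hb] := Ebin_harm_sqrr mu_sum mu_ge0 m1.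
pose D : R := (ln (mu false) - ln (mu true)) / Hrate p + ent_gap p / Hrate p.
pose Q : R := 4 / Hrate p ^+ 2.
have Q0 : 0 <= Q by rewrite divr_ge0// sqr_ge0.
exists (Q * (a + b) + (4 * D ^+ 2 + 16 * K ^+ 2)) => [|[|n]].
- by repeat apply: addr_ge0; apply: mulr_ge0 => //; rewrite ?addr_ge0 ?sqr_ge0.
- by rewrite /Vbin /= subrr mulr0.
apply: le_trans (Efron_Stein mu_sum mu_ge0 _ _) _.
rewrite -mulrA mulrC ler_wpM2r//.
pose P1 (k : nat) := harm k - harm n - ln (mu false) : R.
pose P2 (l : nat) := harm l - harm n - ln (mu true) : R.
have mm : mu false * mu true <= 1.
  by rewrite mulr_ile1 ?(ltW m0) ?(ltW m1)// -mu_sum ?lerDl ?lerDr ltW.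
set E := Ebin _ _ _.
have E0 : 0 <= E by apply: Ebin_ge0 => // k l _; exact: sqr_ge0.
apply: (@le_trans _ _ E); first by rewrite ler_piMl.
apply: (@le_trans _ _ (Q * (Ebin mu n (fun k _ => P1 k ^+ 2) + Ebin mu n (fun _ l => P2 l ^+ 2))
   + (4 * D ^+ 2 + 16 * K ^+ 2))).
  rewrite -EbinD -EbinZ -[X in _ <= _ + X](Ebin_cst mu_sum n) -EbinD.
  apply: le_Ebin => // k l _.
  have -> : e false k.+1 + e true l - (e false k + e true l.+1)
    = P1 k / Hrate p - P2 l / Hrate p + D + (incr_rest p false k - incr_rest p true l).
    rewrite /D -(poisson_gap p01) /incr_rest /mean_profile /profile /P1 /P2 /mean_incr.
    by ring.
  have -> : Q * (P1 k ^+ 2 + P2 l ^+ 2) = 4 * ((P1 k / Hrate p) ^+ 2 + (P2 l / Hrate p) ^+ 2).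
    by rewrite /Q; field; rewrite gt_eqF.
  have : `|incr_rest p false k - incr_rest p true l| <= 2 * K.
    apply: le_trans (ler_normB _ _) _.
    by have := wK false k; have := wK true l; lra.
  move=> h.
  have h2 : (incr_rest p false k - incr_rest p true l) ^+ 2 <= (2 * K) ^+ 2.
    by rewrite -[leLHS]real_normK ?num_real// lerXn2r ?nnegrE ?mulr_ge0.
  move: h2; set x := P1 k / _; set y := P2 l / _; set z := incr_rest _ _ _ - _.
  have := sqr_ge0 (x + y); have := sqr_ge0 (x - D); have := sqr_ge0 (x - z).
  have := sqr_ge0 (y + D); have := sqr_ge0 (y + z); have := sqr_ge0 (D - z).
  lra.
rewrite lerD2r ler_wpM2l//; apply: lerD.
  by apply: le_trans (ha n) _; rewrite ler_piMr// invf_le1 ?ltr0n// ler1n.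
by apply: le_trans (hb n) _; rewrite ler_piMr// invf_le1 ?ltr0n// ler1n.
Qed.

Lemma root_var_approx : exists2 C : R, 0 <= C & forall n (lam : R), 0 < lam <= 1 ->
  `|root_var n - sigma2 p * (n%:R * harm n)| <= C * (lam * (n%:R * harm n) + n%:R / lam).
Proof.
have [C C0 hC] := var_trie_approx p01 p_sum.
have [D D0 hD] := root_Vbin_le.
have s0 := sigma2_ge0 p01.
exists (C + D + sigma2 p) => [|n lam lam01]; first by apply: addr_ge0 => //; exact: addr_ge0.
have /andP[l0 l1] := lam01.
have il : 1 <= lam^-1 by rewrite invf_ge1.
have V0 := Vbin_ge0 mu_sum mu_ge0 n (fun k l => e false k + e true l).
have hn0 : 0 <= n%:R * harm n :> R by rewrite mulr_ge0// harm_ge0.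
have -> : root_var n - sigma2 p * (n%:R * harm n) = Ebin mu n (fun k l =>
    v false k + v true l - sigma2 p * (n%:R * harm n))
    + Vbin mu n (fun k l => e false k + e true l).
  by rewrite EbinB Ebin_cst// /root_var; ring.
have h1 : `|Ebin mu n (fun k l => v false k + v true l - sigma2 p * (n%:R * harm n))|
   <= C * (lam * (n%:R * harm n) + n%:R / lam) + sigma2 p * n%:R.
  apply: le_trans (ler_norm_Ebin mu_ge0 _ _) _; apply: Ebin_le => // k l kl.
  have h1 := hC false k lam lam01; have h2 := hC true l lam lam01.
  have /andP[h5 h6] := nharm_split R k l.
  have NE := natrD R k l; rewrite kl in h5 h6 NE.
  have g5 := ler_wpM2l s0 h5; have g6 := ler_wpM2l s0 h6; rewrite mulr0 in g5.
  have g7 := ler_wpM2l (mulr_ge0 C0 (ltW l0)) h5; rewrite mulr0 in g7.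
  move: h1 h2 g5 g6 g7; set hk := k%:R * harm k.
  set hl := l%:R * harm l; set hn := n%:R * harm n => h1 h2 g5 g6 g7.
  have -> : C * (lam * hn + n%:R / lam) = C * lam * hn + C * k%:R / lam + C * l%:R / lam.
    by rewrite NE; ring.
  move: h1 h2; rewrite !ler_norml; set li := lam^-1 => /andP[a1 a2] /andP[b1 b2].
  by apply/andP; split; lra.
apply: le_trans (ler_normD _ _) _; rewrite (ger0_norm V0).
have h2 := hD n.
have h3 : (D + sigma2 p) * n%:R <= (D + sigma2 p) * (n%:R / lam).
  by apply: ler_wpM2l; [exact: addr_ge0|rewrite ler_peMr].
have h4 : 0 <= (D + sigma2 p) * (lam * (n%:R * harm n)).
  by apply: mulr_ge0; [exact: addr_ge0|apply: mulr_ge0 => //; exact: ltW].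
move: h1 h2 h3 h4; set X := `|Ebin _ _ _|; set V := Vbin _ _ _; set hn := n%:R * harm n.
set li := lam^-1 => h1 h2 h3 h4; lra.
Qed.

(** The split at the root has variance [O(n)], below the order [n log n], so [gauss_step] is applied
    with linear part [0] and the whole fluctuation in [F]. *)
Lemma root_law_gauss : exists2 C : R, 0 <= C & forall k t, 0 < k <= 1 ->
  forall L n a,
  `|root_law p mu L n (fun x => cos (t * (x%:R - root_mean n) + a))
    - expR (- (t ^+ 2 / 2 * (sigma2 p * (n%:R * harm n)))) * cos a|
  <= k * t ^+ 2 * (sigma2 p * (n%:R * harm n)) + C * (t ^+ 2 / k) * n%:R
     + C * (t ^+ 4 / k) * n%:R ^+ 2 + 2 * n%:R ^+ 2 * coll_rate p ^+ L.
Proof.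
have [C C0 hC] := trie_law_gauss p01 p_sum.
have [D D0 hD] := root_Vbin_le.
have [G G0 hG] := gauss_var_split p01.
exists (C + G + 3 * D + G + 3 * G ^+ 2 + C) => [|k t k01 L n a].
  by repeat apply: addr_ge0 => //; apply: mulr_ge0 => //; exact: sqr_ge0.
set s := sigma2 p * (n%:R * harm n); have /andP[k0 k1] := k01.
have s0 : 0 <= s.
  by apply: mulr_ge0; [exact: sigma2_ge0|apply: mulr_ge0 => //; exact: harm_ge0].
pose delta i m := k * t ^+ 2 * A i m + C * (t ^+ 2 / k) * m%:R
  + C * (t ^+ 4 / k) * pairs R m + 2 * pairs R m * coll_rate p ^+ L.
pose F x y := e false x + e true y - Ebin mu n (fun k l => e false k + e true l).
have EF : Ebin mu n F = 0 by rewrite /F EbinB Ebin_cst// subrr.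
have hYF x y : (x + y = n)%N ->
    (toll n)%:R + e false x + e true y - root_mean n = 0 + F x y.
  by move=> _; rewrite /root_mean /F; ring.
have := @gauss_step R p p01 p_sum mu L n delta A (fun _ _ => 0) F (root_mean n) s t k a
  mu_sum mu_ge0 (gauss_var_ge0 p01) s0 k01 (hC k t k01 L) hYF (Ebin_cst mu_sum n 0) EF.
move=> /le_trans; apply.
have -> : Ebin mu n (fun x y => F x y ^+ 2) = Vbin mu n (fun k l => e false k + e true l).
  by rewrite VbinE.
rewrite !expr0n /= !Ebin_cst// mulr0 mulr0 add0r add0r addr0.
have ki : 0 <= k^-1 by rewrite invr_ge0 ltW.
have kki : 1 <= k^-1 by rewrite invf_ge1.
have t0 : 0 <= t ^+ 2 by exact: sqr_ge0.
have t4 : 0 <= t ^+ 4 by rewrite exprn_even_ge0.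
have t2k : 0 <= t ^+ 2 / k by rewrite mulr_ge0.
have t4k : 0 <= t ^+ 4 / k by rewrite mulr_ge0.
have r0 : 0 <= coll_rate p ^+ L by rewrite exprn_ge0// coll_rate_ge0.
have n0 : 0 <= n%:R :> R by [].
have pn : pairs R n <= n%:R ^+ 2 by rewrite /pairs -natrX ler_nat -mulnn leq_mul2l leq_pred orbT.
have h1 : Ebin mu n (fun x y => delta false x + delta true y)
  <= k * t ^+ 2 * (s + G * n%:R) + C * (t ^+ 2 / k) * n%:R
     + (C * (t ^+ 4 / k) + 2 * coll_rate p ^+ L) * n%:R ^+ 2.
  apply: Ebin_le => // x y xy; rewrite /delta.
  have g1 : A false x + A true y <= s + G * n%:R.
    by have := hG x y; rewrite xy -/s ler_norml => /andP[_]; lra.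
  have g2 := pairsD R x y; rewrite xy in g2.
  have NE := natrD R x y; rewrite xy in NE.
  have kt : 0 <= k * t ^+ 2 by rewrite mulr_ge0// ltW.
  have g3 := ler_wpM2l kt g1.
  have c0 : 0 <= C * (t ^+ 4 / k) + 2 * coll_rate p ^+ L by rewrite addr_ge0// mulr_ge0.
  have g4 := ler_wpM2l c0 (le_trans g2 pn).
  move: g3 g4; rewrite NE; set P1 := pairs R x; set P2 := pairs R y.
  set t2k' := t ^+ 2 / k; set t4k' := t ^+ 4 / k; set rr := _ ^+ L; set N2 := _ ^+ 2.
  set a1 := A _ _; set a2 := A _ _; set kt2 := k * t ^+ 2.
  by move=> g3 g4; lra.
have h2 : Ebin mu n (fun x y => (A false x + A true y - s) ^+ 2) <= G ^+ 2 * n%:R ^+ 2.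
  apply: Ebin_le => // x y xy; rewrite -exprMn -[leLHS]real_normK ?num_real//.
  by rewrite lerXn2r ?nnegrE ?mulr_ge0//; have := hG x y; rewrite xy.
have h3 : `|Ebin mu n (fun x y => A false x + A true y) + 0 - s| <= G * n%:R.
  rewrite addr0 -[X in _ - X](Ebin_cst mu_sum n) -EbinB.
  apply: le_trans (ler_norm_Ebin mu_ge0 _ _) _; apply: Ebin_le => // x y xy.
  by have := hG x y; rewrite xy.
rewrite addr0 in h3.
have h4 := hD n.
have f1 : 3 / k * (t ^+ 2 * Vbin mu n (fun k l => e false k + e true l))
   <= 3 * D * (t ^+ 2 / k) * n%:R.
  have -> : 3 * D * (t ^+ 2 / k) * n%:R = 3 / k * (t ^+ 2 * (D * n%:R)) by ring.
  by rewrite ler_wpM2l ?mulr_ge0// ler_wpM2l.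
have f2 : 3 / k * (t ^+ 4 * Ebin mu n (fun x y => (A false x + A true y - s) ^+ 2))
   <= 3 * G ^+ 2 * (t ^+ 4 / k) * n%:R ^+ 2.
  have -> : 3 * G ^+ 2 * (t ^+ 4 / k) * n%:R ^+ 2 = 3 / k * (t ^+ 4 * (G ^+ 2 * n%:R ^+ 2)) by ring.
  by rewrite ler_wpM2l ?mulr_ge0// ler_wpM2l.
have f3 : t ^+ 2 / 2 * (G * n%:R) <= t ^+ 2 / k * (G * n%:R).
  by rewrite ler_wpM2r ?mulr_ge0// ler_wpM2l// lef_pV2 ?posrE//; lra.
have f4 : k * t ^+ 2 * (G * n%:R) <= t ^+ 2 / k * (G * n%:R).
  rewrite ler_wpM2r ?mulr_ge0// mulrC ler_wpM2l//; lra.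
have f5 : t ^+ 2 / 2 * `|Ebin mu n (fun x y => A false x + A true y) - s|
    <= t ^+ 2 / 2 * (G * n%:R) by apply: ler_wpM2l => //; rewrite divr_ge0.
have u1 : 0 <= t ^+ 2 / k * n%:R by rewrite mulr_ge0.
have u2 : 0 <= t ^+ 4 / k * n%:R ^+ 2 by rewrite mulr_ge0// sqr_ge0.
have w1 := mulr_ge0 C0 u1; have w2 := mulr_ge0 (sqr_ge0 G) u1.
have w3 := mulr_ge0 C0 u2; have w4 := mulr_ge0 G0 u2; have w5 := mulr_ge0 D0 u2.
move: h1 f1 f2 f3 f4 f5 w1 w2 w3 w4 w5.
set E1 := Ebin mu n (fun x y => delta _ _ + _); set V := Vbin _ _ _.
set E2 := Ebin _ _ _; set E3 := `|_|; set rr := _ ^+ L; set ik := k^-1.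
move=> h1 f1 f2 f3 f4 f5 w1 w2 w3 w4 w5; lra.
Qed.
End root.

(** * The normal distribution *)

Section gaussian.
Variable R : realType.
Local Notation leb := (@lebesgue_measure R).
Local Notation pdf := (@normal_pdf R 0 1).

Lemma normal_pdf01E x : pdf x = normal_peak 1 * expR (- (x ^+ 2 / 2)).
Proof.
rewrite normal_pdfE ?oner_neq0// /normal_fun subr0 expr1n.
by congr (_ * expR _); rewrite mulNr.
Qed.

Lemma is_derive_cmul (f : R -> R) (k x df : R) :
  is_derive x 1 f df -> is_derive x 1 (fun y => k * f y) (k * df).
Proof. exact: (@is_deriveZ _ _ _ f k x 1 df). Qed.

Lemma is_derive_normal_pdf (x : R) : is_derive x 1 pdf (- x * pdf x).
Proof.
have -> : pdf = (fun y => normal_peak 1 * expR (- (y ^+ 2 / 2))).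
  by apply/funext => y; exact: normal_pdf01E.
have d1 : is_derive x 1 (fun y : R => - (2^-1 * y ^+ 2)) (- x).
  have h : is_derive x 1 (fun y : R => y ^+ 2) (2 * x).
    by have := @is_deriveX _ _ id 2 x 1 1 _; rewrite [_ *: _]mulr1 exprfctE expr1; apply; exact: is_derive_id.
  have := is_derive_cmul 2^-1 h; rewrite mulKf// => d0.
  exact: (@is_deriveN _ _ _ _ x 1 _ d0).
have d2 : is_derive x 1 (fun y : R => expR (- (2^-1 * y ^+ 2))) (expR (- (2^-1 * x ^+ 2)) * - x).
  exact: (@is_derive1_comp _ expR (fun y => - (2^-1 * y ^+ 2))).
have d3 := is_derive_cmul (normal_peak 1) d2.
rewrite (_ : (fun y => _) = fun y => normal_peak 1 * expR (- (2^-1 * y ^+ 2))); last first.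
  by apply/funext => y; rewrite [2^-1 * _]mulrC.
rewrite (_ : - x * _ = normal_peak 1 * (expR (- (2^-1 * x ^+ 2)) * - x)) //.
by rewrite [x ^+ 2 / 2]mulrC; ring.
Qed.

Lemma continuous_pdf : continuous pdf.
Proof. by apply: continuous_normal_pdf; rewrite oner_neq0. Qed.

Lemma integrable_pdf : leb.-integrable setT (EFin \o pdf).
Proof. exact: (@integrable_normal_pdf R 0 1). Qed.

(** Domination by the normal density of variance [2]: [|x|] is at most [1 + x^2 / 4], hence at most
    [expR (x^2 / 4)]. *)
Lemma integrable_id_pdf : leb.-integrable setT (EFin \o (fun x => `|x| * pdf x)).
Proof.
have s2 : Num.sqrt 2 != 0 :> R by rewrite gt_eqF// sqrtr_gt0.
have p2 : 0 < normal_peak (Num.sqrt 2 : R) by exact: normal_peak_gt0.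
pose c : R := normal_peak 1 / normal_peak (Num.sqrt 2).
have c0 : 0 <= c by rewrite divr_ge0 ?normal_peak_ge0.
have := @integrableZl _ _ _ leb setT measurableT c (EFin \o normal_pdf 0 (Num.sqrt 2))
  (@integrable_normal_pdf R 0 (Num.sqrt 2)).
apply: le_integrable => //.
  apply/measurable_EFinP/measurable_funM; last exact: measurable_normal_pdf.
  by apply: continuous_measurable_fun; exact: norm_continuous.
move=> x _; rewrite /= lee_fin [leLHS]ger0_norm ?mulr_ge0 ?normal_pdf_ge0//.
rewrite [leRHS](ger0_norm (mulr_ge0 c0 (normal_pdf_ge0 _ _ _))) normal_pdf01E normal_pdfE//.
rewrite /c [X in _ <= X]mulrA divfK ?gt_eqF//.
rewrite mulrCA ler_wpM2l ?normal_peak_ge0// /normal_fun subr0 sqr_sqrtr//.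
have -> : - (x ^+ 2 / 2) = - x ^+ 2 / (2 *+ 2) - (x ^+ 2 / 4) by field.
rewrite expRD mulrCA ler_piMr ?expR_ge0// expRN ler_pdivrMr ?expR_gt0// mul1r.
apply: le_trans (expR_ge1Dx _).
rewrite -[x ^+ 2]real_normK ?num_real//; have := sqr_ge0 (1 - `|x| / 2); lra.
Qed.

Lemma integrable_bounded_pdf (f : R -> R) (c : R) : measurable_fun setT f ->
  (forall x, `|f x| <= c) ->
  leb.-integrable setT (EFin \o (fun x => f x * pdf x)).
Proof.
move=> mf fc.
have := @integrableZl _ _ _ leb setT measurableT c (EFin \o pdf) integrable_pdf.
apply: le_integrable => //.
  by apply/measurable_EFinP/measurable_funM => //; exact: measurable_normal_pdf.
move=> x _ /=; rewrite lee_fin !normrM (ger0_norm (normal_pdf_ge0 _ _ _)).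
by rewrite ler_wpM2r ?normal_pdf_ge0// (le_trans (fc x))// ler_norm.
Qed.

Lemma continuous_trig (F : R -> R) (s a : R) : continuous F ->
  continuous (fun x => F (s * x + a)).
Proof.
move=> cF x; apply: (@continuous_comp _ _ _ (fun x => s * x + a) F); last exact: cF.
by apply: cvgD; [apply: cvgM; [exact: cvg_cst|exact: cvg_id]|exact: cvg_cst].
Qed.

Lemma is_derive_affine (s a x : R) : is_derive x 1 (fun x : R => s * x + a) s.
Proof.
have d1 := is_derive_cmul s (is_derive_id x 1).
have := @is_deriveD _ _ _ (fun y => s * y) (cst a) x 1 _ _ d1 (is_derive_cst a x 1).
by rewrite addr0 mulr1.
Qed.

Lemma integrable_id_trig_pdf (s a : R) :
  leb.-integrable setT (EFin \o (fun x => x * sin (s * x + a) * pdf x)).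
Proof.
apply: le_integrable integrable_id_pdf => //.
  apply/measurable_EFinP/measurable_funM; last exact: measurable_normal_pdf.
  apply: measurable_funM => //; apply: continuous_measurable_fun.
  by apply: continuous_trig; exact: continuous_sin.
move=> x _ /=; rewrite lee_fin !normrM normr_id ler_wpM2r// ler_piMr// sin_max//.
Qed.

Let seg n : set R := `[- n.+1%:R, n.+1%:R].

Lemma cvg_integral_segments (f : R -> R) : leb.-integrable setT (EFin \o f) ->
  (\int[leb]_(x in seg n) (f x)%:E)%E @[n --> \oo]
    --> (\int[leb]_x (f x)%:E)%E.
Proof.
move=> fi; have mf := measurable_int _ fi.
have mfR : measurable_fun setT f by exact/measurable_EFinP.
pose f_ n x := (f x * \1_(seg n) x)%:E.
have -> : (fun n => \int[leb]_(x in seg n) (f x)%:E)%E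
    = (fun n => \int[leb]_x f_ n x)%E.
  apply/funext => n; rewrite integral_mkcond; apply: eq_integral => x _.
  by rewrite /f_ /patch indicE; case: (x \in _); rewrite ?mulr1 ?mulr0.
have mf_ n : measurable_fun setT (f_ n).
  apply/measurable_EFinP/measurable_funM; first exact: mfR.
  by apply: measurable_indic; exact: measurable_itv.
have f_f : \forall x \ae leb, setT x -> f_ n x @[n --> \oo] --> (EFin \o f) x.
  apply: aeW => x _; apply: cvg_near_cst.
  near=> n; rewrite /f_ indicE mem_set ?mulr1// /seg /= in_itv /= -ler_norml.
  rewrite (@le_trans _ _ n%:R) ?ler_nat//.
  by near: n; exact: nbhs_infty_ger.
have f_le : \forall x \ae leb, forall n, setT x -> (`|f_ n x| <= (abse \o (EFin \o f)) x)%E.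
  apply: aeW => x n _; rewrite /f_ indicE /= lee_fin normrM.
  by case: (x \in _); rewrite ?normr1 ?normr0 ?mulr1 ?mulr0.
have [_ _] := @dominated_convergence _ _ _ leb setT measurableT f_ _ _ mf_ mf f_f (integrable_abse fi) f_le.
exact.
Unshelve. all: end_near. Qed.

(** The integrand is the derivative of [sin (s * x + a) * pdf x], which vanishes at both ends of
    growing segments. *)
Lemma gaussian_by_parts (s a : R) :
  (\int[leb]_x (s * cos (s * x + a) * pdf x - x * sin (s * x + a) * pdf x)%:E = 0)%E.
Proof.
set f := fun x => s * cos (s * x + a) * pdf x - x * sin (s * x + a) * pdf x.
pose F x := sin (s * x + a) * pdf x.
have dF (x : R) : is_derive x 1 F (f x).
  have d1 : is_derive x 1 (fun x => sin (s * x + a)) (cos (s * x + a) * s).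
    exact: (@is_derive1_comp _ (@sin R) (fun x => s * x + a) x _ _ _ (is_derive_affine s a x)).
  have -> : f x = sin (s * x + a) * (- x * pdf x) + pdf x * (cos (s * x + a) * s).
    by rewrite /f; ring.
  exact: (@is_deriveM _ _ (fun x => sin (s * x + a)) pdf x 1 _ _ d1 (is_derive_normal_pdf x)).
have cf : continuous f.
  move=> x; apply: cvgB; apply: cvgM; try exact: continuous_pdf.
    by apply: cvgM; [exact: cvg_cst|apply: continuous_trig; exact: continuous_cos].
  by apply: cvgM; [exact: cvg_id|apply: continuous_trig; exact: continuous_sin].
have fi : leb.-integrable setT (EFin \o f).
  have i1 : leb.-integrable setT (EFin \o (fun x => s * cos (s * x + a) * pdf x)).
    apply: (@integrable_bounded_pdf _ `|s|).
      apply: continuous_measurable_fun => x; apply: cvgM; first exact: cvg_cst.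
      by apply: continuous_trig; exact: continuous_cos.
    by move=> x; rewrite normrM ler_piMr// cos_max.
  exact: integrableB i1 (integrable_id_trig_pdf s a).
have := cvg_integral_segments fi.
have -> : (fun n => \int[leb]_(x in seg n) (f x)%:E)%E
   = (fun n => (F n.+1%:R - F (- n.+1%:R))%:E).
  apply/funext => n; rewrite (@continuous_FTC2 R f F)//.
  - by apply: (@lt_trans _ _ 0); rewrite ?oppr_lt0 ltr0n.
  - exact: continuous_subspaceT.
  - split=> [x _||]; first by have := dF x.
    + apply: cvg_at_right_filter; apply: differentiable_continuous.
      by apply/derivable1_diffP; have := dF (- n.+1%:R).
    + apply: cvg_at_left_filter; apply: differentiable_continuous.
      by apply/derivable1_diffP; have := dF n.+1%:R.
  - by move=> x _; rewrite derive1E; have := dF x => /@derive_val.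
move=> h.
have F0 : F n.+1%:R - F (- n.+1%:R) @[n --> \oo] --> 0.
  have Fn n y : `|y| = n.+1%:R -> `|F y| <= normal_peak 1 * n.+1%:R^-1.
    move=> yn; rewrite /F normrM (ger0_norm (normal_pdf_ge0 _ _ _)).
    apply: (@le_trans _ _ (pdf y)); first by rewrite ler_piMl ?normal_pdf_ge0 ?sin_max.
    rewrite normal_pdf01E ler_wpM2l ?normal_peak_ge0// expRN lef_pV2 ?posrE ?expR_gt0//.
    apply: le_trans (expR_ge1Dx _); rewrite -[y ^+ 2]real_normK ?num_real// yn.
    by have := sqr_ge0 (n.+1%:R - 1 : R); lra.
  apply/cvgr0Pnorm_lt => eps eps0.
  have h0 : 2 * normal_peak 1 * n.+1%:R^-1 @[n --> \oo] --> (2 * normal_peak 1 * 0 : R).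
    by apply: cvgM; [exact: cvg_cst|exact: cvg_harmonic].
  rewrite mulr0 in h0; near=> n.
  apply: (@le_lt_trans _ _ (2 * normal_peak 1 * n.+1%:R^-1)).
    apply: le_trans (ler_normB _ _) _.
    rewrite -mulrA mulr_natl mulr2n; apply: lerD; apply: Fn; first exact: normr_nat.
    by rewrite normrN normr_nat.
  near: n; exact: cvgr_lt h0 _ eps0.
apply: (cvg_unique _ h); first exact: ereal_hausdorff.
by apply/fine_cvgP; split; [exact: nearW|exact: F0].
Unshelve. all: end_near. Qed.

(** Differentiation under the integral and integration by parts give [G' = - s G] for the left-hand
    side [G], so [expR (s ^ 2 / 2) * G] is constant and equals its value [cos a] at [0]. *)
Lemma gaussian_cos (s a : R) :
  \int[leb]_x (cos (s * x + a) * pdf x) = expR (- (s ^+ 2 / 2)) * cos a.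
Proof.
pose G (s : R) := \int[leb]_x (cos (s * x + a) * pdf x).
pose f (s x : R) := cos (s * x + a) * pdf x.
have if_ r : leb.-integrable setT (EFin \o f r).
  apply: (@integrable_bounded_pdf _ 1); last by move=> x; exact: cos_max.
  by apply: continuous_measurable_fun; apply: continuous_trig; exact: continuous_cos.
have df (r x : R) : is_derive r 1 (f ^~ x) (- (x * sin (r * x + a) * pdf x)).
  have d0 : is_derive r 1 (fun r => r * x + a) x.
    have -> : (fun r => r * x + a) = (fun r => x * r + a).
      by apply/funext => y; rewrite mulrC.
    exact: is_derive_affine.
  have d1 := @is_derive1_comp _ (@cos R) (fun r => r * x + a) r _ _ (is_derive_cos _) d0.
  have d2 := is_derive_cmul (pdf x) d1.
  rewrite (_ : f ^~ x = fun y => pdf x * (cos \o (fun r => r * x + a)) y); last first.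
    by apply/funext => y; rewrite /f mulrC.
  by apply: is_derive_eq d2 _; ring.
have d1E r x : partial1of2 f r x = - (x * sin (r * x + a) * pdf x).
  by rewrite /partial1of2 derive1E; have := df r x => /@derive_val.
have itv (r : R) : `]r - 1, r + 1[%classic r.
  by rewrite /= in_itv /= ltrBlDr ltrDl ltr01.
have fd (r0 r1 x y : R) : `]r0, r1[%classic x -> setT y -> derivable (f ^~ y) x 1.
  by move=> _ _; have := df x y.
have P0 y : 0 <= `|y| * pdf y by rewrite mulr_ge0// normal_pdf_ge0.
have fle (r0 r1 x y : R) : `]r0, r1[%classic x -> setT y ->
    `|partial1of2 f x y| <= `|y| * pdf y.
  move=> _ _; rewrite d1E normrN !normrM (ger0_norm (normal_pdf_ge0 _ _ _)).
  by rewrite ler_wpM2r ?normal_pdf_ge0// ler_piMr// sin_max.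
have dG (r : R) : is_derive r 1 G (- (r * G r)).
  have der : derivable G r 1.
    apply: (@derivable_under_integral R _ _ leb f setT measurableT r (r - 1) (r + 1) (itv r)
      (fun x _ => if_ x) (fd _ _) _ P0 integrable_id_pdf (fle _ _)).
  apply: DeriveDef => //; rewrite -derive1E.
  rewrite (@differentiation_under_integral R _ _ leb f setT measurableT r (r - 1) (r + 1) (itv r)
      (fun x _ => if_ x) (fd _ _) _ P0 integrable_id_pdf (fle _ _)).
    have := gaussian_by_parts r a; rewrite /G -/(f r).
    have iA : leb.-integrable setT (EFin \o (fun x => r * f r x)).
      exact: (integrableZl _ r (if_ r)).
    have := @RintegralB _ _ _ leb setT _ _ measurableT iA (integrable_id_trig_pdf r a).
    rewrite (RintegralZl _ measurableT (if_ r)) => e1 e2.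
    have {}e2 : \int[leb]_x (r * f r x - x * sin (r * x + a) * pdf x) = 0.
      rewrite /Rintegral -[RHS]/(fine 0); congr fine; rewrite -[RHS]e2.
      by apply: eq_integral => x _; rewrite /f mulrA.
    rewrite e2 in e1.
    under eq_Rintegral do rewrite d1E -mulN1r.
    rewrite (RintegralZl _ measurableT (integrable_id_trig_pdf r a)).
    by move: e1; rewrite /f; lra.
pose K (r : R) := expR (r ^+ 2 / 2) * G r.
have dK (r : R) : is_derive r 1 K 0.
  have h : is_derive r 1 (fun y : R => 2^-1 * y ^+ 2) r.
    have := @is_deriveX _ _ id 2 r 1 1 _; rewrite [_ *: _]mulr1 exprfctE expr1 => /(_ (is_derive_id _ _)) h.
    by have := is_derive_cmul 2^-1 h; rewrite mulKf.
  have d2 := @is_derive1_comp _ expR (fun y => 2^-1 * y ^+ 2) r _ _ (is_derive_expR _) h.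
  have d3 := @is_deriveM _ _ (expR \o (fun y => 2^-1 * y ^+ 2)) G r 1 _ _ d2 (dG r).
  have -> : K = (expR \o (fun y => 2^-1 * y ^+ 2)) * G.
    by apply/funext => y; rewrite /K (mulrC (y ^+ 2)).
  apply: is_derive_eq d3 _.
  by rewrite /GRing.scale /=; ring.
have := @is_derive_0_is_cst _ K s 0 dK; rewrite /K /G expr0n /= mul0r expR0 mul1r => K0.
have {}K0 : expR (s ^+ 2 / 2) * \int[leb]_x (cos (s * x + a) * pdf x) = cos a.
  rewrite K0 /Rintegral.
  under eq_integral do rewrite mul0r add0r EFinM.
  rewrite integralZl//; last exact: integrable_pdf.
  by rewrite (integral_normal_pdf 0 1) mule1.
by rewrite expRN -[in RHS]K0 mulKf// gt_eqF// expR_gt0.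
Qed.
End gaussian.

(** * Convergence in distribution from characteristic functions *)

(** Spans of cosines with a phase. The phase provides the sines, so the class is closed under
    products and stands in for complex exponentials. *)
Inductive trig_poly {R : realType} : (R -> R) -> Prop :=
| trig_cos s a : trig_poly (fun x => cos (s * x + a))
| trig_add f g : trig_poly f -> trig_poly g -> trig_poly (fun x => f x + g x)
| trig_scale c f : trig_poly f -> trig_poly (fun x => c * f x).

Section trig_poly_theory.
Variable R : realType.
Implicit Types f g h : R -> R.

Lemma trig_cst (c : R) : trig_poly (fun _ => c).
Proof.
have := trig_scale c (trig_cos 0 (0 : R)).
by congr trig_poly; apply/funext => x; rewrite mul0r addr0 cos0 mulr1.
Qed.

Lemma trig_mul f g : trig_poly f -> trig_poly g -> trig_poly (fun x => f x * g x).
Proof.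
move=> hf hg; elim: hf => [s a|f1 f2 _ h1 _ h2|c f1 _ h1].
- elim: hg => [s' a'|g1 g2 _ h1 _ h2|c g1 _ h1].
  + have := trig_add (trig_scale 2^-1 (trig_cos (s + s') (a + a')))
                     (trig_scale 2^-1 (trig_cos (s - s') (a - a'))).
    congr trig_poly; apply/funext => x.
    have -> : (s + s') * x + (a + a') = (s * x + a) + (s' * x + a') by ring.
    have -> : (s - s') * x + (a - a') = (s * x + a) - (s' * x + a') by ring.
    by rewrite cosD cosB; field.
  + by have := trig_add h1 h2; congr trig_poly; apply/funext => x; rewrite mulrDr.
  + by have := trig_scale c h1; congr trig_poly; apply/funext => x; rewrite mulrCA.
- by have := trig_add h1 h2; congr trig_poly; apply/funext => x; rewrite mulrDl.
- by have := trig_scale c h1; congr trig_poly; apply/funext => x; rewrite mulrA.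
Qed.

Lemma trig_continuous f : trig_poly f -> continuous f.
Proof.
elim=> [s a|f1 f2 _ h1 _ h2|c f1 _ h1] x.
- by apply: continuous_trig; exact: continuous_cos.
- by apply: cvgD; [exact: h1|exact: h2].
- by apply: cvgM; [exact: cvg_cst|exact: h1].
Qed.

Lemma trig_bounded f : trig_poly f -> exists c : R, forall x, `|f x| <= c.
Proof.
elim=> [s a|f1 f2 _ [c1 h1] _ [c2 h2]|c f1 _ [c1 h1]].
- by exists 1 => x; exact: cos_max.
- by exists (c1 + c2) => x; apply: le_trans (ler_normD _ _) _; exact: lerD.
- by exists (`|c| * c1) => x; rewrite normrM ler_wpM2l.
Qed.

(* The Bernstein polynomial of the indicator of [1/2, 1]; below, [u] is an affine
   function of a cosine. *)
Let bern (u : R) m := Ebin (fun i : bool => if i then 1 - u else u) m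
  (fun k l => (l < k)%N%:R).

Lemma trig_Ebin (U : R -> R) m (F : nat -> nat -> R) : trig_poly U ->
  trig_poly (fun x => Ebin (fun i : bool => if i then 1 - U x else U x) m F).
Proof.
move=> hU; elim: m F => [|m IH] F /=; first exact: trig_cst.
apply: trig_add; first exact: trig_mul hU (IH _).
apply: trig_mul (IH _); have := trig_add (trig_cst 1) (trig_scale (-1) hU).
by congr trig_poly; apply/funext => x; rewrite mulN1r.
Qed.

Section bernstein_step.
Variables (u : R) (m : nat).
Hypothesis u01 : 0 <= u <= 1.
Let q (i : bool) : R := if i then 1 - u else u.
Let q_sum : q false + q true = 1. Proof. by rewrite /q addrC subrK. Qed.
Let q_ge0 i : 0 <= q i.
Proof. by case/andP: u01 => h0 h1; case: i; rewrite /q// subr_ge0. Qed.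

Lemma bern01 : 0 <= bern u m <= 1.
Proof.
apply/andP; split; first by apply: (Ebin_ge0 q_sum q_ge0) => k l _.
by apply: (Ebin_le q_sum q_ge0) => k l _; case: (l < k)%N.
Qed.

Let dev (d : R) : 0 < d -> (0 < m)%N ->
  Ebin q m (fun k l => (k%:R - m%:R * u) ^+ 2 / (m%:R * d) ^+ 2) <= (4 * m%:R * d ^+ 2)^-1.
Proof.
move=> d0 m0; have M0 : 0 < m%:R :> R by rewrite ltr0n.
rewrite (@eq_Ebin _ q m _ (fun k l => ((m%:R * d) ^+ 2)^-1 *
   (k%:R * q true - l%:R * q false + 0) ^+ 2)); last first.
  by move=> k l <-; rewrite /q natrD; ring.
rewrite EbinZ Ebin_sqr_shift// expr0n /= add0r.
set t := (X in X <= _).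
have -> : t = (m%:R * d ^+ 2)^-1 * (u * (1 - u)).
  by rewrite /t /=; field; rewrite !gt_eqF.
have -> : (4 * m%:R * d ^+ 2)^-1 = (m%:R * d ^+ 2)^-1 * 4^-1 by rewrite -mulrA invfM mulrC.
apply: ler_wpM2l; last by have := sqr_ge0 (2 * u - 1); lra.
by rewrite invr_ge0; apply: mulr_ge0 => //; exact: sqr_ge0.
Qed.

(** [l < k] means that more than half of the [m] trials succeed, so this is Chebyshev's inequality
    with variance [m * u * (1 - u)], at most [m / 4]. *)
Lemma bern_high (d : R) : 0 < d -> (0 < m)%N -> 2^-1 + d <= u ->
  1 - (4 * m%:R * d ^+ 2)^-1 <= bern u m.
Proof.
move=> d0 m0 hu; rewrite lerBlDr -lerBlDl; apply: le_trans (dev d0 m0).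
rewrite /bern -[X in X - _](Ebin_cst q_sum m) -EbinB.
have M0 : 0 < m%:R :> R by rewrite ltr0n.
apply: (le_Ebin q_ge0) => k l kl; case: ltnP => lk; first by rewrite subrr divr_ge0 ?sqr_ge0.
rewrite subr0 ler_pdivlMr ?exprn_gt0 ?mulr_gt0// mul1r -[leRHS]sqrrN.
have hk : 2 * k%:R <= m%:R :> R by rewrite -natrM ler_nat; lia.
have md : 0 <= m%:R * d by rewrite mulr_ge0// ltW.
have key : m%:R * d <= - (k%:R - m%:R * u).
  by have := ler_wpM2l (ltW M0) hu; lra.
by rewrite lerXn2r// nnegrE (le_trans md).
Qed.

Lemma bern_low (d : R) : 0 < d -> (0 < m)%N -> u <= 2^-1 - d ->
  bern u m <= (4 * m%:R * d ^+ 2)^-1.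
Proof.
move=> d0 m0 hu; apply: le_trans (dev d0 m0).
have M0 : 0 < m%:R :> R by rewrite ltr0n.
apply: (le_Ebin q_ge0) => k l kl; case: ltnP => lk; last by rewrite divr_ge0 ?sqr_ge0.
rewrite ler_pdivlMr ?exprn_gt0 ?mulr_gt0// mul1r.
have hk : m%:R <= 2 * k%:R :> R by rewrite -natrM ler_nat; lia.
have md : 0 <= m%:R * d by rewrite mulr_ge0// ltW.
have key : m%:R * d <= k%:R - m%:R * u.
  by have := ler_wpM2l (ltW M0) hu; lra.
by rewrite lerXn2r// nnegrE (le_trans md).
Qed.
End bernstein_step.

Lemma trig_sandwich (x eps M : R) : 0 < eps -> 0 < M -> exists h, [/\ trig_poly h,
  (forall z, 0 <= h z <= 1),
  (forall z, - M <= z <= x -> 1 - eps <= h z) &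
  (forall z, x + eps <= z <= M -> h z <= eps)].
Proof.
move=> e0 M0; pose N := M + 2 * `|x|.
have x1 := ler_norm x; have x2 : - `|x| <= x by rewrite lerNl -normrN ler_norm.
have xx : 0 <= `|x| by exact: normr_ge0.
pose rho := (x + eps + N) / 2; pose c := (x - N) / 2.
have r0 : 0 < rho by rewrite /rho /N; lra.
have er : eps / 2 < rho by rewrite /rho /N; lra.
pose th : R := pi / (2 * rho).
have th0 : 0 < th by rewrite divr_gt0 ?pi_gt0// mulr_gt0.
have thr : th * rho = pi / 2 by rewrite /th; field; rewrite gt_eqF.
pose d : R := sin (th * (eps / 2)) / 2.
have te : 0 < th * (eps / 2) < pi / 2.
  by rewrite -thr; apply/andP; split; [apply: mulr_gt0 => //; exact: divr_gt0|rewrite ltr_pM2l].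
have d0 : 0 < d by rewrite divr_gt0// sin_gt0_pihalf.
have cosd : cos (th * (rho - eps / 2)) = 2 * d.
  by rewrite mulrBr thr cosB cos_pihalf sin_pihalf mul0r add0r mul1r /d [RHS]mulrC divfK.
pose U z : R := 2^-1 + 2^-1 * cos (th * z + - (th * c)).
have hU : trig_poly U by apply: trig_add; [exact: trig_cst|exact/trig_scale/trig_cos].
have U01 z : 0 <= U z <= 1.
  have := cos_le1 (th * z + - (th * c)); have := cos_geN1 (th * z + - (th * c)).
  by rewrite /U => h1 h2; apply/andP; split; lra.
have cos_dec (y : R) : `|y| <= rho - eps / 2 -> 2 * d <= cos (th * y).
  move=> hy; rewrite -cosd -[cos (th * y)]cos_norm normrM (ger0_norm (ltW th0)).
  have [<-//|ne] := eqVneq `|y| (rho - eps / 2).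
  have ylt : `|y| < rho - eps / 2 by rewrite lt_neqAle ne.
  have p0 := @pi_gt0 R.
  have b1 : th * (rho - eps / 2) <= pi by rewrite mulrBr thr; lra.
  have b2 : 0 <= th * `|y| by rewrite mulr_ge0// ltW.
  have b3 : th * `|y| < th * (rho - eps / 2) by rewrite ltr_pM2l.
  apply/ltW; rewrite ltr_cos// in_itv /=; apply/andP; split=> //; lra.
have [m m0 hm] : exists2 m, (0 < m)%N & (4 * m%:R * d ^+ 2)^-1 <= eps.
  pose m := (Num.truncn (4 * d ^+ 2 * eps)^-1).+1.
  exists m => //; have dd : 0 < 4 * d ^+ 2 * eps.
    by apply: mulr_gt0 => //; apply: mulr_gt0 => //; exact: exprn_gt0.
  have := truncnS_gt (4 * d ^+ 2 * eps)^-1; rewrite -/m => hm.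
  have m0 : 0 < m%:R :> R by rewrite ltr0n.
  have h1 : 1 < m%:R * (4 * d ^+ 2 * eps) by rewrite -ltr_pdivrMr// div1r.
  have mp : 0 < 4 * m%:R * d ^+ 2 by apply: mulr_gt0; [exact: mulr_gt0|exact: exprn_gt0].
  by rewrite -[X in X <= _]mul1r ler_pdivrMr//; move: h1; set M' := m%:R; lra.
exists (fun z => bern (U z) m); split.
- exact: trig_Ebin.
- by move=> z; exact: bern01.
- move=> z /andP[z1 z2]; apply: le_trans (bern_high (U01 z) d0 m0 _); first by lra.
  have := cos_dec (z - c); rewrite /U mulrBr => h.
  have {}h := h _; suff : 2 * d <= cos (th * z - th * c) by lra.
  apply: h; rewrite ler_norml /c /rho /N; apply/andP; split; lra.
- move=> z /andP[z1 z2]; apply: le_trans (bern_low (U01 z) d0 m0 _) hm.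
  have := cos_dec (z - c - 2 * rho) => h.
  have {}h : 2 * d <= cos (th * (z - c - 2 * rho)).
    by apply: h; rewrite ler_norml /c /rho /N; apply/andP; split; lra.
  (* Translation by [2 * rho] is half a period and changes the sign of the cosine, so the positive
     estimate serves for the negative stretch. *)
  have e1 : th * (z - c - 2 * rho) = th * z + - (th * c) - pi.
    by rewrite -[X in _ = _ - X](_ : th * (2 * rho) = pi); [ring|rewrite mulrCA thr mulrC divfK].
  move: h; rewrite e1 /U; set w := th * z + _.
  by have := cosDpi (w - pi); rewrite subrK => ->; lra.
Qed.
End trig_poly_theory.

(* The weight [w] is the constant [1] for the variables [Z n] below, and the
   density of the limit distribution when [m] is the Lebesgue measure. *)
Section weighted_cdf.
Context d (T : measurableType d) (R : realType) (m : {measure set T -> \bar R}).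
Variables (Z w : T -> R) (K : R).
Hypothesis mZ : measurable_fun setT Z.
Hypothesis w0 : forall t, 0 <= w t.
Hypothesis iw : m.-integrable setT (EFin \o w).
Hypothesis w1 : \int[m]_t w t = 1.
Hypothesis iZw : m.-integrable setT (EFin \o (fun t => `|Z t| * w t)).
Hypothesis ZK : \int[m]_t (`|Z t| * w t) <= K.

Let mw : measurable_fun setT w.
Proof. exact/measurable_EFinP/(measurable_int m iw). Qed.

Lemma integrable_bounded_weight (f : T -> R) (c : R) : measurable_fun setT f ->
  (forall t, `|f t| <= c) -> m.-integrable setT (EFin \o (fun t => f t * w t)).
Proof.
move=> mf fc.
have := @integrableZl _ _ _ m setT measurableT c (EFin \o w) iw.
apply: le_integrable => //.
  by apply/measurable_EFinP/measurable_funM.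
move=> x _ /=; rewrite lee_fin !normrM (ger0_norm (w0 _)).
by rewrite ler_wpM2r// (le_trans (fc x))// ler_norm.
Qed.

Definition wcdf x : R := \int[m]_t ((Z t <= x)%R%:R * w t).

Let mle x : measurable_fun setT (fun t => (Z t <= x)%R%:R : R).
Proof.
rewrite (_ : (fun t => _) = \1_[set t | Z t <= x]).
  apply: measurable_indic; rewrite -[X in measurable X]setTI.
  have -> : [set t | Z t <= x] = Z @^-1` `]-oo, x].
    by apply/seteqP; split => t /=; rewrite in_itv.
  by apply: mZ => //; exact: measurable_itv.
apply/funext => t; rewrite indicE; congr ((nat_of_bool _)%:R).
by apply/idP/idP; [move=> h; apply/mem_set|rewrite inE].
Qed.

Let ile x : m.-integrable setT (EFin \o (fun t => (Z t <= x)%R%:R * w t)).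
Proof.
by apply: (@integrable_bounded_weight _ 1) => // t; case: (Z t <= x)%R; rewrite ?normr1 ?normr0.
Qed.

(** Outside [[- M, M]] nothing but [0 <= h <= 1] is known; there [1 <= |Z| / M], which charges the
    defect to the first moment. *)
Lemma wcdf_sandwich (h : R -> R) (x eps M : R) : 0 < eps -> 0 < M -> measurable_fun setT (h \o Z) ->
  (forall z, 0 <= h z <= 1) ->
  (forall z, - M <= z <= x -> 1 - eps <= h z) ->
  (forall z, x + eps <= z <= M -> h z <= eps) ->
  wcdf x <= \int[m]_t (h (Z t) * w t) + eps + K / M /\
  \int[m]_t (h (Z t) * w t) <= wcdf (x + eps) + eps + K / M.
Proof.
move=> e0 M0 mh h01 hlow hup.
have ih : m.-integrable setT (EFin \o (fun t => h (Z t) * w t)).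
  apply: (@integrable_bounded_weight _ 1) => // t.
  by case/andP: (h01 (Z t)) => h0 h1; rewrite ger0_norm.
have ie : m.-integrable setT (EFin \o (fun t => eps * w t)).
  exact: (integrableZl _ eps iw).
have iM : m.-integrable setT (EFin \o (fun t => M^-1 * (`|Z t| * w t))).
  exact: (integrableZl _ M^-1 iZw).
have key g : m.-integrable setT (EFin \o g) ->
    \int[m]_t (g t + (eps * w t + M^-1 * (`|Z t| * w t))) <= \int[m]_t g t + eps + K / M.
  move=> ig; rewrite RintegralD//; last exact: integrableD ie iM.
  rewrite RintegralD// (RintegralZl _ measurableT iw) (RintegralZl _ measurableT iZw) w1.
  rewrite mulr1 addrA lerD2l mulrC ler_wpM2r// invr_ge0 ltW//.
have ineq g1 g2 t : (g1 <= g2 + (eps + M^-1 * `|Z t|))%R ->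
    g1 * w t <= g2 * w t + (eps * w t + M^-1 * (`|Z t| * w t)).
  by move=> g12; have := ler_wpM2r (w0 t) g12; lra.
have i2 g : m.-integrable setT (EFin \o g) -> m.-integrable setT
    (EFin \o (fun t => g t + (eps * w t + M^-1 * (`|Z t| * w t)))).
  by move=> ig; exact: integrableD ig (integrableD _ ie iM).
have big t : M < `|Z t| -> 1 <= M^-1 * `|Z t|.
  by move=> tM; rewrite mulrC ler_pdivlMr// mul1r ltW.
have nn t : 0 <= M^-1 * `|Z t| by rewrite mulr_ge0// invr_ge0 ltW.
split.
  apply: le_trans (key _ ih); apply: le_Rintegral => //; first exact: i2.
  move=> t _; apply: ineq; have /andP[h0 h1] := h01 (Z t).
  case: (leP (Z t) x) => [zx|_]; rewrite /= ?mulr1n ?mulr0n; last by have := nn t; lra.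
  have [Mz|Mz] := leP (- M) (Z t).
    by have := nn t; have := hlow (Z t); rewrite Mz zx /= => /(_ isT); lra.
  suff : 1 <= M^-1 * `|Z t| by lra.
  by apply: big; rewrite ltr0_norm; lra.
apply: le_trans (key _ (ile _)); apply: le_Rintegral => //; first exact: i2.
move=> t _; apply: ineq; have /andP[h0 h1] := h01 (Z t).
case: (leP (Z t) (x + eps)) => [zx|xz]; rewrite /= ?mulr1n ?mulr0n; first by have := nn t; lra.
have [Mz|Mz] := leP (Z t) M.
  by have := nn t; have := hup (Z t); rewrite Mz (ltW xz) /= => /(_ isT); lra.
suff : 1 <= M^-1 * `|Z t| by lra.
by apply: big; rewrite gtr0_norm; lra.
Qed.
End weighted_cdf.

(** * Convergence of distribution functions *)

Section levy.
Variable R : realType.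
Local Notation leb := (@lebesgue_measure R).
Local Notation pdf := (@normal_pdf R 0 1).

Lemma normal_peak_le1 : normal_peak 1 <= 1 :> R.
Proof.
have p2 : 1 <= pi *+ 2 :> R by rewrite mulr2n; have := @pi_ge2 R; lra.
have p0 : 0 < pi *+ 2 :> R by exact: lt_le_trans p2.
by rewrite /normal_peak expr1n mul1r invf_le1 ?sqrtr_gt0// -[leLHS]sqrtr1 ler_sqrt// ltW.
Qed.

Lemma normal_wcdfE x : wcdf leb id pdf x = Phi x.
Proof.
rewrite /wcdf /Phi /normal_prob -/(Rintegral leb `]-oo, x] pdf) [RHS]Rintegral_mkcond.
apply: eq_Rintegral => y _; rewrite /patch mem_setE in_itv /=.
by case: (y <= x)%R; rewrite ?mul1r ?mul0r.
Qed.

Let iid : leb.-integrable setT (EFin \o (fun t => `|id t| * pdf t)).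
Proof. exact: integrable_id_pdf. Qed.

Lemma Phi_lipschitz (x e : R) : 0 <= e -> Phi (x + e) <= Phi x + e.
Proof.
move=> e0; rewrite -!normal_wcdfE /wcdf.
have ile y : leb.-integrable setT (EFin \o (fun t => (t <= y)%R%:R * pdf t)).
  have mf : measurable_fun setT (fun t : R => (t <= y)%R%:R : R).
    rewrite (_ : (fun t => _) = \1_`]-oo, y]); first by apply: measurable_indic; exact: measurable_itv.
    by apply/funext => t; rewrite indicE mem_setE in_itv.
  apply: (@integrable_bounded_pdf _ (fun t => (t <= y)%R%:R) 1) => //.
  by move=> t; case: (t <= y)%R; rewrite ?normr1 ?normr0.
have iI : leb.-integrable setT (EFin \o \1_`[x, x + e]) by exact: integrable_indic_itv.
have eI : \int[leb]_t \1_`[x, x + e] t = e.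
  rewrite /Rintegral integral_indic// setIT.
  have := @lebesgue_measure_itv R `[x, x + e]%R; rewrite /= => ->.
  rewrite lte_fin ltrDl; move: e0; rewrite le_eqVlt => /orP[/eqP <-|->] /=.
    by rewrite ltxx.
  by rewrite addrAC subrr add0r.
rewrite -[X in _ <= _ + X]eI -RintegralD//; apply: le_Rintegral => //.
  exact: integrableD (ile x) iI.
move=> t _; rewrite indicE mem_setE in_itv /=.
have p0 := @normal_pdf_ge0 R 0 1 t.
have p1 : pdf t <= 1.
  by apply: le_trans normal_peak_le1; apply: normal_pdf_ub; rewrite oner_neq0.
by case: (leP t (x + e)); case: (leP t x) => /=; case: (leP x t) => //=; rewrite ?mul1r ?mul0r; lra.
Qed.

(** The first moments give tightness. The distribution functions of [Z n] and of the limit are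
    compared through one trigonometric polynomial, with its step starting at [x] for the upper bound
    and at [x - eps] for the lower; [Phi_lipschitz] pays for the width of the step. *)
Lemma levy_cdf d (T : measurableType d) (P : probability T R) (Z : nat -> T -> R) :
  (forall n, measurable_fun setT (Z n)) ->
  (\forall n \near \oo, P.-integrable setT (EFin \o Z n) /\ \int[P]_t `|Z n t| <= 1) ->
  (forall s a, \int[P]_t cos (s * Z n t + a) @[n --> \oo] --> expR (- (s ^+ 2 / 2)) * cos a) ->
  forall x, fine (P [set t | Z n t <= x]) @[n --> \oo] --> Phi x.
Proof.
move=> mZ hZ hcos x.
have i1 : P.-integrable setT (EFin \o (fun _ : T => 1 : R)).
  exact: finite_measure_integrable_cst.
have w1 : \int[P]_t (fun _ : T => 1 : R) t = 1.
  by rewrite /Rintegral integral_cst// mul1e; exact: (congr1 fine (probability_setT P)).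
have pdf1 : \int[leb]_t pdf t = 1 by rewrite /Rintegral (integral_normal_pdf 0 1).
have cdfE n y : wcdf P (Z n) (fun _ => 1) y = fine (P [set t | Z n t <= y]).
  rewrite /wcdf /Rintegral.
  have mA : measurable [set t | Z n t <= y].
    rewrite -[X in measurable X]setTI.
    have -> : [set t | Z n t <= y] = Z n @^-1` `]-oo, y].
      by apply/seteqP; split => t /=; rewrite in_itv.
    by apply: mZ => //; exact: measurable_itv.
  rewrite -[X in fine X = _](_ : \int[P]_t (\1_[set t | Z n t <= y] t)%:E = _)%E.
    by rewrite integral_indic// setIT.
  apply: eq_integral => t _; rewrite mulr1 indicE; congr ((nat_of_bool _)%:R%:E).
  by apply/idP/idP; [rewrite inE|move=> h; apply/mem_set].
have mh f n : trig_poly f -> measurable_fun setT (f \o Z n).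
  by move=> /trig_continuous cf; apply: measurableT_comp => //; exact: continuous_measurable_fun.
have tcvg f : trig_poly f ->
    \int[P]_t (f (Z n t) * 1) @[n --> \oo] --> \int[leb]_y (f y * pdf y).
  have iP g n : trig_poly g -> P.-integrable setT (EFin \o (fun t => g (Z n t) * 1)).
    move=> tg; have [c hc] := trig_bounded tg.
    apply: (@integrable_bounded_weight _ _ _ P (fun=> 1) (fun=> ler01) i1 (g \o Z n) c) .
      exact: mh.
    by move=> t; exact: hc.
  have iN g : trig_poly g -> leb.-integrable setT (EFin \o (fun t => g t * pdf t)).
    move=> tg; have [c hc] := trig_bounded tg.
    by apply: (integrable_bounded_pdf (c := c)) => //; apply: continuous_measurable_fun; exact: trig_continuous.
  elim=> [s a|g1 g2 t1 h1 t2 h2|c g1 t1 h1].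
  - rewrite gaussian_cos; under eq_cvg do under eq_Rintegral do rewrite mulr1.
    exact: hcos.
  - have -> : (fun n => \int[P]_t ((g1 (Z n t) + g2 (Z n t)) * 1)) =
        (fun n => \int[P]_t (g1 (Z n t) * 1) + \int[P]_t (g2 (Z n t) * 1)).
      apply/funext => n; rewrite -(RintegralD measurableT (iP _ n t1) (iP _ n t2)).
      by apply: eq_Rintegral => t _; rewrite mulrDl.
    rewrite (_ : \int[leb]_y _ = \int[leb]_y (g1 y * pdf y) + \int[leb]_y (g2 y * pdf y)).
      exact: cvgD.
    rewrite -(RintegralD measurableT (iN _ t1) (iN _ t2)).
    by apply: eq_Rintegral => y _; rewrite mulrDl.
  - have -> : (fun n => \int[P]_t (c * g1 (Z n t) * 1)) =
        (fun n => c * \int[P]_t (g1 (Z n t) * 1)).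
      apply/funext => n; rewrite -(RintegralZl c measurableT (iP _ n t1)).
      by apply: eq_Rintegral => t _; rewrite mulrA.
    rewrite (_ : \int[leb]_y _ = c * \int[leb]_y (g1 y * pdf y)).
      by apply: cvgM; [exact: cvg_cst|].
    rewrite -(RintegralZl c measurableT (iN _ t1)).
    by apply: eq_Rintegral => y _; rewrite mulrA.
pose K := \int[leb]_y (`|id y| * pdf y).
have K0 : 0 <= K.
  by apply: Rintegral_ge0 => y _; rewrite mulr_ge0// normal_pdf_ge0.
apply/cvgrPdist_lt => eta eta0.
(* Each side loses five times [eps]: two sandwich errors, the two tails [K / M] and [1 / M]
   together, the convergence of the integral, and the Lipschitz step. *)
pose eps := eta / 8; have eps0 : 0 < eps by rewrite divr_gt0.
pose M := 8 * (K + 1) / eta.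
have M0 : 0 < M by rewrite divr_gt0// mulr_gt0// ltr_wpDl.
have KM : K / M + 1 / M = eps.
  by rewrite /M /eps; field; rewrite !gt_eqF// ltr_wpDl.
have [hu [tu hu01 hul huu]] := trig_sandwich x eps0 M0.
have [hl [tl hl01 hll hlu]] := trig_sandwich (x - eps) eps0 M0.
have mid : measurable_fun [set: R] (@id R) by [].
have [_ Nu] := wcdf_sandwich (m := leb) (Z := id) (w := pdf) (K := K) mid (@normal_pdf_ge0 _ 0 1)
  (@integrable_pdf R) pdf1 iid (lexx _) eps0 M0
  (continuous_measurable_fun (trig_continuous tu)) hu01 hul huu.
have [Nl _] := wcdf_sandwich (m := leb) (Z := id) (w := pdf) (K := K) mid (@normal_pdf_ge0 _ 0 1)
  (@integrable_pdf R) pdf1 iid (lexx _) eps0 M0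
  (continuous_measurable_fun (trig_continuous tl)) hl01 hll hlu.
rewrite !normal_wcdfE in Nu Nl.
have Lu := Phi_lipschitz x (ltW eps0); have Ll := Phi_lipschitz (x - eps) (ltW eps0).
rewrite subrK in Ll.
have /cvgrPdist_lt/(_ _ eps0) Cu := tcvg _ tu.
have /cvgrPdist_lt/(_ _ eps0) Cl := tcvg _ tl.
near=> n.
have [iZ Z1] : P.-integrable setT (EFin \o Z n) /\ \int[P]_t `|Z n t| <= 1.
  by near: n.
have iZw : P.-integrable setT (EFin \o (fun t => `|Z n t| * 1)).
  have := integrable_abse iZ; congr (integrable _ _ _).
  by apply/funext => t /=; rewrite mulr1.
have Z1' : \int[P]_t (`|Z n t| * 1) <= 1.
  by apply: le_trans Z1; rewrite le_eqVlt; apply/orP; left; apply/eqP;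
     apply: eq_Rintegral => t _; rewrite mulr1.
have [Pu _] := wcdf_sandwich (mZ n) (fun=> ler01) i1 w1 iZw Z1' eps0 M0 (mh _ n tu) hu01 hul huu.
have [_ Pl] := wcdf_sandwich (mZ n) (fun=> ler01) i1 w1 iZw Z1' eps0 M0 (mh _ n tl) hl01 hll hlu.
rewrite !cdfE subrK in Pu Pl.
have du : `|\int[leb]_y (hu y * pdf y) - \int[P]_t (hu (Z n t) * 1)| < eps by near: n.
have dl : `|\int[leb]_y (hl y * pdf y) - \int[P]_t (hl (Z n t) * 1)| < eps by near: n.
have e8 : eta = 8 * eps by rewrite /eps; field.
move: Pu Pl Nu Nl du dl KM; rewrite !ltr_norml => Pu Pl Nu Nl /andP[du1 du2] /andP[dl1 dl2] KM.
have k1 : 0 <= K / M by rewrite divr_ge0// ltW.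
have k2 : 0 <= 1 / M by rewrite divr_ge0// ltW.
by rewrite e8; apply/andP; split; lra.
Unshelve. all: end_near. Qed.
End levy.

(** * Words and truncated tries *)

Section seqs.
Variable T : eqType.
Implicit Type A : seq T.

Fixpoint seqs A n : seq (seq T) :=
  if n is m.+1 then [seq x :: u | x <- A, u <- seqs A m] else [:: [::]].

Lemma mem_seqs A n u : (u \in seqs A n) = (size u == n) && all (mem A) u.
Proof.
elim: n u => [|n IH] [|x u] //=.
  by apply/allpairsP => -[] [y v] [].
apply/allpairsP/andP => [[[y v]] /= [yA vA [-> ->]]|[su /andP[xA uA]]].
  by move: vA; rewrite IH eqSS yA => /andP[].
by exists (x, u); split => //; rewrite IH uA -eqSS su.
Qed.

Lemma uniq_seqs A n : uniq A -> uniq (seqs A n).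
Proof.
move=> uA; elim: n => //= n IH; apply: allpairs_uniq => //.
by move=> [x u] [y v] _ _ /= [-> ->].
Qed.
End seqs.

Section trie_size.
Implicit Types (w u : seq bool) (ws us : seq (seq bool)).

Definition bucket b ws := [seq behead w | w <- ws & head false w == b].

Fixpoint trie_size L ws : nat :=
  if L is L'.+1 then
    (toll (size ws) + trie_size L' (bucket false ws) + trie_size L' (bucket true ws))%N
  else 0%N.

Definition level_size k ws : nat :=
  \sum_(w <- ws) (1 < count (fun v => take k v == take k w) ws)%N.

Lemma level_size0 ws : level_size 0 ws = toll (size ws).
Proof.
rewrite /level_size (eq_bigr (fun=> (1 < size ws)%N : nat)); last first.
  by move=> w _; rewrite take0 (@eq_count _ _ xpredT) ?count_predT// => v; rewrite take0.
by rewrite big_const_seq count_predT iter_addn_0 /toll; case: (leqP 2 (size ws)) => h; rewrite ?mul1n.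
Qed.

Lemma level_sizeS k ws : all (fun w => 0 < size w)%N ws ->
  level_size k.+1 ws = (level_size k (bucket false ws) + level_size k (bucket true ws))%N.
Proof.
move=> /allP ne.
have cE b u : count (fun v => take k.+1 v == take k.+1 (b :: u)) ws =
    count (fun v => take k v == take k u) (bucket b ws).
  rewrite count_map count_filter; apply: eq_in_count => -[|c v] /ne //= _.
  by rewrite eqseq_cons andbC.
have sE b : level_size k (bucket b ws) = (\sum_(w <- ws | head false w == b)
    (1 < count (fun v => take k.+1 v == take k.+1 w) ws)%N)%N.
  rewrite /level_size {1}/bucket big_map big_filter big_seq_cond [RHS]big_seq_cond.
  apply: eq_bigr => -[|c u] /andP[/ne//] _ /= /eqP ->.
  by rewrite (cE b u).
rewrite !sE /level_size (bigID (fun w => head false w == false)) /=; congr addn.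
by apply: eq_bigl => w; case: (head false w).
Qed.

(** The recursion counts bucket by bucket, whereas depths count level by level: a word contributes
    to level [k] while another one has the same first [k] symbols. *)
Lemma trie_sizeE L ws : all (fun w => size w == L) ws ->
  trie_size L ws = (\sum_(k < L) level_size k ws)%N.
Proof.
elim: L ws => [|L IH] ws hs; first by rewrite big_ord0.
have sb b : all (fun w => size w == L) (bucket b ws).
  rewrite all_map; apply/allP => w; rewrite mem_filter => /andP[_ /(allP hs)/=].
  by rewrite size_behead => /eqP ->.
rewrite /= big_ord_recl level_size0 -addnA; congr addn.
rewrite !IH// -big_split; apply: eq_bigr => k _ /=; rewrite level_sizeS//.
by apply/allP => w /(allP hs)/eqP ->.
Qed.
End trie_size.

(** * The law of the truncated trie under the Markov source *)

Section markov_words.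
Variables (R : realType) (p : bool -> bool -> R).

Fixpoint word_prob (q : bool -> R) (w : seq bool) : R :=
  if w is b :: u then q b * word_prob (p b) u else 1.

Definition Eword q L (f : seq bool -> R) : R :=
  \sum_(w <- seqs [:: false; true] L) word_prob q w * f w.

Definition Ewords q L n (f : seq (seq bool) -> R) : R :=
  \sum_(ws <- seqs (seqs [:: false; true] L) n) (\prod_(w <- ws) word_prob q w) * f ws.

Lemma EwordS q L f : Eword q L.+1 f =
  q false * Eword (p false) L (fun u => f (false :: u))
  + q true * Eword (p true) L (fun u => f (true :: u)).
Proof.
rewrite /Eword /= !big_cat /= !big_map /= big_nil addr0 !mulr_sumr.
by congr (_ + _); apply: eq_bigr => u _; rewrite mulrA.
Qed.

Lemma EwordsS q L n f :
  Ewords q L n.+1 f = Eword q L (fun w => Ewords q L n (fun ws => f (w :: ws))).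
Proof.
rewrite /Ewords /Eword /= big_allpairs_dep; apply: eq_bigr => w _.
by rewrite mulr_sumr; apply: eq_bigr => ws _; rewrite big_cons mulrA.
Qed.

Lemma Ewords0 q L f : Ewords q L 0 f = f [::].
Proof. by rewrite /Ewords /= big_seq1 big_nil mul1r. Qed.

Lemma eq_Eword q L f g : f =1 g -> Eword q L f = Eword q L g.
Proof. by move=> fg; apply: eq_bigr => w _; rewrite fg. Qed.

Lemma eq_Ewords q L n f g : (forall ws, size ws = n -> f ws = g ws) ->
  Ewords q L n f = Ewords q L n g.
Proof.
move=> fg; rewrite /Ewords big_seq [RHS]big_seq; apply: eq_bigr => ws.
by rewrite mem_seqs => /andP[/eqP s _]; rewrite fg.
Qed.

Lemma Eword_Ewords q L q' L' n (f : seq bool -> seq (seq bool) -> R) :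
  Eword q L (fun w => Ewords q' L' n (f w)) =
  Ewords q' L' n (fun ws => Eword q L (fun w => f w ws)).
Proof.
rewrite /Eword /Ewords; under eq_bigr do rewrite mulr_sumr.
rewrite exchange_big; apply: eq_bigr => ws _; rewrite mulr_sumr.
by apply: eq_bigr => w _; rewrite mulrCA.
Qed.

Lemma Eword_Ebin q L q' n (F : seq bool -> nat -> nat -> R) :
  Eword q L (fun w => Ebin q' n (F w)) = Ebin q' n (fun k l => Eword q L (fun w => F w k l)).
Proof.
elim: n F => [|n IH] F //=; rewrite -!IH /Eword !mulr_sumr -big_split /=.
by apply: eq_bigr => w _; rewrite mulrDr !(mulrCA (word_prob q w)).
Qed.

(** The suffixes behind the first symbol form two independent families of Markov words whose sizes
    are binomial. The induction places one word at a time, as [Ebin] does. *)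
Lemma Ewords_bucket q L n (f : seq (seq bool) -> seq (seq bool) -> R) :
  Ewords q L.+1 n (fun ws => f (bucket false ws) (bucket true ws)) =
  Ebin q n (fun k l => Ewords (p false) L k (fun us => Ewords (p true) L l (f us))).
Proof.
elim: n f => [|n IH] f; first by rewrite /= !Ewords0.
rewrite EwordsS EwordS [RHS]/=; congr (_ * _ + _ * _).
  rewrite (eq_Eword _ _ (fun u => (IH (fun us vs => f (u :: us) vs)))) Eword_Ebin.
  by apply: eq_Ebin => k l _; rewrite EwordsS.
rewrite (eq_Eword _ _ (fun u => (IH (fun us vs => f us (u :: vs))))) Eword_Ebin.
apply: eq_Ebin => k l _; rewrite Eword_Ewords.
by apply: eq_Ewords => us _; rewrite EwordsS.
Qed.

Lemma size_bucket ws : (size (bucket false ws) + size (bucket true ws))%N = size ws.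
Proof.
rewrite !size_map !size_filter -[RHS](count_predC (fun w => head false w == false)).
by congr addn; apply: eq_count => w /=; case: (head false w).
Qed.

Lemma Ewords_trie_law L i n f :
  Ewords (p i) L n (fun ws => f (trie_size L ws)) = trie_law p L i n f.
Proof.
elim: L i n f => [|L IH] i n f.
  by elim: n => [|n IHn]; rewrite ?Ewords0// EwordsS /Eword /= big_seq1 mul1r.
pose g us vs := f (toll (size us + size vs) + trie_size L us + trie_size L vs)%N.
rewrite (@eq_Ewords _ _ _ _ (fun ws => g (bucket false ws) (bucket true ws))); last first.
  by move=> ws _; rewrite /g size_bucket.
have -> : trie_law p L.+1 i n f = root_law p (p i) L n f by [].
rewrite Ewords_bucket; apply: eq_Ebin => k l kl; rewrite -IH.
apply: eq_Ewords => us su; rewrite /= -IH; apply: eq_Ewords => vs sv.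
by rewrite /g su sv kl.
Qed.

Lemma Ewords_root_law q L n f :
  Ewords q L.+1 n (fun ws => f (trie_size L.+1 ws)) = root_law p q L n f.
Proof.
pose g us vs := f (toll (size us + size vs) + trie_size L us + trie_size L vs)%N.
rewrite (@eq_Ewords _ _ _ _ (fun ws => g (bucket false ws) (bucket true ws))); last first.
  by move=> ws _; rewrite /g size_bucket.
rewrite Ewords_bucket; apply: eq_Ebin => k l kl; rewrite -Ewords_trie_law.
apply: eq_Ewords => us su; rewrite /= -Ewords_trie_law; apply: eq_Ewords => vs sv.
by rewrite /g su sv kl.
Qed.

Lemma word_probE q (g : nat -> bool) L :
  word_prob q (mkseq g L.+1) = q (g 0%N) * \prod_(k < L) p (g k) (g k.+1).
Proof.
elim: L q g => [|L IH] q g; first by rewrite /= big_ord0.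
have -> : mkseq g L.+2 = g 0%N :: mkseq (g \o succn) L.+1.
  by rewrite /mkseq /= -[2%N]add1n iotaDl -!map_comp.
rewrite -[LHS]/(q (g 0%N) * word_prob (p (g 0%N)) (mkseq (g \o succn) L.+1)).
by rewrite IH big_ord_recl.
Qed.
End markov_words.

(** * Depths *)

Section depths.
Variables (n : nat) (s : nat -> nat -> bool).

Definition trunc_buckets L : nat := (\sum_(j < n) \sum_(k < L) ~~ sep n s j k)%N.

Lemma agreeE i j k : agree s i j k = (mkseq (s i) k == mkseq (s j) k).
Proof.
apply/forallP/eqP => [h|h l].
  by apply/eq_in_map => l; rewrite mem_iota => /= lk; have /eqP := h (Ordinal lk).
by have := congr1 (nth false ^~ l) h; rewrite !nth_mkseq// => ->.
Qed.

Lemma nsep_count (j : 'I_n) k :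
  ~~ sep n s j k = (1 < count (fun i => agree s i j k) (iota 0 n))%N.
Proof.
have -> : count (fun i => agree s i j k) (iota 0 n) = #|[pred i : 'I_n | agree s i j k]|.
  have -> : iota 0 n = index_iota 0 n by rewrite /index_iota subn0.
  rewrite -sum1_count -sum1_card /= big_mkord.
  by apply: eq_bigl.
rewrite (cardD1 j) inE; have -> : agree s j j k by apply/forallP.
rewrite add1n ltnS; apply/forallPn/card_gt0P => -[i].
  case: eqP => //= ij; rewrite negbK => h; exists i; rewrite !inE h andbT.
  by apply/eqP => e; apply: ij; rewrite e.
rewrite !inE => /andP[ij h]; exists i; rewrite (inj_eq val_inj) ij /= negbK; exact: h.
Qed.

Lemma trunc_bucketsE L :
  trunc_buckets L = trie_size L (mkseq (fun j => mkseq (s j) L) n).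
Proof.
rewrite trie_sizeE; last first.
  by apply/allP => w /mapP[j _ ->]; rewrite size_mkseq.
rewrite /trunc_buckets exchange_big; apply: eq_bigr => k _.
have I : iota 0 n = index_iota 0 n by rewrite /index_iota subn0.
rewrite /level_size big_map [in RHS]I big_mkord; apply: eq_bigr => j _.
rewrite nsep_count count_map; congr (nat_of_bool (1 < _)%N).
apply: eq_count => i /=; rewrite agreeE.
by rewrite /mkseq -!map_take take_iota (minn_idPl (ltnW (ltn_ord k))).
Qed.

Lemma sepS j k l : (k <= l)%N -> sep n s j k -> sep n s j l.
Proof.
move=> kl /forallP h; apply/forallP => i; apply/implyP => ij.
have /implyP/(_ ij) := h i; apply: contra => /forallP a; apply/forallP => x.
exact: (a (Ordinal (leq_trans (ltn_ord x) kl))).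
Qed.

Lemma ler_trunc_buckets K L : (K <= L)%N -> (trunc_buckets K <= trunc_buckets L)%N.
Proof.
move=> KL; apply: leq_sum => j _.
by rewrite -(subnKC KL) big_split_ord /= leq_addr.
Qed.

(** Separation is monotone in the length of the prefix, so the least separating length counts the
    lengths that do not separate. *)
Lemma depth_sep j L : sep n s j L ->
  (\sum_(k < L) ~~ sep n s j k)%N = depth n s j.
Proof.
move=> hL; rewrite /depth; case: pselect => [h|]; last by case; exists L.
case: ex_minnP => m hm mmin; have mL := mmin _ hL.
rewrite -(subnKC mL) big_split_ord /= [X in (_ + X)%N]big1; last first.
  by move=> i _; rewrite (sepS (leq_addr _ _) hm).
rewrite addn0 (eq_bigr (fun=> 1%N)) ?sum1_card ?card_ord// => i _.
by apply/eqP; rewrite eqb1; apply/negP => /mmin; rewrite leqNgt ltn_ord.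
Qed.

Lemma depth_nsep j : ~ (exists k, sep n s j k) -> depth n s j = 0%N.
Proof. by rewrite /depth; case: pselect. Qed.

Lemma trunc_buckets_cvg : (forall j : 'I_n, exists k, sep n s j k) ->
  exists L0, forall L, (L0 <= L)%N -> trunc_buckets L = buckets n s.
Proof.
move=> /choice[k hk]; exists (\max_(j < n) k j)%N => L hL.
apply: eq_bigr => j _; apply: depth_sep; apply: sepS (hk j).
by apply: leq_trans hL; exact: (leq_bigmax j).
Qed.

(** A string that is never separated makes the truncated counts diverge; with a bounded mean this
    shows that such strings form a null event. *)
Lemma trunc_buckets_ge (j : 'I_n) L : ~ (exists k, sep n s j k) -> (L <= trunc_buckets L)%N.
Proof.
move=> h; rewrite /trunc_buckets (bigD1 j)//=.
rewrite (eq_bigr (fun=> 1%N)) ?sum1_card ?card_ord ?leq_addr// => k _.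
by apply/eqP; rewrite eqb1; apply/negP => hk; apply: h; exists k.
Qed.

(* Unlike [trunc_buckets], this converges even when some strings coincide. *)
Lemma buckets_approx :
  exists L0, forall L, (L0 <= L)%N ->
    (\sum_(j < n) sep n s j L * \sum_(k < L) ~~ sep n s j k)%N = buckets n s.
Proof.
have /choice[k hk] : forall j : 'I_n, exists k, (exists l, sep n s j l) -> sep n s j k.
  by move=> j; have [[k hk]|h] := pselect (exists l, sep n s j l); [exists k|exists 0%N].
exists (\max_(j < n) k j)%N => L hL; apply: eq_bigr => j _.
have [h|h] := pselect (exists l, sep n s j l).
  have sL : sep n s j L.
    by apply: sepS (hk j h); apply: leq_trans hL; exact: (leq_bigmax j).
  by rewrite sL mul1n depth_sep.
rewrite depth_nsep//; case E : (sep n s j L); last by rewrite mul0n.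
by case: h; exists L.
Qed.
End depths.

Lemma eq_sep n (s s' : nat -> nat -> bool) j k :
  (j < n)%N -> (forall i l, (i < n)%N -> (l < k)%N -> s i l = s' i l) ->
  sep n s j k = sep n s' j k.
Proof.
move=> jn h; apply: eq_forallb => i; congr (_ ==> ~~ _).
by apply: eq_forallb => l; rewrite !h.
Qed.

(** * Buckets under the Markov source *)

Section markov_source.
Context (R : realType) (p : bool -> bool -> R) (mu : bool -> R)
  d (T : measurableType d) (P : probability T R).
Variable X : nat -> nat -> T -> bool.
Hypothesis mX : forall j k, measurable [set t | X j k t].
Hypothesis PX : forall (n L : nat) (w : nat -> nat -> bool),
  P [set t | forall j k, (j < n)%N -> (k <= L)%N -> X j k t = w j k]
  = ((\prod_(j < n) (mu (w j 0%N) * \prod_(k < L) p (w j k) (w j k.+1)))%R)%:E.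

Definition words n L t := mkseq (fun j => mkseq (fun k => X j k t) L) n.

Let lists n L := seqs (seqs [:: false; true] L) n.

Lemma words_lists n L t : words n L t \in lists n L.
Proof.
rewrite mem_seqs size_mkseq eqxx /=; apply/allP => w /mapP[j _ ->] /=.
rewrite mem_seqs size_mkseq eqxx /=; apply/allP => b _.
by case: b; rewrite !inE.
Qed.

Definition table (ws : seq (seq bool)) j k := nth false (nth [::] ws j) k.

Let tableK n L v : v \in lists n L -> mkseq (fun j => mkseq (table v j) L) n = v.
Proof.
rewrite mem_seqs => /andP[/eqP sv /allP vL]; apply: (@eq_from_nth _ [::]).
  by rewrite size_mkseq.
move=> j; rewrite size_mkseq => jn; rewrite nth_mkseq//.
have : nth [::] v j \in v by rewrite mem_nth// sv.
move=> /vL /=; rewrite mem_seqs => /andP[/eqP sw _].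
by rewrite -[RHS](mkseq_nth false) sw.
Qed.

Let words_eqE n L v : v \in lists n L.+1 -> [set t | words n L.+1 t = v] =
  [set t | forall j k, (j < n)%N -> (k <= L)%N -> X j k t = table v j k].
Proof.
move=> hv; apply/seteqP; split => t /= h.
  by move=> j k jn kL; rewrite /table -h !nth_mkseq.
rewrite -[RHS](tableK hv); apply/eq_in_map => j; rewrite mem_iota => /= jn.
by apply/eq_in_map => k; rewrite mem_iota => /= kL; apply: h.
Qed.

Lemma measurable_words n L v : measurable [set t | words n L t = v].
Proof.
have -> : [set t | words n L t = v] = (if v \in lists n L then
    \bigcap_j \bigcap_k [set t | (j < n)%N -> (k < L)%N -> X j k t = table v j k] else set0).
  case: ifPn => hv; last first.
    by apply/seteqP; split => t //= h; move: hv; rewrite -h words_lists.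
  apply/seteqP; split => t /= h.
    by move=> j _ k _ /= jn kL; rewrite /table -h !nth_mkseq.
  rewrite -[RHS](tableK hv); apply/eq_in_map => j; rewrite mem_iota => /= jn.
  by apply/eq_in_map => k; rewrite mem_iota => /= kL; apply: h.
case: ifP => // _; apply: bigcapT_measurable => j; apply: bigcapT_measurable => k.
case: (ltnP j n) => jn; last first.
  rewrite (_ : [set t | _] = setT)//; by apply/seteqP; split.
case: (ltnP k L) => kL; last first.
  rewrite (_ : [set t | _] = setT)//; by apply/seteqP; split.
case: (table v j k).
  rewrite (_ : [set t | _] = [set t | X j k t])//.
  by apply/seteqP; split => t /= h //; apply: h.
rewrite (_ : [set t | _] = ~` [set t | X j k t]); first exact: measurableC.
apply/seteqP; split => t /= h; first by rewrite h.
by move=> _ _; apply/negbTE/negP.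
Qed.

(** The cylinders of the hypothesis fix the symbols [0] to [L], hence words of length [L.+1]; this
    is why [mu] with [L] transitions matches [L.+1] levels of the trie. *)
Lemma prob_words n L v : v \in lists n L.+1 ->
  P [set t | words n L.+1 t = v] = (\prod_(w <- v) word_prob p mu w)%:E.
Proof.
move=> hv; rewrite words_eqE// PX; congr EFin.
transitivity (\prod_(w <- mkseq (fun j => mkseq (table v j) L.+1) n) word_prob p mu w).
  rewrite {1}/mkseq big_map; have -> : iota 0 n = index_iota 0 n by rewrite /index_iota subn0.
  by rewrite big_mkord; apply: eq_bigr => j _; rewrite word_probE.
by rewrite tableK.
Qed.

Lemma words_sumE n L (f : seq (seq bool) -> R) t :
  f (words n L t) = \sum_(v <- lists n L) f v * \1_[set t | words n L t = v] t.
Proof.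
have ind v : \1_[set t | words n L t = v] t = (words n L t == v)%:R :> R.
  rewrite indicE; congr ((nat_of_bool _)%:R).
  by apply/idP/eqP => [|h]; [rewrite inE|apply/mem_set].
under eq_bigr do rewrite ind.
rewrite (bigD1_seq (words n L t)) ?words_lists ?uniq_seqs//= eqxx mulr1.
by rewrite big1 ?addr0// => v; rewrite eq_sym => /negbTE ->; rewrite mulr0.
Qed.

Lemma measurable_fun_words n L (f : seq (seq bool) -> R) :
  measurable_fun setT (fun t => f (words n L t)).
Proof.
rewrite (_ : (fun t => _) = (fun t => \sum_(v <- lists n L)
   f v * \1_[set t | words n L t = v] t)); last by apply/funext => t; exact: words_sumE.
apply: measurable_sum => v; apply: measurable_funM => //.
by apply: measurable_indic; exact: measurable_words.
Qed.

Lemma integral_words n L (f : seq (seq bool) -> R) :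
  (\int[P]_t (f (words n L.+1 t))%:E)%E = (Ewords p mu L.+1 n f)%:E.
Proof.
pose A v := [set t | words n L.+1 t = v].
have mA v : measurable (A v) by exact: measurable_words.
have iA v : P.-integrable setT (fun t => (f v)%:E * (\1_(A v) t)%:E)%E.
  by apply: integrableZl => //; exact: integrable_indic.
transitivity (\int[P]_t (\sum_(v <- lists n L.+1) (f v)%:E * (\1_(A v) t)%:E))%E.
  by apply: eq_integral => t _; rewrite words_sumE -sumEFin.
rewrite integral_sum// /Ewords -sumEFin big_seq [RHS]big_seq; apply: eq_bigr => v hv.
rewrite integralZl//; last exact: integrable_indic.
rewrite integral_indic// setIT [X in (_ * X)%E](_ : _ = (\prod_(w <- v) word_prob p mu w)%:E); first by rewrite -EFinM mulrC.
exact: prob_words hv.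
Qed.
End markov_source.

(** * Moments of the number of bucket operations *)

Section buckets_moments.
Context (R : realType) (p : bool -> bool -> R) (mu : bool -> R)
  d (T : measurableType d) (P : probability T R).
Variable X : nat -> nat -> T -> bool.
Hypothesis p01 : forall i j, 0 < p i j < 1.
Hypothesis p_sum : forall i, p i false + p i true = 1.
Hypothesis mu_ge0 : forall i, 0 <= mu i.
Hypothesis mu_sum : mu false + mu true = 1.
Hypothesis mX : forall j k, measurable [set t | X j k t].
Hypothesis PX : forall (n L : nat) (w : nat -> nat -> bool),
  P [set t | forall j k, (j < n)%N -> (k <= L)%N -> X j k t = w j k]
  = ((\prod_(j < n) (mu (w j 0%N) * \prod_(k < L) p (w j k) (w j k.+1)))%R)%:E.

Local Notation source t := (fun j k => X j k t).
Local Notation B n t := (buckets n (source t)).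
Local Notation Btrunc n L t := (trunc_buckets n (source t) L).

Lemma measurable_trunc n L (f : nat -> R) : measurable_fun setT (fun t => f (Btrunc n L t)).
Proof.
rewrite (_ : (fun t => _) = (fun t => f (trie_size L (words X n L t)))); last first.
  by apply/funext => t; rewrite trunc_bucketsE.
exact: (measurable_fun_words mX n L (fun ws => f (trie_size L ws))).
Qed.

Lemma integral_trunc n L (f : nat -> R) :
  (\int[P]_t (f (Btrunc n L.+1 t))%:E)%E = (root_law p mu L n f)%:E.
Proof.
rewrite -Ewords_root_law -(integral_words mX PX).
by apply: eq_integral => t _; rewrite trunc_bucketsE.
Qed.

(** A pointwise limit, valid at every sample point, of functions of finitely many symbols: a string
    not yet separated at length [L] counts as [0], in agreement with the default value of
    [depth]. *)
Lemma measurable_buckets n : measurable_fun setT (fun t => (B n t)%:R : R).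
Proof.
pose g L s : nat := (\sum_(j < n) sep n s j L * \sum_(k < L) ~~ sep n s j k)%N.
have mg L : measurable_fun setT (fun t => (g L (source t))%:R : R).
  rewrite (_ : (fun t => _) = (fun t => (g L (table (words X n L t)))%:R)); last first.
    apply/funext => t; congr (_%:R).
    have e j k : (j < n)%N -> (k <= L)%N ->
        sep n (source t) j k = sep n (table (words X n L t)) j k.
      move=> jn kL; apply: eq_sep => // i l iN lk.
      by rewrite /table !nth_mkseq// (leq_trans lk).
    apply: eq_bigr => j _; rewrite e//; congr muln; apply: eq_bigr => k _.
    by rewrite e// ltnW.
  exact: (measurable_fun_words mX n L (fun ws => (g L (table ws))%:R)).
apply: (@measurable_fun_cvg _ _ _ _ (fun L t => (g L (source t))%:R)) => // t _.
have [L0 hL] := buckets_approx n (source t).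
apply: cvg_near_cst; exists L0 => // L /= LL.
by rewrite /g hL.
Qed.

Let F n (f : nat -> R) t : \bar R := limn (fun L => (f (Btrunc n L.+1 t))%:E).

(** Monotone convergence along the levels. The limit is taken in the extended reals, since it may be
    infinite where strings coincide. *)
Let integral_lim n f (l : R) : (forall x, 0 <= f x) ->
  (forall x y, (x <= y)%N -> f x <= f y) ->
  root_law p mu L n f @[L --> \oo] --> l ->
  measurable_fun setT (F n f) /\ (\int[P]_t F n f t)%E = l%:E.
Proof.
move=> f0 fnd fl.
have mg L : measurable_fun setT (fun t => (f (Btrunc n L.+1 t))%:E).
  by apply/measurable_EFinP; exact: measurable_trunc.
have nd t : setT t -> nondecreasing_seq (fun L => (f (Btrunc n L.+1 t))%:E).
  by move=> _ K L KL; rewrite lee_fin; apply: fnd; apply: ler_trunc_buckets.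
split.
  apply: (emeasurable_fun_cvg (fun L t => (f (Btrunc n L.+1 t))%:E)) => // t _.
  by apply: ereal_nondecreasing_is_cvgn; exact: nd.
have := cvg_monotone_convergence (mu := P) measurableT mg (fun L t _ => f0 _) nd.
under eq_cvg do rewrite integral_trunc.
move=> h; apply: cvg_unique h _; first exact: ereal_hausdorff.
by apply: cvg_EFin => //; apply: nearW.
Qed.

(** The limit of the truncated counts has finite mean, hence is finite almost everywhere, while it
    is infinite as soon as one string is never separated. *)
Lemma ae_separated n :
  {ae P, forall t, forall j : 'I_n, exists k, sep n (source t) j k}.
Proof.
have nat_nd x y : (x <= y)%N -> x%:R <= y%:R :> R by rewrite ler_nat.
have [mF iF] := integral_lim (fun x => ler0n R x) nat_nd
  (cvg_root_mean p01 p_sum mu_sum (n := n)).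
have F0 t : (0 <= F n (fun x => x%:R) t)%E.
  apply: lime_ge; last by apply: nearW => L; rewrite lee_fin.
  apply: ereal_nondecreasing_is_cvgn => K L KL; rewrite lee_fin ler_nat.
  exact: ler_trunc_buckets.
have intF : P.-integrable setT (F n (fun x => x%:R)).
  apply/integrableP; split => //; rewrite (eq_integral (F n (fun x => x%:R))).
    by rewrite iF ltry.
  by move=> t _; rewrite gee0_abs.
apply: filterS (integrable_ae measurableT intF) => t /(_ I) fin j.
apply: contrapT => h; move: fin; suff -> : F n (fun x => x%:R) t = +oo%E by [].
apply/cvg_lim => //; apply/cvgeryP/cvgryPge => A; near=> L.
have : A <= L%:R by near: L; exact: nbhs_infty_ger.
move/le_trans; apply; rewrite ler_nat (leq_trans (leqnSn L))//.
exact: (trunc_buckets_ge (j := j)).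
Unshelve. all: end_near. Qed.

Lemma ae_trunc_cvg n (f : nat -> R) :
  {ae P, forall t, (f (Btrunc n L.+1 t))%:E @[L --> \oo] --> (f (B n t))%:E}.
Proof.
apply: filterS (ae_separated n) => t /trunc_buckets_cvg[L0 hL].
apply: cvg_near_cst; exists L0 => // L /= LL.
by rewrite hL// (leq_trans LL).
Qed.

Lemma measurable_fun_buckets n (f : R -> R) : measurable_fun setT f ->
  measurable_fun setT (fun t => f (B n t)%:R).
Proof. by move=> mf; exact: measurableT_comp mf (measurable_buckets n). Qed.

Let moment n (f : R -> R) (l : R) : measurable_fun setT f -> (forall x, 0 <= f x%:R) ->
  (forall x y, (x <= y)%N -> f x%:R <= f y%:R) ->
  root_law p mu L n (fun x => f x%:R) @[L --> \oo] --> l ->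
  (\int[P]_t (f (B n t)%:R)%:E)%E = l%:E.
Proof.
move=> mf f0 fnd /(integral_lim f0 fnd)[mF <-].
apply: ae_eq_integral => //.
  by apply/measurable_EFinP; exact: measurable_fun_buckets.
apply: filterS (ae_trunc_cvg n (fun x => f x%:R)) => t h _.
by apply/esym/cvg_lim.
Qed.

Lemma buckets_mean n : (\int[P]_t ((B n t)%:R : R)%:E)%E = (root_mean p mu n)%:E.
Proof.
apply: (@moment n id) => //; first by move=> x y; rewrite ler_nat.
exact: cvg_root_mean.
Qed.

Lemma buckets_sqr n : (\int[P]_t ((B n t)%:R ^+ 2 : R)%:E)%E =
  (root_var p mu n + root_mean p mu n ^+ 2)%:E.
Proof.
apply: (@moment n (fun x => x ^+ 2)).
- by apply: measurable_funX; exact: measurable_id.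
- by move=> x; exact: sqr_ge0.
- by move=> x y xy; rewrite lerXn2r ?nnegrE ?ler_nat.
- exact: cvg_root_sqr.
Qed.

Lemma integrable_buckets n : P.-integrable setT (fun t => ((B n t)%:R : R)%:E).
Proof.
apply/integrableP; split; first by apply/measurable_EFinP; exact: measurable_buckets.
under eq_integral do rewrite gee0_abs ?lee_fin//.
by rewrite buckets_mean ltry.
Qed.

Lemma integrable_buckets_sqr n : P.-integrable setT (fun t => ((B n t)%:R ^+ 2 : R)%:E).
Proof.
apply/integrableP; split.
  by apply/measurable_EFinP; apply: measurable_funX; exact: measurable_buckets.
under eq_integral do rewrite gee0_abs ?lee_fin ?sqr_ge0//.
by rewrite buckets_sqr ltry.
Qed.

Lemma buckets_var n :
  (\int[P]_t (((B n t)%:R - root_mean p mu n) ^+ 2)%:E)%E = (root_var p mu n)%:E.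
Proof.
set e := root_mean p mu n.
have i1 := integrableZl measurableT (- (2 * e)) (integrable_buckets n).
have ic : P.-integrable setT (fun=> (e ^+ 2)%:E) by exact: finite_measure_integrable_cst.
transitivity (\int[P]_t (((B n t)%:R ^+ 2)%:E + ((- (2 * e))%:E * ((B n t)%:R)%:E + (e ^+ 2)%:E)))%E.
  by apply: eq_integral => t _; rewrite -EFinM -!EFinD; congr EFin; ring.
rewrite integralD//; [|exact: integrable_buckets_sqr|exact: integrableD].
rewrite integralD// integralZl//; last exact: integrable_buckets.
rewrite buckets_sqr buckets_mean integral_cst//.
rewrite [X in (_ + (_ + _ * X))%E](_ : _ = 1%E); last exact: (probability_setT P).
rewrite mule1 -EFinM -!EFinD; congr EFin; rewrite -/e; ring.
Qed.

Lemma cvg_root_law_cos n t a :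
  root_law p mu L n (fun x => cos (t * (x%:R - root_mean p mu n) + a)) @[L --> \oo]
  --> \int[P]_x cos (t * ((B n x)%:R - root_mean p mu n) + a).
Proof.
pose f (x : R) := cos (t * (x - root_mean p mu n) + a).
have cf : continuous f.
  move=> x; apply: continuous_comp; last exact: continuous_cos.
  apply: cvgD; last exact: cvg_cst.
  by apply: cvgM; [exact: cvg_cst|apply: cvgB; [exact: cvg_id|exact: cvg_cst]].
have mf := continuous_measurable_fun cf.
have i1 : P.-integrable setT (fun _ : T => 1%E) by exact: finite_measure_integrable_cst.
have mL L : measurable_fun setT (fun x => (f (Btrunc n L.+1 x)%:R)%:E).
  by apply/measurable_EFinP; exact: (measurable_trunc n L.+1 (fun x => f x%:R)).
have mB : measurable_fun setT (fun x => (f (B n x)%:R)%:E).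
  by apply/measurable_EFinP; exact: measurable_fun_buckets.
have [iB _ h] := @dominated_convergence _ _ _ P setT measurableT _ _ _ mL mB
  (filterS (fun x h _ => h) (ae_trunc_cvg n (fun x => f x%:R))) i1
  (aeW _ (fun x L _ => cos_max _)).
have hB : (\int[P]_x (f (B n x)%:R)%:E)%E = (\int[P]_x f (B n x)%:R)%:E.
  by rewrite /Rintegral fineK//; exact: integrable_fin_num.
move: h; rewrite hB => /fine_cvgP[_]; apply: cvg_trans; apply: near_eq_cvg.
by apply: nearW => L /=; rewrite (integral_trunc n L (fun x => f x%:R)).
Qed.
End buckets_moments.

(** * Asymptotics *)

Section asymptotics.
Variables (R : realType) (p : bool -> bool -> R) (mu : bool -> R).
Hypothesis p01 : forall i j, 0 < p i j < 1.
Hypothesis p_sum : forall i, p i false + p i true = 1.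
Hypothesis mu_ge0 : forall i, 0 <= mu i.
Hypothesis mu_sum : mu false + mu true = 1.
Local Notation e := (root_mean p mu).
Local Notation v := (root_var p mu).
Let y (n : nat) : R := ln n%:R.

Lemma cvg_dist_le (f g : nat -> R) (l : R) :
  (\forall n \near \oo, `|f n - l| <= g n) -> g n @[n --> \oo] --> 0 -> f n @[n --> \oo] --> l.
Proof.
move=> fg g0; apply/cvgrPdist_lt => eps eps0.
have /cvgrPdist_lt/(_ _ eps0) g1 := g0.
near=> n; rewrite distrC; apply: le_lt_trans (_ : g n < eps); first by near: n.
have : `|0 - g n| < eps by near: n.
by rewrite sub0r normrN; apply: le_lt_trans; exact: ler_norm.
Unshelve. all: end_near. Qed.

Let near_ln (A : R) : \forall n \near \oo, A <= y n.
Proof.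
near=> n; have h : expR A <= n%:R by near: n; exact: nbhs_infty_ger.
by rewrite -[A]expRK ler_ln// ?posrE ?(lt_le_trans _ h)// expR_gt0.
Unshelve. all: end_near. Qed.

Let cvg_Vln : (y n)^-1 @[n --> \oo] --> 0.
Proof.
apply/gtr0_cvgV0; last exact/cvgryPge/near_ln.
by near=> n; apply: lt_le_trans (_ : 1 <= y n) => //; near: n; exact: near_ln.
Unshelve. all: end_near. Qed.

Let harm_bounds n : (0 < n)%N -> (y n <= harm n <= 1 + y n)%R.
Proof.
case: n => // n _; rewrite ln_le_harm//=; exact: harm_le_ln.
Qed.

Lemma root_mean_asymp : exists C : R, \forall n \near \oo,
  `|e n - (n%:R * ln n%:R) / Hrate p| <= C * n%:R.
Proof.
have [C C0 hC] := root_mean_approx p01 p_sum mu_ge0 mu_sum.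
have H0 : 0 < Hrate p by exact: Hrate_gt0.
exists (C + (Hrate p)^-1); near=> n.
have n0 : (0 < n)%N by near: n; exact: nbhs_infty_gt.
have /andP[h1 h2] := harm_bounds n0.
rewrite mulrDl; apply: le_trans (ler_distD (n%:R * harm n / Hrate p) _ _) _.
apply: lerD; first exact: hC.
rewrite -mulrBl -mulrBr !normrM normfV (gtr0_norm H0) ger0_norm//.
rewrite ger0_norm; last by rewrite subr_ge0.
rewrite [leRHS]mulrC ler_wpM2r// ?invr_ge0 ?(ltW H0)//.
by rewrite -[leRHS]mulr1 ler_wpM2l//; rewrite /y in h2 *; lra.
Unshelve. all: end_near. Qed.

(** The choice [lam = 1 / sqrt (ln n)] balances [lam * n * harm n] against [n / lam]; the summand
    with [s] pays for replacing [harm n] by [ln n]. *)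
Let sqrt_bound (C s Y h N : R) : 0 <= C -> 0 <= s -> 1 <= Y -> Y <= h <= 1 + Y -> 0 <= N ->
  C * ((Num.sqrt Y)^-1 * (N * h) + N / (Num.sqrt Y)^-1) + s * (N * (h - Y))
  <= (3 * C + s) * (N * Num.sqrt Y).
Proof.
move=> C0 s0 Y1 /andP[h1 h2] N0; set z := Num.sqrt Y.
have z1 : 1 <= z by rewrite -[X in X <= _]sqrtr1 ler_wsqrtr.
have zz : Y = z ^+ 2 by rewrite sqr_sqrtr// (le_trans _ Y1).
have zV : z^-1 * h <= 2 * z.
  rewrite mulrC ler_pdivrMr ?(lt_le_trans _ z1)//; rewrite zz in h2.
  by have : 1 <= z ^+ 2; [exact: exprn_ege1|rewrite expr2 in h2 *; lra].
have k1 : N * (z^-1 * h) <= N * (2 * z) by exact: ler_wpM2l.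
have k2 : s * (N * (h - Y)) <= s * (N * z).
  by apply: ler_wpM2l => //; apply: ler_wpM2l => //; lra.
have k3 : C * (z^-1 * (N * h) + N / z^-1) <= C * (3 * (N * z)).
  by apply: ler_wpM2l => //; rewrite invrK mulrCA; lra.
by apply: le_trans (lerD k3 k2) _; lra.
Qed.

Let s0 : 0 <= sigma2 p. Proof. exact: sigma2_ge0. Qed.

Lemma root_var_asymp : exists2 C : R, 0 <= C & \forall n \near \oo,
  `|v n - sigma2 p * (n%:R * ln n%:R)| <= C * (n%:R * Num.sqrt (ln n%:R)).
Proof.
have [C C0 hC] := root_var_approx p01 p_sum mu_ge0 mu_sum.
exists (3 * C + sigma2 p); first by apply: addr_ge0 => //; apply: mulr_ge0.
near=> n; have n0 : (0 < n)%N by near: n; exact: nbhs_infty_gt.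
have y1 : 1 <= y n by near: n; exact: near_ln.
have hb := harm_bounds n0; have /andP[h1 h2] := hb.
have z0 : 1 <= Num.sqrt (y n) by rewrite -[X in X <= _]sqrtr1 ler_wsqrtr.
apply: le_trans (sqrt_bound C0 s0 y1 hb (ler0n R n)).
apply: le_trans (ler_distD (sigma2 p * (n%:R * harm n)) _ _) _.
apply: lerD.
  by apply: hC; rewrite invr_gt0 invf_le1 ?(lt_le_trans _ z0)//.
rewrite -!mulrBr ger0_norm//.
by apply: mulr_ge0 => //; apply: mulr_ge0; rewrite ?subr_ge0.
Unshelve. all: end_near. Qed.

Hypothesis s_gt0 : 0 < sigma2 p.

Lemma cvg_root_var : v n / (n%:R * ln n%:R) @[n --> \oo] --> sigma2 p.
Proof.
have [C C0 hC] := root_var_asymp.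
apply: (@cvg_dist_le _ (fun n => C * Num.sqrt (y n)^-1)).
  near=> n; have n0 : 0 < n%:R :> R by rewrite ltr0n; near: n; exact: nbhs_infty_gt.
  have y1 : 1 <= y n by near: n; exact: near_ln.
  have y0 : 0 < y n by exact: lt_le_trans y1.
  have z0 : 0 < Num.sqrt (y n) by rewrite sqrtr_gt0.
  have h : `|v n - sigma2 p * (n%:R * y n)| <= C * (n%:R * Num.sqrt (y n)) by near: n.
  have ny : 0 < n%:R * y n by rewrite mulr_gt0.
  rewrite -/(y n) -[X in _ - X](mulfK (lt0r_neq0 ny)) -mulrBl normrM normfV (gtr0_norm ny).
  rewrite ler_pdivrMr//; apply: le_trans h _; rewrite sqrtrV ?(ltW y0)//.
  rewrite le_eqVlt; apply/orP; left; apply/eqP.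
  have := sqr_sqrtr (ltW y0); move: (Num.sqrt (y n)) z0 => z z0 <-; field.
  by rewrite gt_eqF.
have := cvgM (cvg_cst C) (continuous_cvg _ (@sqrt_continuous R 0) cvg_Vln).
rewrite sqrtr0 mulr0 => h; exact: h.
Unshelve. all: end_near. Qed.

Lemma cvg_harm_ln : sigma2 p * (n%:R * harm n) / (n%:R * ln n%:R) @[n --> \oo] --> sigma2 p.
Proof.
apply: (@cvg_dist_le _ (fun n => sigma2 p * (y n)^-1)).
  near=> n; have n0 : (0 < n)%N by near: n; exact: nbhs_infty_gt.
  have y1 : 1 <= y n by near: n; exact: near_ln.
  have y0 : 0 < y n by exact: lt_le_trans y1.
  have /andP[h1 h2] := harm_bounds n0.
  have -> : sigma2 p * (n%:R * harm n) / (n%:R * ln n%:R) - sigma2 p =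
      sigma2 p * ((harm n - y n) / y n).
    by rewrite -/(y n); field; rewrite !gt_eqF// ltr0n.
  rewrite normrM ger0_norm//; apply: ler_wpM2l => //.
  rewrite ger0_norm; last by apply: divr_ge0; rewrite ?subr_ge0// ltW.
  by rewrite -[leRHS]mul1r ler_wpM2r ?invr_ge0 ?(ltW y0)//; lra.
have := cvgM (cvg_cst (sigma2 p)) cvg_Vln; rewrite mulr0 => h; exact: h.
Unshelve. all: end_near. Qed.

Lemma root_var_gt0 : \forall n \near \oo, 0 < v n.
Proof.
have s2 : 0 < sigma2 p / 2 by rewrite divr_gt0.
have /cvgrPdist_lt/(_ _ s2) h := cvg_root_var.
near=> n; have n0 : 0 < n%:R :> R by rewrite ltr0n; near: n; exact: nbhs_infty_gt.
have y1 : 1 <= y n by near: n; exact: near_ln.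
have y0 : 0 < y n by exact: lt_le_trans y1.
have : `|sigma2 p - v n / (n%:R * y n)| < sigma2 p / 2 by near: n.
move=> /ltr_normlP[_ h1]; have : 0 < v n / (n%:R * y n) by lra.
by rewrite pmulr_lgt0// invr_gt0 mulr_gt0.
Unshelve. all: end_near. Qed.

Let near_ny : \forall n \near \oo, (n%:R : R) != 0 /\ y n != 0.
Proof.
near=> n; split; first by rewrite pnatr_eq0 -lt0n; near: n; exact: nbhs_infty_gt.
by rewrite gt_eqF//; apply: lt_le_trans (_ : 1 <= y n) => //; near: n; exact: near_ln.
Unshelve. all: end_near. Qed.

(** The Gaussian value was computed with [sigma2 p * n * harm n], while the normalization uses the
    true variance. *)
Lemma cvg_harm_root_var : sigma2 p * (n%:R * harm n) / v n @[n --> \oo] --> (1 : R).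
Proof.
have s' : sigma2 p != 0 by rewrite gt_eqF.
have h : (sigma2 p * (n%:R * harm n) / (n%:R * ln n%:R)) * (v n / (n%:R * ln n%:R))^-1
  @[n --> \oo] --> sigma2 p / sigma2 p by apply: cvgM cvg_harm_ln (cvgV s' cvg_root_var).
rewrite divff// in h; apply: cvg_trans h; apply: near_eq_cvg; near=> n.
have [n0 y0] : (n%:R : R) != 0 /\ y n != 0 by near: n; exact: near_ny.
have v0 : 0 < v n by near: n; exact: root_var_gt0.
by rewrite /= -/(y n); field; rewrite n0 y0 gt_eqF.
Unshelve. all: end_near. Qed.

Lemma cvg_n_root_var : n%:R / v n @[n --> \oo] --> (0 : R).
Proof.
have s' : sigma2 p != 0 by rewrite gt_eqF.
have h : (y n)^-1 * (v n / (n%:R * ln n%:R))^-1 @[n --> \oo] --> 0 / sigma2 p.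
  by apply: cvgM cvg_Vln (cvgV s' cvg_root_var).
rewrite mul0r in h; apply: cvg_trans h; apply: near_eq_cvg; near=> n.
have [n0 y0] : (n%:R : R) != 0 /\ y n != 0 by near: n; exact: near_ny.
have v0 : 0 < v n by near: n; exact: root_var_gt0.
by rewrite /= -/(y n); field; rewrite n0 y0 gt_eqF.
Unshelve. all: end_near. Qed.
End asymptotics.

(** * The central limit theorem *)

Section buckets_clt.
Context (R : realType) (p : bool -> bool -> R) (mu : bool -> R)
  d (T : measurableType d) (P : probability T R).
Variable X : nat -> nat -> T -> bool.
Hypothesis p01 : forall i j, 0 < p i j < 1.
Hypothesis p_sum : forall i, p i false + p i true = 1.
Hypothesis p_neq : exists i j, p i j != 2^-1.
Hypothesis mu_ge0 : forall i, 0 <= mu i.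
Hypothesis mu_sum : mu false + mu true = 1.
Hypothesis mX : forall j k, measurable [set t | X j k t].
Hypothesis PX : forall (n L : nat) (w : nat -> nat -> bool),
  P [set t | forall j k, (j < n)%N -> (k <= L)%N -> X j k t = w j k]
  = ((\prod_(j < n) (mu (w j 0%N) * \prod_(k < L) p (w j k) (w j k.+1)))%R)%:E.
Local Notation B n t := (buckets n (fun j k => X j k t)).
Local Notation e := (root_mean p mu).
Local Notation v := (root_var p mu).

Lemma buckets_gauss : exists2 C : R, 0 <= C & forall k t, 0 < k <= 1 -> forall n a,
  `|\int[P]_x cos (t * ((B n x)%:R - e n) + a)
    - expR (- (t ^+ 2 / 2 * (sigma2 p * (n%:R * harm n)))) * cos a|
  <= k * t ^+ 2 * (sigma2 p * (n%:R * harm n)) + C * (t ^+ 2 / k) * n%:R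
   + C * (t ^+ 4 / k) * n%:R ^+ 2.
Proof.
have [C C0 hC] := root_law_gauss p01 p_sum mu_ge0 mu_sum.
exists C => // k t k01 n a.
set E := expR _ * _; set U := (X in _ <= X).
have r0 := coll_rate_ge0 p; have r1 := coll_rate_lt1 p01 p_sum.
have c1 : `|root_law p mu L n (fun x => cos (t * (x%:R - e n) + a)) - E| @[L --> \oo]
    --> `|\int[P]_x cos (t * ((B n x)%:R - e n) + a) - E|.
  apply: cvg_norm; apply: cvgB; last exact: cvg_cst.
  exact: (cvg_root_law_cos p01 p_sum mu_sum mX PX).
have c2 : U + 2 * n%:R ^+ 2 * coll_rate p ^+ L @[L --> \oo] --> U + 2 * n%:R ^+ 2 * 0.
  apply: cvgD; first exact: cvg_cst.
  by apply: cvgM; [exact: cvg_cst|apply: cvg_expr; rewrite ger0_norm].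
rewrite mulr0 addr0 in c2; apply: (ler_cvg_to c1 c2).
by apply: nearW => L; exact: hC.
Qed.

Let s_gt0 : 0 < sigma2 p. Proof. exact: sigma2_gt0. Qed.

Let Z n t := ((B n t)%:R - e n) / Num.sqrt (v n).

Let r n : R := sigma2 p * (n%:R * harm n) / v n.
Let q n : R := n%:R / v n.

Let r1 : r n @[n --> \oo] --> (1 : R). Proof. exact: cvg_harm_root_var. Qed.
Let q0 : q n @[n --> \oo] --> (0 : R). Proof. exact: cvg_n_root_var. Qed.
Let near_v : \forall n \near \oo, 0 < v n. Proof. exact: root_var_gt0. Qed.

(** With [t = s / sqrt (v n)] both [t^2 * n] and [t^4 * n^2] tend to [0], so for fixed [k] only the
    error [k * s^2 * r n] survives, and [r n] tends to [1]. *)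
Lemma cvg_buckets_cos s a :
  \int[P]_t cos (s * Z n t + a) @[n --> \oo] --> expR (- (s ^+ 2 / 2)) * cos a.
Proof.
have [C C0 hC] := buckets_gauss.
have bound k n : 0 < k <= 1 -> 0 < v n ->
    `|\int[P]_t cos (s * Z n t + a) - expR (- (s ^+ 2 / 2 * r n)) * cos a|
    <= k * s ^+ 2 * r n + C / k * (s ^+ 2 * q n + s ^+ 4 * q n ^+ 2).
  move=> k01 v0; have := hC k (s / Num.sqrt (v n)) k01 n a.
  have -> : (s / Num.sqrt (v n)) ^+ 2 = s ^+ 2 / v n.
    by rewrite expr_div_n sqr_sqrtr// ltW.
  have -> : (s / Num.sqrt (v n)) ^+ 4 = s ^+ 4 / v n ^+ 2.
    by rewrite expr_div_n; congr (_ / _); rewrite (exprM _ 2 2) sqr_sqrtr// ltW.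
  have k0 : k != 0 by case/andP: k01 => /lt0r_neq0.
  have vn : v n != 0 by rewrite gt_eqF.
  have -> : s ^+ 2 / v n / 2 * (sigma2 p * (n%:R * harm n)) = s ^+ 2 / 2 * r n.
    by rewrite /r; field.
  have -> : k * (s ^+ 2 / v n) * (sigma2 p * (n%:R * harm n))
     + C * (s ^+ 2 / v n / k) * n%:R + C * (s ^+ 4 / v n ^+ 2 / k) * n%:R ^+ 2 =
     k * s ^+ 2 * r n + C / k * (s ^+ 2 * q n + s ^+ 4 * q n ^+ 2).
    by rewrite /r /q; field; rewrite k0 vn.
  rewrite (@eq_Rintegral _ _ _ P setT (fun t => cos (s * Z n t + a))) // => t _.
  by congr cos; rewrite /Z; ring.
have cE : expR (- (s ^+ 2 / 2 * r n)) * cos a @[n --> \oo]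
    --> expR (- (s ^+ 2 / 2 * 1)) * cos a.
  apply: cvgM; last exact: cvg_cst.
  apply: continuous_cvg; first exact: continuous_expR.
  by apply: cvgN; apply: cvgM => //; exact: cvg_cst.
rewrite mulr1 in cE.
have cQ k : C / k * (s ^+ 2 * q n + s ^+ 4 * q n ^+ 2) @[n --> \oo]
    --> C / k * (s ^+ 2 * 0 + s ^+ 4 * 0 ^+ 2).
  apply: cvgM; first exact: cvg_cst.
  apply: cvgD; apply: cvgM => //; [exact: cvg_cst|exact: cvg_cst|].
  by rewrite expr2; under eq_cvg do rewrite expr2; exact: cvgM.
apply/cvgrPdist_lt => eps eps0.
have S0 : 0 < 8 * (s ^+ 2 + 1) by rewrite mulr_gt0// ltr_wpDl ?sqr_ge0.
(* Small enough that [k * s^2 * r n <= eps / 4] once [r n <= 2]; adding [1] to [s^2] keeps the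
   denominator positive at [s = 0]. *)
pose k := Num.min 1 (eps / (8 * (s ^+ 2 + 1))).
have k0 : 0 < k by rewrite lt_min ltr01 divr_gt0.
have k1 : k <= 1 by rewrite ge_min lexx.
have ks : k * s ^+ 2 <= eps / 8.
  apply: le_trans (_ : k * (s ^+ 2 + 1) <= _); first by rewrite ler_wpM2l ?(ltW k0)// lerDl.
  apply: le_trans (_ : eps / (8 * (s ^+ 2 + 1)) * (s ^+ 2 + 1) <= _).
    by rewrite ler_wpM2r ?addr_ge0 ?sqr_ge0// ge_min lexx orbT.
  by rewrite le_eqVlt; apply/orP; left; apply/eqP; field; rewrite gt_eqF// ltr_wpDl ?sqr_ge0.
have e4 : 0 < eps / 4 by rewrite divr_gt0.
have {cQ} := cQ k; rewrite expr0n /= !mulr0 addr0 mulr0 => /cvgrPdist_lt/(_ _ e4) cQ.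
have /cvgrPdist_lt/(_ _ e4) {}cE := cE.
have /cvgrPdist_lt/(_ _ ltr01) c1 := r1.
near=> n.
have v0 : 0 < v n by near: n.
have hE : `|expR (- (s ^+ 2 / 2)) * cos a - expR (- (s ^+ 2 / 2 * r n)) * cos a| < eps / 4.
  by near: n.
have hQ : `|0 - C / k * (s ^+ 2 * q n + s ^+ 4 * q n ^+ 2)| < eps / 4 by near: n.
have hr : `|1 - r n| < 1 by near: n.
have k01 : 0 < k <= 1 by rewrite k0.
apply: le_lt_trans (ler_distD (expR (- (s ^+ 2 / 2 * r n)) * cos a) _ _) _.
rewrite [X in _ + X]distrC.
have hb := bound k n k01 v0.
have kr : k * s ^+ 2 * r n <= eps / 8 * 2.
  apply: ler_pM => //; first by rewrite mulr_ge0 ?sqr_ge0// ltW.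
    by move: hr; rewrite ltr_norml => /andP[_ h]; lra.
  by move: hr; rewrite ltr_norml => /andP[h _]; lra.
move: hQ; rewrite sub0r normrN => /(le_lt_trans (ler_norm _)) hQ.
lra.
Unshelve. all: end_near. Qed.

Let mZ n : measurable_fun setT (Z n).
Proof.
apply: measurable_funM => //; apply: measurable_funB => //.
exact: (measurable_buckets mX).
Qed.

(** The normalized variable has second moment [1], and [|Z| <= (Z^2 + 1) / 2]. *)
Let Z_L1 : \forall n \near \oo, P.-integrable setT (EFin \o Z n) /\ \int[P]_t `|Z n t| <= 1.
Proof.
near=> n; have v0 : 0 < v n by near: n.
have i1 : P.-integrable setT (fun t => (((B n t)%:R - e n) ^+ 2)%:E).
  apply/integrableP; split.
    apply/measurable_EFinP; apply: measurable_funX; apply: measurable_funB => //.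
    exact: (measurable_buckets mX).
  under eq_integral do rewrite gee0_abs ?lee_fin ?sqr_ge0//.
  by rewrite (buckets_var p01 p_sum mu_sum mX PX) ltry.
have ic c : P.-integrable setT (EFin \o (fun _ : T => c : R)).
  exact: finite_measure_integrable_cst.
have i2 : P.-integrable setT (EFin \o (fun t => (2 * v n)^-1 * ((B n t)%:R - e n) ^+ 2)).
  exact: (integrableZl measurableT _ i1).
have i3 : P.-integrable setT
    (EFin \o (fun t => (2 * v n)^-1 * ((B n t)%:R - e n) ^+ 2 + 2^-1)).
  exact: (integrableD measurableT i2 (ic 2^-1)).
have hle t : `|Z n t| <= (2 * v n)^-1 * ((B n t)%:R - e n) ^+ 2 + 2^-1.
  have -> : (2 * v n)^-1 * ((B n t)%:R - e n) ^+ 2 = `|Z n t| ^+ 2 / 2.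
    by rewrite real_normK ?num_real// expr_div_n sqr_sqrtr ?(ltW v0)//; field; rewrite gt_eqF.
  by have := sqr_ge0 (`|Z n t| - 1); lra.
have iZ : P.-integrable setT (EFin \o Z n).
  apply: le_integrable i3 => //; first exact/measurable_EFinP.
  by move=> t _ /=; rewrite lee_fin (le_trans (hle t))// ler_norm.
split=> //.
apply: le_trans (_ : \int[P]_t ((2 * v n)^-1 * ((B n t)%:R - e n) ^+ 2 + 2^-1) <= _).
  by apply: le_Rintegral => //; exact: (integrable_abse iZ).
rewrite (RintegralD measurableT i2 (ic 2^-1)) (RintegralZl _ measurableT i1).
rewrite /Rintegral (buckets_var p01 p_sum mu_sum mX PX) integral_cst//.
rewrite [X in fine (_ * X)%E](_ : _ = 1%E); last exact: (probability_setT P).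
by rewrite mule1 /= le_eqVlt; apply/orP; left; apply/eqP; field; rewrite gt_eqF.
Unshelve. all: end_near. Qed.

Lemma buckets_clt (x : R) :
  fine (P [set t | Z n t <= x]) @[n --> \oo] --> Phi x.
Proof. exact: levy_cdf mZ Z_L1 cvg_buckets_cos x. Qed.
End buckets_clt.

Theorem theorem2p1 (R : realType) (p : bool -> bool -> R) (mu : bool -> R)
  (d : measure_display) (T : measurableType d) (P : probability T R)
  (X : nat -> nat -> T -> bool) :
  (* transition matrix with entries in (0,1), not all equal to 1/2 *)
  (forall i j, 0 < p i j < 1) ->
  (forall i, p i false + p i true = 1) ->
  (exists i j, p i j != 2^-1) ->
  (* initial distribution mu *)
  (forall i, 0 <= mu i) -> mu false + mu true = 1 ->
  (* X j k : k-th symbol (from 0) of the j-th string; measurable *)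
  (forall j k, measurable [set t | X j k t]) ->
  (* the strings are i.i.d. Markov(mu, p): law on all finite cylinders *)
  (forall (n L : nat) (w : nat -> nat -> bool),
     P [set t | forall j k, (j < n)%N -> (k <= L)%N -> X j k t = w j k]
     = ((\prod_(j < n) (mu (w j 0%N) *
           \prod_(k < L) p (w j k) (w j k.+1)))%R)%:E) ->
  let B n t := buckets n (fun j k => X j k t) in
  exists (e v : nat -> R),
    (forall n, (\int[P]_t ((B n t)%:R : R)%:E)%E = (e n)%:E) /\
    (forall n, (\int[P]_t (((B n t)%:R - e n) ^+ 2)%:E)%E = (v n)%:E) /\
    (exists C : R, \forall n \near \oo,
        `| e n - (n%:R * ln n%:R) / Hrate p | <= C * n%:R) /\
    (exists C : R, \forall n \near \oo,
        `| v n - sigma2 p * (n%:R * ln n%:R) | <= C * (n%:R * Num.sqrt (ln n%:R))) /\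
    (forall x : R,
        (fun n : nat => fine (P [set t | ((B n t)%:R - e n) / Num.sqrt (v n) <= x]))
          @ \oo --> Phi x).
Proof.
move=> p01 p_sum p_neq mu_ge0 mu_sum mX PX B.
exists (root_mean p mu), (root_var p mu); split; [|split; [|split; [|split]]].
- by move=> n; exact: buckets_mean.
- by move=> n; exact: buckets_var.
- exact: root_mean_asymp.
- by have [C _ hC] := root_var_asymp p01 p_sum mu_ge0 mu_sum; exists C.
- by move=> x; exact: buckets_clt.
Qed.
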